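(* Assume $\delta<1$. Then: (i) if $\gamma\delta\le1$, then $\bar F(y)=F(y)\mathbf 1_{[0,\hat y]}(y)-m\,\mathbf 1_{(\hat y,\infty)}(y)$ for all $y\ge0$; (ii) if $\gamma\delta>1$, then $\bar F(y)=F(y)\mathbf 1_{[0,\tilde y]}(y)+(w_0(y)-m)\mathbf 1_{(\tilde y,\infty)}(y)$ for all $y\ge0$. Moreover, $\bar F$ is twice continuously differentiable except at a single point. Furthermore, when $\gamma\delta>1$, $\bar F$ is decreasing and there exist $(\bar c_0,\bar c_1)\in(0,\infty)^2$ such that $\bar c_0(-1-y^\gamma)\le\bar F(y)\le\bar c_1(1-y^\gamma)$ for all $y\ge0$.
   Context: Constants: $r>0$, $\rho>0$, $\delta:=r/\rho$, $m>0$. ''Increasing'' and ''decreasing'' mean strictly so. The function $u:[0,\infty)\to[0,\infty)$ is increasing, strictly concave, twice continuously differentiable, $u(0)=0$, $\lim_{\pi\to\infty}u'(\pi)=0$, and $c_0(-1+\pi^{1/\gamma})\le u(\pi)\le c_1(1+\pi^{1/\gamma})$ for all $\pi\ge0$, for some $(c_0,c_1)\in(0,\infty)^2$ and some $\gamma>1$. Set $F(y):=-u^{-1}(y)$ for $y\ge0$ and $F^\star(p):=\inf_{y\ge0}\{yp-F(y)\}$ for $p\in\mathbb R$. Face-lifted utility: let $\mathcal B_{\mathbb R_+}$ be the set of Borel-measurable maps from $\mathbb R_+$ to $\mathbb R_+$. For $y_0\ge0$ and $p\in\mathcal B_{\mathbb R_+}$ let $y^{y_0,p}$ solve $\dot y^{y_0,p}(t)=r(y^{y_0,p}(t)-p(t))$,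 $t>0$, $y^{y_0,p}(0)=y_0$, and let $T_0^{y_0,p}:=\inf\{t\ge0:y^{y_0,p}(t)\le0\}$. Then $$\bar F(y_0):=\sup_{p\in\mathcal B_{\mathbb R_+}}\ \sup_{T\in[0,T_0^{y_0,p}]}\Big\{\mathrm e^{-\rho T}F\big(y^{y_0,p}(T)\big)\mathbf 1_{\{T<\infty\}}+\int_0^T\rho\,\mathrm e^{-\rho t}\big(-m+F(p(t))\big)\mathrm dt\Big\}.$$ Standing assumption (for $\delta\neq1$): the function $F_{\delta m}(y):=F^\star(\delta F'(y))-\delta yF'(y)+F(y)+m$, $y\ge0$, is decreasing with $\lim_{y\to\infty}F_{\delta m}(y)=-\infty$. Set $\bar y:=\inf\{y\ge0:F_{\delta m}(y)\le0\}$ and $\hat y:=\inf\{y\ge0:F(y)\le-m\}$ (for $\delta<1$ one has $0<\hat y<\bar y$). When $\delta<1$ and $\gamma\delta>1$: $w_0(y):=\inf_{p\le0}\{yp-w_0^\star(p)\}$ for $y\ge0$, where $w_0^\star(p):=\int_0^\infty\rho\,\mathrm e^{-\rho t}F^\star(\delta\mathrm e^{\rho(1-\delta)t}p)\,\mathrm dt$ for $p\le0$; and $\tilde y$ denotes the unique point of $(\hat y,\bar y)$ such that $F(\tilde y)=w_0(\tilde y)-m$.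
   Formalization: In the definition of F̄, T=∞ is allowed only when e^{-rt}y^{y_0,p}(t)→0; without this, p=0 and T=∞ give F̄≥-m everywhere, which contradicts (ii) and the upper growth bound. In case (i) the value of F̄ is unaffected. *)

(* Defs.v *)
From HB Require Import structures.
From mathcomp Require Import all_boot all_order all_algebra.
From mathcomp Require Import all_classical all_reals all_analysis.

Set Implicit Arguments.
Unset Strict Implicit.
Unset Printing Implicit Defensive.

Import Order.TTheory GRing.Theory Num.Theory.
Import numFieldNormedType.Exports.

Local Open Scope classical_set_scope.
Local Open Scope ring_scope.

Section Definitions.
Context {R : realType}.
Implicit Types (f u p y : R -> R) (U : set R) (T : \bar R).

Local Notation mu := (@lebesgue_measure R).

Definition Rplus : set R := `[0, +oo[.

(* Functions on the half-line are total functions R -> R of which only the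
   values on Rplus matter; derivatives are taken relative to Rplus, hence are
   one-sided at 0. *)
Definition quotient_at f (x : R) : R -> R := fun z => (f z - f x) / (z - x).

Definition derivable_Rplus f (x : R) : Prop :=
  cvg (quotient_at f x z @[z --> within Rplus x^']).

Definition deriv_Rplus f (x : R) : R :=
  lim (quotient_at f x z @[z --> within Rplus x^']).

(* U is meant to be relatively open in Rplus. *)
Definition C2_on U f : Prop :=
  [/\ forall x, U x -> derivable_Rplus f x,
      forall x, U x -> derivable_Rplus (deriv_Rplus f) x &
      {within U, continuous (deriv_Rplus (deriv_Rplus f))}].

Definition strictly_concave_on U f : Prop :=
  forall x z s, U x -> U z -> x != z -> 0 < s < 1 ->
    s * f x + (1 - s) * f z < f (s * x + (1 - s) * z).

Section PrincipalReward.
Variable u : R -> R.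

Definition F (y : R) : R := - pinv Rplus u y.

Definition Fstar (p : R) : R := inf [set y * p - F y | y in Rplus].

Definition F_dm (delta m y : R) : R :=
  Fstar (delta * deriv_Rplus F y) - delta * y * deriv_Rplus F y + F y + m.

Definition ybar (delta m : R) : R := inf [set y | 0 <= y /\ F_dm delta m y <= 0].

Definition yhat (m : R) : R := inf [set y | 0 <= y /\ F y <= - m].

(* Only used when gamma * delta > 1, in which case the integral is finite. *)
Definition w0star (rho delta p : R) : R :=
  Rintegral mu Rplus
    (fun t => rho * expR (- rho * t)
              * Fstar (delta * expR (rho * (1 - delta) * t) * p)).

Definition w0 (rho delta y : R) : R :=
  inf [set y * p - w0star rho delta p | p in `]-oo, 0]].

Definition is_ytilde (rho delta m y : R) : Prop :=
  yhat m < y < ybar delta m /\ F y = w0 rho delta y - m.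

End PrincipalReward.

Definition borel_Rplus p : Prop :=
  measurable_fun Rplus p /\ (forall t, 0 <= t -> 0 <= p t).

(* y' = r (y - p), y(0) = y0 in the sense of Caratheodory, p being only
   measurable. *)
Definition solves_ode (r y0 : R) p y : Prop :=
  forall t, 0 <= t ->
    mu.-integrable `[0, t] (fun s => (r * (y s - p s))%:E) /\
    y t = y0 + Rintegral mu `[0, t] (fun s => r * (y s - p s)).

Definition T_0 y : \bar R :=
  ereal_inf [set t%:E | t in [set t | 0 <= t /\ y t <= 0]].

(* T = +oo (never retiring) requires that y0 is actually delivered by the
   payments p, i.e. y0 = \int_0^oo r e^{-rt} p(t) dt, which for solutions of the
   ODE is e^{-rt} y(t) --> 0.  Without it, p = 0 and T = +oo would be a free
   choice with payoff -m, whatever the growth of F. *)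
Definition admissible_time (r : R) y T : Prop :=
  [/\ (0 <= T)%E, (T <= T_0 y)%E &
      T = +oo%E -> expR (- r * t) * y t @[t --> +oo] --> 0].

(* The integrand is nonpositive, so the payoff is well defined in [-oo, 0]. *)
Definition payoff u (rho m : R) p y T : \bar R :=
  ((if T is t%:E then expR (- rho * t) * F u (y t) else 0)%:E +
   \int[mu]_(t in [set t | (0 <= t)%R /\ t%:E <= T])
     (rho * expR (- rho * t) * (- m + F u (p t)))%:E)%E.

Definition Fbar u (r rho m y0 : R) : \bar R :=
  ereal_sup [set v | exists p y T,
    [/\ borel_Rplus p, solves_ode r y0 p y, admissible_time r y T &
        v = payoff u rho m p y T]].

End Definitions.

(* Main.v *)
Require Import Defs.
From HB Require Import structures.
From mathcomp Require Import all_boot all_order all_algebra.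
From mathcomp Require Import all_classical all_reals all_analysis.
From mathcomp Require Import measurable_realfun ring lra.

Set Implicit Arguments.
Unset Strict Implicit.
Unset Printing Implicit Defensive.

Import Order.TTheory GRing.Theory Num.Theory.
Import numFieldNormedType.Exports.

Local Open Scope classical_set_scope.
Local Open Scope ring_scope.

(** Let v be the inverse of u, so that F = - v, let dv be its marginal cost and vs its
    convex conjugate, so that Fstar p = - vs (- p). An agent is owed the promise y,
    which grows at the rate r and is reduced by the payments p; costs accrue at the
    rate rho e^{-rho t} (m + v p), and retirement at time T costs e^{-rho T} v(y(T)).

    Everything rests on weak duality. Along a shadow price P e^{(rho - r) t}, the
    inequality v p >= s p - vs s bounds the costs below by valued payments minus a
    conjugate, and the discounted payments add up to the decrease of the discounted
    promise (dual_bound, discounted_promise). Three choices of the price and of a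
    potential show that the following values, discounted and minus the costs
    so far, decrease along every path: - v, for a short time from promises below ybar,
    where F_dm is positive (retire_supersolution); the constant -m
    (constant_supersolution); and w0 - m (cont_supersolution), w0 being the concave
    conjugate of the discounted conjugate of v.

    Let W be -m or w0 - m, below - v up to some yt < ybar and above it beyond. The
    function V that equals - v up to yt and W beyond is the larger of the two, and it
    decreases along paths in the same sense: over a short time interval one may switch
    from W to - v at a time when the promise equals yt (verification). Since the kink
    of a maximum is harmless for such an argument, V bounds all payoffs. It is attained
    up to yt by retiring at once. Beyond yt there are two cases. If gamma * delta <= 1,
    payments that grow at the rate r over a very long time serve any promise at
    negligible cost, which gives -m, and yt = yhat (Fbar_abandon). If
    gamma * delta > 1, the dual integral converges, and the payments that are optimal
    for the price path attain w0 - m (Fbar_ge_never).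

    It remains to see that w0 - m crosses - v exactly once (crossing). Shifting time
    along the price path shows that the discounted conjugate is differentiable, and
    that w0 solves w0 y = vs (delta P) - delta P y with P = - w0'(y) (cont_hjb).
    Compared with the definition of F_dm, this makes the difference w0 - m + v
    increasing wherever it is nonnegative below ybar; it is negative up to yhat, and
    positive from ybar on by a similar comparison of conjugates (disc_conj_gt). The
    crossing is transversal, so the two pieces, each of which is twice continuously
    differentiable, meet in a kink. The growth bounds follow from those of v and,
    for w0, from a suitable price in the dual formula (cont_growth). *)

(** * Convex cost functions and their conjugates *)

Section Calculus.
Context {R : realType}.
Implicit Types (f df : R -> R) (x z : R).

(** The two tangent inequalities squeeze the difference quotient between df x and df
    z, which are close by continuity. *)
Lemma is_derive_subgradient f df x :
  (\forall z \near x, f x + df x * (z - x) <= f z /\ f z + df z * (x - z) <= f x) ->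
  {for x, continuous df} -> is_derive x (1 : R) f (df x).
Proof.
move=> fP cdf; apply/is_derive1_caratheodory.
exists (fun z => if z == x then df x else (f z - f x) / (z - x)); split.
- move=> z; case: eqVneq => [->|zx]; first by rewrite !subrr mulr0.
  by rewrite divfK// subr_eq0.
- rewrite /prop_for /continuous_at eqxx; apply/cvgrPdist_le => e e0.
  move/cvgrPdist_le : cdf => /(_ _ e0) cdf; near=> z.
  case: eqVneq => [_|zx]; first by rewrite subrr normr0 ltW.
  have : `|df x - df z| <= e by near: z.
  have [] : f x + df x * (z - x) <= f z /\ f z + df z * (x - z) <= f x by near: z.
  rewrite !ler_norml; set d := z - x => h1 h2 /andP[h3 h4].
  have d0 : d != 0 by rewrite subr_eq0.
  rewrite -[df x](mulfK d0) -mulrBl; move: zx; rewrite neq_lt => /orP[zx|zx].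
    have {}d0 : d < 0 by rewrite /d; lra.
    by rewrite ler_ndivlMr// ler_ndivrMr//; apply/andP; rewrite /d in h1 h2 d0 *; split; nra.
  have {}d0 : 0 < d by rewrite /d; lra.
  by rewrite ler_pdivlMr// ler_pdivrMr//; apply/andP; rewrite /d in h1 h2 d0 *; split; nra.
- by rewrite eqxx.
Unshelve. all: by end_near. Qed.

End Calculus.

(** Here v is the inverse of the utility and dv its marginal cost. The marginal cost
    enters as a subgradient: being increasing and onto a half-line, it is
    automatically continuous and is the derivative of v. *)
Record convex_cost (R : realType) (v dv : R -> R) : Prop := ConvexCost {
  cost0 : v 0 = 0;
  cost_subgradient :
    forall x z : R, 0 <= x -> 0 <= z -> v x + dv x * (z - x) <= v z;
  marginal_lt : forall x z : R, 0 <= x -> x < z -> dv x < dv z;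
  marginal0_gt0 : 0 < dv 0;
  marginal_onto : forall s : R, dv 0 <= s -> exists2 x : R, 0 <= x & dv x = s }.

Section Conjugate.
Context {R : realType} (v dv : R -> R) (vP : convex_cost v dv).

Definition conj_arg (s : R) : R :=
  if s <= dv 0 then 0 else xget 0 [set x | 0 <= x /\ dv x = s].

(** The convex conjugate of v on the half-line, written at the point conj_arg s where
    the supremum of s * x - v x is attained. *)
Definition legendre (s : R) : R := s * conj_arg s - v (conj_arg s).

Local Notation g := conj_arg.
Local Notation vs := legendre.

Lemma legendreE s : legendre s = s * conj_arg s - v (conj_arg s). Proof. by []. Qed.

Lemma marginal_le x z : 0 <= x -> x <= z -> dv x <= dv z.
Proof.
move=> x0; rewrite le_eqVlt => /predU1P[->//|xz].
exact/ltW/(marginal_lt vP).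
Qed.

Lemma marginal_gt0 x : 0 <= x -> 0 < dv x.
Proof. by move=> x0; exact: lt_le_trans (marginal0_gt0 vP) (marginal_le _ _). Qed.

Lemma marginal_inj x z : 0 <= x -> 0 <= z -> dv x = dv z -> x = z.
Proof.
move=> x0 z0 e; case: (ltgtP x z) => // h.
  by have := marginal_lt vP x0 h; rewrite e ltxx.
by have := marginal_lt vP z0 h; rewrite e ltxx.
Qed.

(** A monotone map onto an interval has no jumps. Only the half-line matters, whence
    the truncation of the argument at 0. *)
Lemma marginal_continuous : continuous (fun x : R => dv (Num.max 0 x) : R).
Proof.
move=> y; apply/cvgrPdist_lt => e e0.
have y0 : 0 <= Num.max 0 y by rewrite le_max lexx.
have s0 := marginal_le (lexx 0) y0.
have lo : \forall z \near y, dv (Num.max 0 y) - e < dv (Num.max 0 z).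
  have [h|h] := ltP (dv (Num.max 0 y) - e) (dv 0).
    by near=> z; apply: lt_le_trans h (marginal_le _ _); rewrite ?le_max ?lexx.
  have [x x0 xE] := marginal_onto vP h.
  have xy : x < y.
    rewrite ltNge; apply/negP => yx.
    have : Num.max 0 y <= x by rewrite ge_max x0.
    by move=> /(marginal_le y0); rewrite xE; lra.
  near=> z; rewrite -xE; apply: (marginal_lt vP) => //.
  by rewrite lt_max; apply/orP; right; near: z; exact: lt_nbhsr.
have hi : \forall z \near y, dv (Num.max 0 z) < dv (Num.max 0 y) + e.
  have h : dv 0 <= dv (Num.max 0 y) + e by lra.
  have [x x0 xE] := marginal_onto vP h.
  have yx : Num.max 0 y < x.
    rewrite ltNge; apply/negP => /(marginal_le x0).
    by rewrite xE; lra.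
  move: yx; rewrite gt_max => /andP[x0' yx].
  near=> z; rewrite -xE; apply: (marginal_lt vP); first by rewrite le_max lexx.
  by rewrite gt_max x0'/=; near: z; exact: lt_nbhsl.
near=> z; have : dv (Num.max 0 y) - e < dv (Num.max 0 z) by near: z.
have : dv (Num.max 0 z) < dv (Num.max 0 y) + e by near: z.
by rewrite ltr_norml; lra.
Unshelve. all: by end_near. Qed.

Lemma conj_arg_low s : s <= dv 0 -> g s = 0.
Proof. by rewrite /conj_arg => ->. Qed.

Lemma conj_arg_spec s : dv 0 <= s -> 0 <= g s /\ dv (g s) = s.
Proof.
rewrite /conj_arg; case: ifPn => [s0 s0'|_ s0].
  by split=> //; apply/eqP; rewrite eq_le s0 s0'.
case: xgetP => [x _ //|/(_ _) no]; have [x x0 xs] := marginal_onto vP s0.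
by case: (no x); split.
Qed.

Lemma conj_arg_ge0 s : 0 <= g s.
Proof.
have [/conj_arg_low -> //|/ltW s0] := leP s (dv 0).
by have [] := conj_arg_spec s0.
Qed.

Lemma marginal_conj_arg s : dv 0 <= s -> dv (g s) = s.
Proof. by move=> /conj_arg_spec[]. Qed.

Lemma conj_arg_marginal x : 0 <= x -> g (dv x) = x.
Proof.
move=> x0; have d0 := marginal_le (lexx 0) x0.
have [g0 ge] := conj_arg_spec d0.
exact: marginal_inj.
Qed.

(** For a slope below the least marginal cost the maximiser is the endpoint 0;
    otherwise it is the point where the tangent of v has slope s. *)
Lemma fenchel_young s x : 0 <= x -> s * x <= v x + legendre s.
Proof.
move=> x0; rewrite /legendre; have [s0|/ltW s0] := leP s (dv 0).
  rewrite conj_arg_low// (cost0 vP) mulr0 subr0 addr0.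
  have := cost_subgradient vP (lexx 0) x0.
  rewrite (cost0 vP) add0r subr0; apply: le_trans.
  exact: ler_wpM2r.
have := cost_subgradient vP (conj_arg_ge0 s) x0.
rewrite marginal_conj_arg//; lra.
Qed.

Lemma conj_marginal x : 0 <= x -> legendre (dv x) = dv x * x - v x.
Proof. by move=> x0; rewrite /legendre conj_arg_marginal. Qed.

Lemma conj_subgradient s t : legendre s + g s * (t - s) <= legendre t.
Proof. by have := fenchel_young t (conj_arg_ge0 s); move: (legendre t) => ct; rewrite /legendre; lra. Qed.

Lemma conj_arg_le s t : s <= t -> g s <= g t.
Proof.
rewrite le_eqVlt => /predU1P[->//|st].
by have := conj_subgradient s t; have := conj_subgradient t s; nra.
Qed.

Lemma conj_arg_lt s t : dv 0 <= s -> s < t -> g s < g t.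
Proof.
move=> s0 st; rewrite lt_neqAle conj_arg_le ?andbT; last exact: ltW.
apply/eqP => e; have : dv (g s) = dv (g t) by rewrite e.
by rewrite !marginal_conj_arg// ?(le_trans s0 (ltW st))// => es; rewrite es ltxx in st.
Qed.

Lemma conj_arg_lt_marginal s x : 0 <= x -> s < dv x -> 0 < x -> g s < x.
Proof.
move=> x0 sx xp; have [s0|/ltW s0] := leP s (dv 0); first by rewrite conj_arg_low.
by rewrite -[ltRHS]conj_arg_marginal//; exact: conj_arg_lt.
Qed.

Lemma conj_arg_continuous : continuous conj_arg.
Proof.
move=> s; apply/cvgrPdist_lt => e e0.
have lo : \forall t \near s, g s - e < g t.
  have [ge|ge] := ltP (g s - e) 0.
    by near=> t; exact: lt_le_trans ge (conj_arg_ge0 _).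
  have gs0 : 0 < g s by lra.
  have s0 : dv 0 < s.
    by rewrite ltNge; apply/negP => /conj_arg_low gs; rewrite gs ltxx in gs0.
  have lts : dv (g s - e) < s.
    rewrite -[ltRHS](marginal_conj_arg (ltW s0)).
    by apply: (marginal_lt vP) => //; lra.
  near=> t; rewrite -[ltLHS](conj_arg_marginal ge).
  apply: conj_arg_lt; first exact: marginal_le.
  by near: t; exact: lt_nbhsr.
have hi : \forall t \near s, g t < g s + e.
  have gs0 := conj_arg_ge0 s.
  have lts : s < dv (g s + e).
    have [s0|/ltW s0] := leP s (dv 0).
      by apply: le_lt_trans s0 _; apply: (marginal_lt vP) => //; lra.
    rewrite -[ltLHS](marginal_conj_arg s0).
    by apply: (marginal_lt vP) => //; lra.
  near=> t; apply: conj_arg_lt_marginal; try lra.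
  by near: t; exact: lt_nbhsl.
near=> t; have : g s - e < g t by near: t.
have : g t < g s + e by near: t.
by rewrite ltr_norml; lra.
Unshelve. all: by end_near. Qed.

Lemma is_derive_conj (s : R) : is_derive s (1 : R) (legendre : R -> R) (g s).
Proof.
apply: (is_derive_subgradient _ (@conj_arg_continuous s)); near=> t; split;
exact: conj_subgradient.
Unshelve. all: by end_near. Qed.

Lemma conj_ge0 s : 0 <= legendre s.
Proof. by have := fenchel_young s (lexx 0); rewrite (cost0 vP); lra. Qed.

Lemma conj_low s : s <= dv 0 -> legendre s = 0.
Proof. by rewrite /legendre => /conj_arg_low ->; rewrite (cost0 vP); lra. Qed.

(** A growth bound on the conjugate becomes one on its maximiser. *)
Lemma conj_arg_bound s : 0 <= s -> s * g s <= legendre (2 * s).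
Proof. by move=> s0; have := conj_subgradient s (2 * s); have := conj_ge0 s; lra. Qed.

Lemma cost_lt x z : 0 <= x -> x < z -> v x < v z.
Proof.
move=> x0 xz; have z0 : 0 <= z by lra.
by have := cost_subgradient vP x0 z0; have := marginal_gt0 x0; nra.
Qed.

Lemma cost_ge0 x : 0 <= x -> 0 <= v x.
Proof.
rewrite le_eqVlt => /predU1P[<-|/cost_lt/ltW]; rewrite (cost0 vP)//.
exact.
Qed.

Lemma cost_le x z : 0 <= x -> x <= z -> v x <= v z.
Proof. by move=> x0; rewrite le_eqVlt => /predU1P[->//|/(cost_lt x0)/ltW]. Qed.

Lemma cost_lipschitz x z M : 0 <= x -> 0 <= z -> x <= M -> z <= M ->
  `|v x - v z| <= dv M * `|x - z|.
Proof.
have base a b : 0 <= a -> a <= b -> b <= M -> `|v a - v b| <= dv M * `|a - b|.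
  move=> a0 ab bM; have b0 : 0 <= b by lra.
  have := cost_subgradient vP b0 a0; have := marginal_le b0 bM.
  have := cost_le a0 ab.
  by move=> h1 h2 h3; rewrite !ler0_norm ?subr_le0//; nra.
move=> x0 z0 xM zM; have [xz|/ltW zx] := leP x z; first exact: base.
by rewrite distrC (distrC x); exact: base.
Qed.

Lemma cost_continuous : continuous (fun x : R => v (Num.max 0 x) : R).
Proof.
move=> x; pose M := Num.max 0 x + 1; pose c := dv M.
have x0 : 0 <= Num.max 0 x by rewrite le_max lexx.
have M0 : 0 <= M by rewrite addr_ge0.
have c0 : 0 < c by exact: marginal_gt0.
apply/cvgrPdist_le => e e0; near=> z.
have zx : `|x - z| < Num.min 1 (e / c).
  near: z; apply: cvgr_dist_lt; first exact: cvg_id.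
  by rewrite lt_min ltr01 divr_gt0.
have {zx}[zx1 zxe] : `|x - z| <= 1 /\ c * `|x - z| <= e.
  move: zx; rewrite lt_min => /andP[/ltW ? /ltW]; split=> //.
  by rewrite mulrC -ler_pdivlMr.
have dxz : `|Num.max 0 x - Num.max 0 z| <= `|x - z|.
  have := ler_norm (x - z); have := ler_norm (z - x); rewrite distrC.
  have := normr_ge0 (x - z); move: (`|x - z|) => n n0 h1 h2.
  by rewrite ler_norml !/Num.max; case: (ltP 0 x) => ?; case: (ltP 0 z) => ?; apply/andP; split; lra.
have z0 : 0 <= Num.max 0 z by rewrite le_max lexx.
have zM : Num.max 0 z <= M.
  by move: dxz; rewrite ler_norml => /andP[]; rewrite /M; lra.
have xM : Num.max 0 x <= M by rewrite lerDl.
have := cost_lipschitz x0 z0 xM zM; have := ler_wpM2l (ltW c0) dxz.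
rewrite -/c => h1 h2; lra.
Unshelve. all: by end_near. Qed.

End Conjugate.

Global Opaque legendre conj_arg.

(** * Antiderivatives and improper integrals *)

Section Antiderivative.
Context {R : realType}.
Implicit Types (f Phi : R -> R) (a b t : R).
Local Notation mu := (@lebesgue_measure R).

Lemma continuous_integrable_itv f a b : continuous f ->
  mu.-integrable `[a, b] (EFin \o f).
Proof.
move=> cf; apply: continuous_compact_integrable; first exact: segment_compact.
exact: continuous_subspaceT.
Qed.

Lemma is_derive_continuous Phi (t l : R) : is_derive t (1 : R) Phi l ->
  {for t, continuous Phi}.
Proof.
by move=> h; apply: differentiable_continuous; apply/derivable1_diffP.
Qed.

Lemma mvt_le f df a b : a <= b ->
  (forall t, a <= t <= b -> is_derive t (1 : R) f (df t)) ->
  (forall t, a <= t <= b -> 0 <= df t) -> f a <= f b.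
Proof.
move=> ab hd h0; have [t|t|c] := @MVT_segment R f df a b ab.
- by rewrite in_itv/= => /andP[/ltW ? /ltW ?]; apply: hd; apply/andP.
- apply: (@derivable_within_continuous _ _ f `[a, b]).
  by move=> x; rewrite in_itv/= => /hd.
rewrite in_itv/= => /h0 d0 e; rewrite -subr_ge0 e mulr_ge0//; lra.
Qed.

Lemma mvt_lt f df a b : a < b ->
  (forall t, a <= t <= b -> is_derive t (1 : R) f (df t)) ->
  (forall t, a < t < b -> 0 < df t) -> f a < f b.
Proof.
move=> ab hd h0; have [t|t|c] := @MVT R f df a b ab.
- by rewrite in_itv/= => /andP[/ltW ? /ltW ?]; apply: hd; apply/andP.
- apply: (@derivable_within_continuous _ _ f `[a, b]).
  by move=> x; rewrite in_itv/= => /hd.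
rewrite in_itv/= => /h0 d0 e; rewrite -subr_gt0 e mulr_gt0//; lra.
Qed.

Lemma is_derive_gt0_right f (c l b : R) : is_derive c (1 : R) f l -> 0 < l -> c < b ->
  exists2 z, c < z < b & f c < f z.
Proof.
move=> /is_derive1_caratheodory[h [hE ch hc]] l0 cb.
have hpos : \forall z \near c, 0 < h z by apply: (cvgr_gt _ ch); rewrite hc.
have : \forall z \near c^'+, c < z < b /\ f c < f z.
  near=> z; have cz : c < z by near: z; exact: nbhs_right_gt.
  split; first by rewrite cz/=; near: z; exact: nbhs_right_lt.
  rewrite -subr_gt0 hE mulr_gt0 ?subr_gt0//; near: z.
  exact: cvg_within hpos.
by move=> /filter_ex[z [? ?]]; exists z.
Unshelve. all: by end_near. Qed.

(** Around a given point, the integral from 0 is an integral from a fixed lower end,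
    up to a constant. *)
Lemma antiderivative f : continuous f ->
  exists Phi : R -> R, forall t : R, is_derive t (1 : R) Phi (f t).
Proof.
move=> cf; pose Phi t := if 0 <= t then \int[mu]_(s in `]0, t]) f s
                      else - \int[mu]_(s in `]t, 0]) f s.
exists Phi => t0; pose M := `|t0| + 1; pose F t := \int[mu]_(s in `[-M, t]) f s.
have M0 : - M < 0 by rewrite /M oppr_lt0 ltr_wpDl.
have Mt : - M < t0.
  by rewrite /M; have := ler_norm (- t0); rewrite normrN; lra.
have PhiE t : - M < t -> Phi t = F t - F 0.
  move=> tM; rewrite /Phi; case: ifPn => [t0'|].
    rewrite /F Rintegral_itvB//; last by rewrite bnd_simp// ltW.
    exact: continuous_integrable_itv.
  rewrite -ltNge => t0'; rewrite /F -opprB Rintegral_itvB//.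
  - exact: continuous_integrable_itv.
  - by rewrite bnd_simp ltW.
  - by rewrite bnd_simp ltW.
have [dF eF] : derivable F t0 1 /\ derive1 F t0 = f t0.
  apply: (@continuous_FTC1_closed _ _ _ _ (t0 + 1)) => //.
  - by rewrite ltrDl.
  - exact: continuous_integrable_itv.
  - exact: cf.
have dF' : is_derive t0 (1 : R) (fun t => F t - F 0) (f t0).
  have : is_derive t0 (1:R) F (f t0) by apply: DeriveDef; [exact: dF|rewrite -derive1E; exact: eF].
  move=> h; have := @is_deriveB _ _ _ F (cst (F 0)) t0 1 _ _ h (is_derive_cst _ _ _).
  by rewrite subr0.
apply: (near_eq_is_derive _ dF').
near=> t; apply/esym/PhiE.
by near: t; exact: lt_nbhsr.
Unshelve. all: by end_near. Qed.

Lemma Rintegral_antiderivative f Phi a b : continuous f ->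
  (forall t, a <= t <= b -> is_derive t (1 : R) Phi (f t)) -> a <= b ->
  \int[mu]_(s in `[a, b]) f s = Phi b - Phi a.
Proof.
move=> cf dP; rewrite le_eqVlt => /predU1P[<-|ab].
  by rewrite set_itv1 Rintegral_set1 subrr.
rewrite /Rintegral (@continuous_FTC2 _ f Phi)//.
- exact: continuous_subspaceT.
- split.
  + by move=> x; rewrite in_itv/= => /andP[/ltW ? /ltW ?]; have := dP x; rewrite /is_true => -[]//; apply/andP.
  + apply: cvg_at_right_filter; apply: is_derive_continuous; apply: dP.
    by rewrite lexx ltW.
  + apply: cvg_at_left_filter; apply: is_derive_continuous; apply: dP.
    by rewrite lexx ltW.
- move=> x; rewrite in_itv/= => /andP[/ltW ? /ltW ?]; rewrite derive1E.
  by apply: derive_val; apply: dP; apply/andP.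
Qed.

Lemma half_line_antiderivative f Phi a L : continuous f ->
  (forall t, a <= t -> 0 <= f t) ->
  (forall t, a <= t -> is_derive t (1 : R) Phi (f t)) ->
  Phi t @[t --> +oo] --> L ->
  mu.-integrable `[a, +oo[ (EFin \o f) /\
  \int[mu]_(s in `[a, +oo[) f s = L - Phi a.
Proof.
move=> cf f0 dP PL.
have e : (\int[mu]_(x in `[a, +oo[) (f x)%:E = L%:E - (Phi a)%:E)%E.
  apply: ge0_continuous_FTC2y => //.
  - exact: continuous_subspaceT.
  - by move=> x /ltW /dP [].
  - apply: cvg_at_right_filter; apply: is_derive_continuous; apply: dP; exact: lexx.
  - move=> x; rewrite in_itv/= andbT => /ltW ax; rewrite derive1E.
    by apply: derive_val; exact: dP.
split; last by rewrite /Rintegral e.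
apply/integrableP; split.
  apply/measurable_EFinP; apply: measurable_funTS.
  exact: continuous_measurable_fun.
have -> : (\int[mu]_(x in `[a, +oo[) `|(EFin \o f) x|
          = \int[mu]_(x in `[a, +oo[) (f x)%:E)%E.
  apply: eq_integral => x.
  by rewrite inE/= in_itv/= andbT => /f0 fx; rewrite ger0_norm.
by rewrite e -EFinB ltry.
Qed.

End Antiderivative.

#[local] Opaque expR.

Section DerivativeRules.
Context {R : realType}.
Implicit Types (f g : R -> R) (c t K eta : R).

Lemma is_derive_mul f g (df dg t : R) :
  is_derive t (1 : R) f df -> is_derive t (1 : R) g dg ->
  is_derive t (1 : R) (fun s => f s * g s) (f t * dg + df * g t).
Proof.
move=> hf hg; have h := @is_deriveM _ _ f g t 1 df dg hf hg.
by apply: is_derive_eq h _; rewrite /GRing.scale/= [df * _]mulrC.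
Qed.

Lemma is_derive_scale c f (t df : R) : is_derive t (1 : R) f df ->
  is_derive t (1 : R) (fun s => c * f s) (c * df).
Proof.
move=> h; apply: is_derive_eq (is_derive_mul (is_derive_cst c t 1) h) _.
by rewrite mul0r addr0.
Qed.

Lemma is_derive_expM c t :
  is_derive t (1 : R) (fun s : R => expR (c * s) : R) (c * expR (c * t)).
Proof.
have h : is_derive t (1 : R) (fun s => c * s) c.
  by apply: is_derive_eq (is_derive_scale c (is_derive_id t 1)) _; rewrite mulr1.
by apply: is_derive_eq (is_derive1_comp (is_derive_expR (c * t)) h) _; rewrite mulrC.
Qed.

Lemma is_derive_shiftl f (df c t : R) : is_derive (c + t) (1 : R) f df ->
  is_derive t (1 : R) (fun s => f (c + s)) df.
Proof.
move=> h; have h' : is_derive t (1 : R) (fun s => c + s) 1.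
  apply: is_derive_eq (is_deriveD (is_derive_cst c t 1) (is_derive_id t 1)) _.
  by rewrite add0r.
by apply: is_derive_eq (is_derive1_comp h h') _; rewrite mulr1.
Qed.

Lemma cvg_expRN c : 0 < c -> expR (- c * t) @[t --> +oo] --> (0 : R).
Proof.
move=> c0; have h : (fun t : R => c * t) x @[x --> +oo] --> +oo.
  exact: gt0_cvgMry.
by under eq_fun do rewrite mulNr; exact: (cvg_comp _ (fun x => expR (- x)) h (@cvgr_expR R)).
Qed.

Lemma expRN_small c (e : R) : 0 < c -> 0 < e ->
  exists2 t : R, 0 <= t & expR (- c * t) < e.
Proof.
move=> c0 e0; exists (Num.max 0 (c^-1 * - ln (e / 2))); first by rewrite le_max lexx.
have e20 : 0 < e / 2 by lra.
apply: (@le_lt_trans _ _ (e / 2)); last by lra.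
rewrite -[leRHS]lnK// ler_expR mulNr lerNl -ler_pdivrMl//.
by rewrite le_max lexx orbT.
Qed.

(** The exponential bound keeps the nondecreasing antiderivative bounded. *)
Lemma improper_antiderivative f K eta : continuous f -> (forall t, 0 <= f t) ->
  0 < eta -> (forall t, 0 <= t -> f t <= K * expR (- eta * t)) ->
  exists (Phi : R -> R) (L : R), (forall t, is_derive t (1 : R) Phi (f t)) /\
    Phi t @[t --> +oo] --> L.
Proof.
move=> cf f0 eta0 fK; have [Phi dPhi] := antiderivative cf.
exists Phi, (sup (range Phi)); split=> //; apply: nondecreasing_cvgr.
  by move=> a b ab; apply: (@mvt_le _ Phi f) => //.
have K0 : 0 <= K.
  by have := le_trans (f0 0) (fK 0 (lexx _)); rewrite mulr0 expR0 mulr1.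
exists (Phi 0 + K / eta) => _ [t _ <-].
have Phi0 a b : a <= b -> Phi a <= Phi b.
  by move=> ab; apply: (@mvt_le _ Phi f) => //.
have [t0|/ltW t0] := leP t 0.
  by apply: le_trans (Phi0 _ _ t0) _; rewrite lerDl divr_ge0// ltW.
pose X (s : R) : R := - (K / eta) * expR (- eta * s) - Phi s.
have dX s : is_derive s (1 : R) X (K * expR (- eta * s) - f s).
  have h1 := is_derive_scale (- (K / eta)) (is_derive_expM (- eta) s).
  apply: is_derive_eq (is_deriveB h1 (dPhi s)) _.
  by congr (_ - _); field; rewrite gt_eqF.
have : X 0 <= X t.
  apply: (@mvt_le _ X (fun s => K * expR (- eta * s) - f s)) => // s /andP[s0 _].
  by rewrite subr_ge0 fK.
rewrite /X mulr0 expR0 mulr1.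
have := mulr_ge0 (divr_ge0 K0 (ltW eta0)) (expR_ge0 (- eta * t)); lra.
Qed.

End DerivativeRules.

Section IntegrableRules.
Context {R : realType} (D : set (measurableTypeR R)) (mD : measurable D).
Implicit Types (f g : R -> R) (c : R).
Local Notation mu := (@lebesgue_measure R).

Lemma integrable_mulr f c : mu.-integrable D (EFin \o f) ->
  mu.-integrable D (EFin \o (fun t => f t * c)).
Proof.
by move=> h; apply: eq_integrable (integrableZr mD c h).
Qed.

Lemma integrable_mull f c : mu.-integrable D (EFin \o f) ->
  mu.-integrable D (EFin \o (fun t => c * f t)).
Proof.
by move=> h; apply: eq_integrable (integrableZl mD c h).
Qed.

Lemma integrable_add f g : mu.-integrable D (EFin \o f) ->
  mu.-integrable D (EFin \o g) -> mu.-integrable D (EFin \o (fun t => f t + g t)).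
Proof.
by move=> hf hg; apply: eq_integrable (integrableD mD hf hg).
Qed.

Lemma integrable_sub f g : mu.-integrable D (EFin \o f) ->
  mu.-integrable D (EFin \o g) -> mu.-integrable D (EFin \o (fun t => f t - g t)).
Proof.
by move=> hf hg; apply: eq_integrable (integrableB mD hf hg).
Qed.

End IntegrableRules.

(** * The conjugate discounted along a price path *)

Section Discount.
Context {R : realType} (v dv : R -> R) (r rho : R).
Local Notation mu := (@lebesgue_measure R).
Local Notation g := (conj_arg dv).
Local Notation vs := (legendre v dv).
Local Notation kap := (rho - r).
Local Notation delta := (r / rho).

(** With prices counted positively, this is the integral that defines the dual
    function w0star: the conjugate, discounted along a shadow price that starts at Q
    and grows at the rate rho - r. The lock prevents integrals from being compared by
    computation. *)
Definition disc_conj : R -> R := locked (fun Q => \int[mu]_(t in `[0, +oo[)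
  (rho * expR (- rho * t) * vs (delta * expR (kap * t) * Q))).

(** The promise that is served by paying, forever, what is optimal for that price
    path; it is the derivative of disc_conj. *)
Definition disc_arg : R -> R := locked (fun Q => \int[mu]_(t in `[0, +oo[)
  (r * expR (- r * t) * g (delta * expR (kap * t) * Q))).

(** The price path through 1. Any positive price lies on it, so functions of the price
    are studied as functions of the time tau. *)
Definition shadow : R -> R := locked (fun tau => expR (kap * tau)).

Lemma disc_conjE Q : disc_conj Q = \int[mu]_(t in `[0, +oo[)
  (rho * expR (- rho * t) * vs (delta * expR (kap * t) * Q)).
Proof. by rewrite /disc_conj -lock. Qed.

Lemma disc_argE Q : disc_arg Q = \int[mu]_(t in `[0, +oo[)
  (r * expR (- r * t) * g (delta * expR (kap * t) * Q)).
Proof. by rewrite /disc_arg -lock. Qed.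

Lemma shadowE tau : shadow tau = expR (kap * tau).
Proof. by rewrite /shadow -lock. Qed.

Context (vP : convex_cost v dv) (C q : R).
Context (r_gt0 : 0 < r) (r_lt_rho : r < rho) (C_ge0 : 0 <= C) (q_ge0 : 0 <= q)
  (kapq : kap * q < rho)
  (grow : forall s : R, 0 <= s -> vs s <= C * (1 + s `^ q)).

Lemma rate_gt0 : 0 < rho. Proof. exact: lt_trans r_lt_rho. Qed.
Local Notation rho_gt0 := rate_gt0.

Lemma delta_gt0 : 0 < delta. Proof. by rewrite divr_gt0// rho_gt0. Qed.

Lemma shadow_gt0 tau : 0 < shadow tau. Proof. by rewrite shadowE expR_gt0. Qed.

Lemma shadowD s t : shadow (s + t) = shadow s * shadow t.
Proof. by rewrite !shadowE mulrDr expRD. Qed.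

(** The flow grows at most like e^{kap q t}, which discounting at the rate rho > kap q
    beats. *)
Lemma conj_flow_bound (c t : R) : 0 <= c -> 0 <= t ->
  expR (- rho * t) * vs (c * expR (kap * t)) <=
  C * (1 + c `^ q) * expR (- (rho - kap * q) * t).
Proof.
move=> c0 t0; have k0 : 0 < kap by rewrite subr_gt0.
have := grow (mulr_ge0 c0 (expR_ge0 (kap * t))).
rewrite powRM ?expR_ge0// -expRM => h.
have e0 := expR_ge0 (- rho * t).
apply: (le_trans (ler_wpM2l e0 h)).
have e1 : expR (- rho * t) <= expR (- (rho - kap * q) * t).
  by rewrite ler_expR ler_wpM2r// lerN2 gerBl mulr_ge0// ltW.
have e2 : expR (- rho * t) * expR (kap * t * q) = expR (- (rho - kap * q) * t).
  by rewrite -expRD; congr expR; ring.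
have h1 := ler_wpM2l C_ge0 e1.
have -> : expR (- rho * t) * (C * (1 + c `^ q * expR (kap * t * q))) =
    C * expR (- rho * t) + C * c `^ q * (expR (- rho * t) * expR (kap * t * q)) by ring.
by rewrite e2; lra.
Qed.

Lemma conj_flow_cvg0 (c : R) : 0 <= c ->
  expR (- rho * t) * vs (c * expR (kap * t)) @[t --> +oo] --> (0 : R).
Proof.
move=> c0; have h : (fun t : R => C * (1 + c `^ q) * expR (- (rho - kap * q) * t)) x
    @[x --> +oo] --> (0 : R).
  rewrite -[X in _ --> X](mulr0 (C * (1 + c `^ q))); apply: cvgM; first exact: cvg_cst.
  by apply: cvg_expRN; rewrite subr_gt0.
apply: (squeeze_cvgr _ (cvg_cst 0) h).
near=> t; have t0 : 0 <= t by near: t; apply: nbhs_pinfty_ge; rewrite num_real.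
rewrite conj_flow_bound// andbT.
by rewrite mulr_ge0 ?expR_ge0// (conj_ge0 vP).
Unshelve. all: by end_near. Qed.

Lemma arg_flow_bound (c t : R) : 0 < c ->
  expR (- r * t) * g (c * expR (kap * t)) <=
  c^-1 * (expR (- rho * t) * vs (2 * c * expR (kap * t))).
Proof.
move=> c0; have e0 := expR_gt0 (kap * t).
have := conj_arg_bound vP (ltW (mulr_gt0 c0 e0)); rewrite mulrA => h.
rewrite -(ler_pM2l c0) mulVKf ?gt_eqF//.
have -> : expR (- r * t) = expR (- rho * t) * expR (kap * t).
  by rewrite -expRD; congr expR; ring.
apply: le_trans (ler_wpM2l (expR_ge0 (- rho * t)) h).
by rewrite le_eqVlt; apply/orP; left; apply/eqP; ring.
Qed.

Lemma conj_continuous : continuous vs.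
Proof. by move=> s; apply: is_derive_continuous (is_derive_conj vP s). Qed.

Lemma disc_flow_continuous (c : R) (h : R -> R) : continuous h ->
  continuous (fun t : R => c * expR (- c * t) * h (delta * expR (kap * t)) : R).
Proof.
move=> ch t; apply: cvgM.
  by apply: is_derive_continuous (is_derive_scale c (is_derive_expM (- c) t)).
apply: (@continuous_comp _ _ _ (fun t : R => delta * expR (kap * t) : R) h t); last exact: ch.
by apply: is_derive_continuous (is_derive_scale delta (is_derive_expM kap t)).
Qed.

(** Starting at a later price amounts to shifting time, so that up to a factor all the
    discounted integrals are tails of a single one. This yields their derivatives in
    tau without differentiating under an integral. *)
Lemma disc_antiderivative (c K eta : R) (h : R -> R) :
  0 < c -> continuous h -> (forall s, 0 <= h s) -> 0 < eta ->
  (forall t, 0 <= t -> c * expR (- c * t) * h (delta * expR (kap * t)) <= K * expR (- eta * t)) ->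
  exists (Phi : R -> R) (L : R),
  [/\ forall t, is_derive t (1 : R) Phi (c * expR (- c * t) * h (delta * expR (kap * t))),
    Phi t @[t --> +oo] --> L &
  forall tau,
    mu.-integrable `[0, +oo[ (EFin \o (fun t : R =>
        c * expR (- c * t) * h (delta * expR (kap * t) * shadow tau))) /\
    \int[mu]_(t in `[0, +oo[) (c * expR (- c * t) * h (delta * expR (kap * t) * shadow tau))
     = expR (c * tau) * (L - Phi tau)].
Proof.
move=> c0 ch h0 eta0 hK.
pose F t := c * expR (- c * t) * h (delta * expR (kap * t)).
have cF : continuous F by exact: disc_flow_continuous.
have F0 t : 0 <= F t by rewrite /F mulr_ge0// mulr_ge0 ?expR_ge0 ?ltW.
have [Phi [L [dPhi cPhi]]] := improper_antiderivative cF F0 eta0 hK.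
exists Phi, L; split=> // tau.
pose f t := expR (c * tau) * F (tau + t).
have -> : (fun t : R => c * expR (- c * t) * h (delta * expR (kap * t) * shadow tau)) = f.
  apply/funext => t; rewrite /f /F shadowE -[_ * expR (kap * tau)]mulrA -expRD -mulrDr.
  rewrite [t + tau]addrC [in RHS]mulrA; congr (_ * _).
  by rewrite [RHS]mulrCA -expRD; congr (_ * expR _); ring.
have cf : continuous f.
  move=> t; apply: cvgM; first exact: cvg_cst.
  apply: (@continuous_comp _ _ _ (fun t => tau + t) F t); last exact: cF.
  by apply: cvgD; [exact: cvg_cst|exact: cvg_id].
have f0 t : 0 <= t -> 0 <= f t by move=> _; rewrite mulr_ge0 ?expR_ge0.
have df (t : R) : 0 <= t ->
    is_derive t (1 : R) (fun t => expR (c * tau) * Phi (tau + t)) (f t).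
  by move=> _; apply: is_derive_scale; apply: is_derive_shiftl; exact: dPhi.
have cP : expR (c * tau) * Phi (tau + t) @[t --> +oo] --> expR (c * tau) * L.
  apply: cvgM; first exact: cvg_cst.
  have -> : (fun x => Phi (tau + x)) = (fun x => Phi (x + tau)).
    by apply/funext => x; rewrite addrC.
  by rewrite cvg_shiftr.
have [intf ->] := half_line_antiderivative cf f0 df cP.
by split=> //; rewrite addr0 mulrBr.
Qed.

Lemma disc_is_derive (c K eta : R) (h : R -> R) tau :
  0 < c -> continuous h -> (forall s, 0 <= h s) -> 0 < eta ->
  (forall t, 0 <= t -> c * expR (- c * t) * h (delta * expR (kap * t)) <= K * expR (- eta * t)) ->
  let I tau := \int[mu]_(t in `[0, +oo[) (c * expR (- c * t) * h (delta * expR (kap * t) * shadow tau)) in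
  is_derive tau (1 : R) I (c * (I tau - h (delta * shadow tau))).
Proof.
move=> c0 ch h0 eta0 hK I.
have [Phi [L [dPhi _ IE]]] := disc_antiderivative c0 ch h0 eta0 hK.
have -> : I = fun tau => expR (c * tau) * (L - Phi tau).
  by apply/funext => s; exact: (IE s).2.
have h1 := is_deriveB (is_derive_cst L tau 1) (dPhi tau).
apply: is_derive_eq (is_derive_mul (is_derive_expM c tau) h1) _.
have e : expR (c * tau) * expR (- c * tau) = 1 by rewrite -expRD mulNr addrN expR0.
have -> : (cst L - Phi) tau = L - Phi tau by [].
by rewrite shadowE -[X in _ = _ * (_ - X)]mul1r -e; ring.
Qed.

Lemma conj_flow_rate t : 0 <= t ->
  rho * expR (- rho * t) * vs (delta * expR (kap * t)) <=
  rho * (C * (1 + delta `^ q)) * expR (- (rho - kap * q) * t).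
Proof.
move=> t0; have := conj_flow_bound (ltW delta_gt0) t0.
by move/(ler_wpM2l (ltW rho_gt0)); rewrite !mulrA.
Qed.

Lemma arg_flow_rate t : 0 <= t ->
  r * expR (- r * t) * g (delta * expR (kap * t)) <=
  r * (delta^-1 * (C * (1 + (2 * delta) `^ q))) * expR (- (rho - kap * q) * t).
Proof.
move=> t0; have d0 := delta_gt0; have d1 : 0 <= delta^-1 by rewrite invr_ge0 ltW.
have d2 : 0 <= 2 * delta by rewrite mulr_ge0// ltW.
have := ler_wpM2l d1 (conj_flow_bound d2 t0).
move/(le_trans (arg_flow_bound t d0))/(ler_wpM2l (ltW r_gt0)).
by rewrite !mulrA.
Qed.

Lemma eta_gt0 : 0 < rho - kap * q. Proof. by rewrite subr_gt0. Qed.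

Lemma is_derive_disc_conj tau : is_derive tau (1 : R) (disc_conj \o shadow)
  (rho * (disc_conj (shadow tau) - vs (delta * shadow tau))).
Proof.
have -> : disc_conj \o shadow = fun tau => \int[mu]_(t in `[0, +oo[)
    (rho * expR (- rho * t) * vs (delta * expR (kap * t) * shadow tau)).
  by apply/funext => s; exact: disc_conjE.
rewrite disc_conjE; exact: (disc_is_derive tau rho_gt0 conj_continuous (conj_ge0 vP) eta_gt0 conj_flow_rate).
Qed.

Lemma is_derive_disc_arg tau : is_derive tau (1 : R) (disc_arg \o shadow)
  (r * (disc_arg (shadow tau) - g (delta * shadow tau))).
Proof.
have -> : disc_arg \o shadow = fun tau => \int[mu]_(t in `[0, +oo[)
    (r * expR (- r * t) * g (delta * expR (kap * t) * shadow tau)).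
  by apply/funext => s; exact: disc_argE.
rewrite disc_argE; exact: (disc_is_derive tau r_gt0 (conj_arg_continuous vP) (conj_arg_ge0 vP) eta_gt0 arg_flow_rate).
Qed.

(** The transversality condition: up to a factor, this is a tail of a convergent
    integral. *)
Lemma disc_arg_tail tau : expR (- r * t) * disc_arg (shadow (tau + t)) @[t --> +oo] --> (0 : R).
Proof.
have [Phi [L [_ cPhi h]]] := disc_antiderivative r_gt0 (conj_arg_continuous vP) (conj_arg_ge0 vP) eta_gt0 arg_flow_rate.
have -> : (fun t => expR (- r * t) * disc_arg (shadow (tau + t))) =
    (fun t => expR (r * tau) * (L - Phi (t + tau))).
  apply/funext => t; rewrite disc_argE (h _).2 mulrA -expRD (addrC tau); congr (expR _ * _).
  ring.
rewrite -[X in _ --> X](mulr0 (expR (r * tau))); apply: cvgM; first exact: cvg_cst.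
rewrite -(subrr L); apply: cvgB; first exact: cvg_cst.
by rewrite cvg_shiftr.
Qed.

Lemma shadow_onto P : 0 < P -> exists tau, shadow tau = P.
Proof.
move=> P0; exists (ln P / kap); rewrite shadowE mulrCA divff ?mulr1 ?lnK//.
by rewrite gt_eqF// subr_gt0.
Qed.

Lemma conj0 : vs 0 = 0.
Proof. by rewrite (conj_low vP)// ltW// (marginal0_gt0 vP). Qed.

Lemma disc_conj_integrable P : 0 <= P -> mu.-integrable `[0, +oo[
  (EFin \o (fun t : R => rho * expR (- rho * t) * vs (delta * expR (kap * t) * P))).
Proof.
rewrite le_eqVlt => /predU1P[<-|].
  rewrite (_ : EFin \o _ = cst 0%E); first exact: integrable0.
  by apply/funext => t /=; rewrite mulr0 conj0 mulr0.
move=> /shadow_onto[tau <-].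
have [Phi [L [_ _ h]]] := disc_antiderivative rho_gt0 conj_continuous (conj_ge0 vP) eta_gt0 conj_flow_rate.
exact: (h tau).1.
Qed.

Lemma disc_arg_integrable P : 0 < P -> mu.-integrable `[0, +oo[
  (EFin \o (fun t : R => r * expR (- r * t) * g (delta * expR (kap * t) * P))).
Proof.
move=> /shadow_onto[tau <-].
have [Phi [L [_ _ h]]] := disc_antiderivative r_gt0 (conj_arg_continuous vP) (conj_arg_ge0 vP) eta_gt0 arg_flow_rate.
exact: (h tau).1.
Qed.

Lemma disc_conj0 : disc_conj 0 = 0.
Proof.
rewrite disc_conjE; under eq_Rintegral do rewrite mulr0 conj0 mulr0.
by rewrite Rintegral_cst ?mul0r.
Qed.

(** Because prices grow at the rate rho - r, payments weighted by price and discounted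
    at the rate rho are discounted at the rate r, like promises. *)
Lemma discount_weight t : rho * expR (- rho * t) * (delta * expR (kap * t)) = r * expR (- r * t).
Proof.
have -> : expR (- r * t) = expR (- rho * t) * expR (kap * t).
  by rewrite -expRD; congr expR; ring.
by field; rewrite gt_eqF// rho_gt0.
Qed.

(** The subgradient inequality of the conjugate, integrated along the price path. *)
Lemma disc_conj_subgradient P Q : 0 < P -> 0 <= Q ->
  disc_conj P + disc_arg P * (Q - P) <= disc_conj Q.
Proof.
move=> P0 Q0; have iP := disc_conj_integrable (ltW P0).
have iQ := disc_conj_integrable Q0; have iA := disc_arg_integrable P0.
have mI : measurable (`[0, +oo[%classic : set R) by exact: measurable_itv.
have iA' : mu.-integrable `[0, +oo[
  (EFin \o (fun t : R => r * expR (- r * t) * g (delta * expR (kap * t) * P) * (Q - P))).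
  exact: integrable_mulr.
rewrite disc_argE -RintegralZr// !disc_conjE -RintegralD//.
apply: le_Rintegral => //; first exact: integrable_add.
move=> t _; rewrite -discount_weight.
have w0 : 0 <= rho * expR (- rho * t) by rewrite mulr_ge0 ?expR_ge0// ltW// rho_gt0.
have := conj_subgradient vP (delta * expR (kap * t) * P) (delta * expR (kap * t) * Q).
by move=> /(ler_wpM2l w0); lra.
Qed.

Lemma disc_arg_ge0 P : 0 <= disc_arg P.
Proof.
by rewrite disc_argE; apply: Rintegral_ge0 => t _; rewrite !mulr_ge0 ?expR_ge0// ?(conj_arg_ge0 vP)// ltW.
Qed.

Lemma disc_conj_ge0 P : 0 <= disc_conj P.
Proof.
by rewrite disc_conjE; apply: Rintegral_ge0 => t _; rewrite !mulr_ge0 ?expR_ge0// ?(conj_ge0 vP)// ltW// rho_gt0.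
Qed.

Lemma disc_conj_bound P : 0 <= P ->
  disc_conj P <= rho * C / (rho - kap * q) * (1 + (delta * P) `^ q).
Proof.
move=> P0; have d0 := delta_gt0; have e0 := eta_gt0.
set eta := rho - kap * q in e0 *.
have dP : 0 <= delta * P by rewrite mulr_ge0// ltW.
pose K := rho * (C * (1 + (delta * P) `^ q)).
have K0 : 0 <= K by rewrite !mulr_ge0 ?addr_ge0 ?powR_ge0// ltW// rho_gt0.
have cf : continuous (fun t : R => K * expR (- eta * t) : R).
  by move=> t; apply: is_derive_continuous (is_derive_scale K (is_derive_expM (- eta) t)).
have f0 t : 0 <= t -> 0 <= K * expR (- eta * t) by rewrite mulr_ge0 ?expR_ge0.
have df (t : R) : 0 <= t -> is_derive t (1 : R) (fun t => - (K / eta) * expR (- eta * t)) (K * expR (- eta * t)).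
  move=> _; apply: is_derive_eq (is_derive_scale (- (K / eta)) (is_derive_expM (- eta) t)) _.
  by move: (expR _) => ?; field; rewrite gt_eqF.
have cP : - (K / eta) * expR (- eta * t) @[t --> +oo] --> (0 : R).
  rewrite -[X in _ --> X](mulr0 (- (K / eta))); apply: cvgM; first exact: cvg_cst.
  exact: cvg_expRN.
have [iK eK] := half_line_antiderivative cf f0 df cP.
have -> : rho * C / eta * (1 + (delta * P) `^ q) = K / eta by rewrite /K; ring.
have -> : K / eta = \int[mu]_(t in `[0, +oo[) (K * expR (- eta * t)).
  by rewrite eK (mulr0 (- eta)) expR0 mulr1 sub0r opprK.
rewrite disc_conjE; apply: le_Rintegral => //; first exact: disc_conj_integrable.
move=> t; rewrite /= in_itv/= andbT => t0.
have := ler_wpM2l (ltW rho_gt0) (conj_flow_bound dP t0).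
by rewrite /K !mulrA (mulrAC delta P).
Qed.

Lemma shadow_lt s t : s < t -> shadow s < shadow t.
Proof. by move=> st; rewrite !shadowE ltr_expR ltr_pM2l ?subr_gt0. Qed.

Lemma shadow_le s t : s <= t -> shadow s <= shadow t.
Proof. by move=> st; rewrite !shadowE ler_expR ler_pM2l ?subr_gt0. Qed.

Lemma is_derive_shadow tau : is_derive tau (1 : R) shadow (kap * shadow tau).
Proof.
have -> : shadow = fun tau => expR (kap * tau) by apply/funext => s; exact: shadowE.
exact: is_derive_expM.
Qed.

Lemma is_derive_global_min (f : R -> R) (df x : R) :
  (forall t, derivable f t 1) -> is_derive x (1 : R) f df ->
  (forall t, f x <= f t) -> df = 0.
Proof.
move=> df' hf h; have hm : is_derive x (1 : R) f 0.
  apply: (@derive1_at_min _ f (x - 1) (x + 1)) => //; first by lra.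
  by rewrite in_itv/=; lra.
by rewrite -(@derive_val _ _ _ _ _ _ _ hf) (@derive_val _ _ _ _ _ _ _ hm).
Qed.

(** The price P minimises Q |-> disc_conj Q - disc_arg P * Q. Along the price path the
    derivative of this function is known from is_derive_disc_conj, and its vanishing
    is the claim. *)
Lemma disc_conj_hjb P : 0 < P ->
  disc_conj P = vs (delta * P) + (1 - delta) * P * disc_arg P.
Proof.
move=> /shadow_onto[tau <-]; set A := disc_arg (shadow tau).
pose f t := disc_conj (shadow t) - A * shadow t.
have dF t : is_derive t (1 : R) f (rho * (disc_conj (shadow t) - vs (delta * shadow t)) - A * (kap * shadow t)).
  exact: (is_deriveB (is_derive_disc_conj t) (is_derive_scale A (is_derive_shadow t))).
have := is_derive_global_min (fun t => @ex_derive _ _ _ _ _ _ _ (dF t)) (dF tau) _.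
have h t : f tau <= f t.
  have := disc_conj_subgradient (shadow_gt0 tau) (ltW (shadow_gt0 t)).
  rewrite /f /A.
  move: (shadow t) (shadow tau) (disc_conj (shadow t)) (disc_conj (shadow tau)) (disc_arg _).
  by move=> *; lra.
move=> /(_ h) e; have r0 := rho_gt0.
apply: (@mulfI _ rho); first by rewrite gt_eqF.
clear h dF; rewrite {}/f {}/A in e *.
move: (shadow tau) (vs _) (disc_arg _) (disc_conj _) e => S V A B e.
have -> : rho * (V + (1 - delta) * S * A) = rho * V + kap * S * A.
  by field; rewrite gt_eqF.
by lra.
Qed.

(** Payments increase along the price path, hence the discounted excess of the promise
    over the present payment decreases. *)
Lemma disc_arg_excess tau t : 0 <= t ->
  expR (- r * t) * (disc_arg (shadow (tau + t)) - g (delta * shadow tau)) <=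
  disc_arg (shadow tau) - g (delta * shadow tau).
Proof.
have d0 := delta_gt0.
move=> t0; set G := g _.
pose N s := expR (- r * s) * (disc_arg (shadow (tau + s)) - G).
have dN (s : R) : is_derive s (1 : R) N
    (r * expR (- r * s) * (G - g (delta * shadow (tau + s)))).
  have h := is_derive_shiftl (is_derive_disc_arg (tau + s)).
  have h1 := is_deriveB h (is_derive_cst G s 1).
  apply: is_derive_eq (is_derive_mul (is_derive_expM (- r) s) h1) _.
  have -> : ((fun s : R => (disc_arg \o shadow) (tau + s)) - cst G) s = disc_arg (shadow (tau + s)) - G by [].
  ring.
have Glt s : 0 <= s -> G <= g (delta * shadow (tau + s)).
  by move=> s0; apply: (conj_arg_le vP); rewrite ler_pM2l// shadow_le// lerDl.
have <- : N 0 = disc_arg (shadow tau) - G by rewrite /N (mulr0 (- r)) expR0 mul1r (addr0 tau).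
rewrite -lerN2.
apply: (@mvt_le _ (fun s => - N s) (fun t => - (r * expR (- r * t) * (G - g (delta * shadow (tau + t))))) 0 t) => //.
move=> s /andP[s0 _]; rewrite -mulrN mulr_ge0 ?mulr_ge0 ?expR_ge0 ?(ltW r_gt0)//.
by rewrite opprB subr_ge0 Glt.
Qed.

(** A negative excess could not decay, whereas promises are nonnegative. *)
Lemma disc_arg_ge tau : g (delta * shadow tau) <= disc_arg (shadow tau).
Proof.
rewrite leNgt; apply/negP => AG.
have G0 := le_lt_trans (disc_arg_ge0 _) AG.
have e0 : 0 < (g (delta * shadow tau) - disc_arg (shadow tau)) / g (delta * shadow tau).
  by rewrite divr_gt0// subr_gt0.
have [t t0] := expRN_small r_gt0 e0; rewrite ltr_pdivlMr//.
have := disc_arg_excess tau t0.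
have := mulr_ge0 (expR_ge0 (- r * t)) (disc_arg_ge0 (shadow (tau + t))).
by move: (expR _) (disc_arg _) (disc_arg _) (g _) => *; lra.
Qed.

(** The inequality is strict because at some later time the payment has strictly
    increased. *)
Lemma disc_arg_gt P : 0 < P -> g (delta * P) < disc_arg P.
Proof.
have d0 := delta_gt0; have dv0 := marginal0_gt0 vP.
move=> P0; have /shadow_onto[tau tauE] := P0.
have /shadow_onto[sigma sE] : 0 < P + dv 0 / delta by rewrite addr_gt0// divr_gt0.
have ts : tau <= sigma.
  rewrite leNgt; apply/negP => /shadow_lt; rewrite tauE sE ltNge.
  by rewrite lerDl divr_ge0// ltW.
have gg : g (delta * P) < g (delta * shadow sigma).
  rewrite sE mulrDr mulrCA divff ?mulr1 ?gt_eqF//.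
  have dP : 0 < delta * P by rewrite mulr_gt0.
  have [h|/ltW h] := leP (dv 0) (delta * P); first by rewrite (conj_arg_lt vP)// ltrDl.
  have := @conj_arg_lt _ _ _ vP (dv 0) (delta * P + dv 0) (lexx _).
  by rewrite (conj_arg_low (lexx (dv 0))) (conj_arg_low h); apply; rewrite ltrDr.
have := disc_arg_excess tau (t := sigma - tau).
rewrite subr_ge0 subrKC tauE => /(_ ts).
have := disc_arg_ge sigma; move: gg (expR_gt0 (- r * (sigma - tau))).
move: (disc_arg _) (disc_arg _) (g _) (g _) (expR _) => a b c d e.
by move=> *; nra.
Qed.

Lemma disc_arg_shadow_lt s t : s < t -> disc_arg (shadow s) < disc_arg (shadow t).
Proof.
move=> st.
apply: (@mvt_lt _ (disc_arg \o shadow) (fun tau => r * (disc_arg (shadow tau) - g (delta * shadow tau))) s t) => //.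
  by move=> x _; exact: is_derive_disc_arg.
by move=> x _; rewrite mulr_gt0// subr_gt0 disc_arg_gt// shadow_gt0.
Qed.

Lemma disc_arg_continuous : continuous (disc_arg \o shadow).
Proof. by move=> t; apply: is_derive_continuous (is_derive_disc_arg t). Qed.

(** Large values: the promise exceeds the present payment, and payments are unbounded.
    Small values: below the price dv 0 / delta nothing is paid, so that the promise
    decays exponentially backwards in time. *)
Lemma disc_arg_onto y : 0 < y -> exists tau, disc_arg (shadow tau) = y.
Proof.
move=> y0; have d0 := delta_gt0; have dv0 := marginal0_gt0 vP.
have [b yb] : exists b, y <= disc_arg (shadow b).
  have /shadow_onto[b bE] : 0 < dv y / delta.
    by rewrite divr_gt0// (marginal_gt0 vP)// ltW.
  exists b; apply: le_trans (disc_arg_ge b).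
  by rewrite bE mulrCA divff ?mulr1 ?gt_eqF// (conj_arg_marginal vP)// ltW.
have [a ay] : exists a, disc_arg (shadow a) <= y.
  have /shadow_onto[c cE] : 0 < dv 0 / delta by rewrite divr_gt0.
  set A := disc_arg (shadow c); have A0 : 0 <= A by exact: disc_arg_ge0.
  have A1 : 0 < A + 1 by lra.
  have [t t0 ht] := expRN_small r_gt0 (divr_gt0 y0 A1).
  exists (c - t).
  pose N s := expR (- r * s) * disc_arg (shadow s).
  have dN (s : R) : is_derive s (1 : R) N (- (r * expR (- r * s) * g (delta * shadow s))).
    have h := is_derive_disc_arg s.
    apply: is_derive_eq (is_derive_mul (is_derive_expM (- r) s) h) _.
    rewrite /=; ring.
  have : N (c - t) <= N c.
    apply: (@mvt_le _ N (fun s => - (r * expR (- r * s) * g (delta * shadow s))) (c - t) c) => //; first by lra.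
    move=> s /andP[_ sc]; rewrite conj_arg_low ?mulr0 ?oppr0//.
    by have := shadow_le sc; rewrite cE ler_pdivlMr// mulrC.
  have e : expR (- r * (c - t)) = expR (- r * c) * expR (r * t).
    by rewrite -expRD; congr expR; ring.
  have e1 : expR (- r * t) * expR (r * t) = 1.
    by rewrite -expRD -mulrDl addNr mul0r expR0.
  rewrite /N e -mulrA ler_pM2l ?expR_gt0// => h.
  have := ler_wpM2l (expR_ge0 (- r * t)) h; rewrite mulrA e1 mul1r => {}h.
  apply: (le_trans h); apply: le_trans (ler_wpM2r A0 (ltW ht)) _.
  by rewrite mulrAC ler_pdivrMr// ler_pM2l// lerDl.
have ab : a <= b.
  by rewrite leNgt; apply/negP => /disc_arg_shadow_lt/(le_lt_trans yb); rewrite ltNge ay.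
have cA : {within `[a, b], continuous (disc_arg \o shadow)}.
  by apply: continuous_subspaceT; exact: disc_arg_continuous.
have [|tau _ tauE] := IVT ab cA (v := y); last by exists tau.
by rewrite /= ge_min ay le_max yb orbT.
Qed.

End Discount.

(** * The value of serving a promise forever *)

Section Continuation.
Context {R : realType} (v dv : R -> R) (r rho : R).
Local Notation mu := (@lebesgue_measure R).
Local Notation g := (conj_arg dv).
Local Notation vs := (legendre v dv).
Local Notation kap := (rho - r).
Local Notation delta := (r / rho).
Local Notation B := (disc_conj v dv r rho).
Local Notation A := (disc_arg dv r rho).
Local Notation shadow := (shadow r rho).

(** The concave conjugate of disc_conj, which is the function w0. *)
Definition cont_value (y : R) : R := inf [set B P - P * y | P in [set P | 0 <= P]].
(** The time at which the price path through 1 serves the promise y. *)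
Definition ptime (y : R) : R := xget 0 [set tau | A (shadow tau) = y].
(** The minimising price in cont_value y, for y > 0; minus it is the derivative of
    cont_value. *)
Definition price (y : R) : R := shadow (ptime y).

Context (vP : convex_cost v dv) (C q : R).
Context (r_gt0 : 0 < r) (r_lt_rho : r < rho) (C_ge0 : 0 <= C) (q_ge0 : 0 <= q)
  (kapq : kap * q < rho)
  (grow : forall s : R, 0 <= s -> vs s <= C * (1 + s `^ q)).

Let Alt := disc_arg_shadow_lt vP r_gt0 r_lt_rho C_ge0 q_ge0 kapq grow.
Let Agt := disc_arg_gt vP r_gt0 r_lt_rho C_ge0 q_ge0 kapq grow.
Let Bsub := disc_conj_subgradient vP r_gt0 r_lt_rho C_ge0 q_ge0 kapq grow.
Let Bge0 := disc_conj_ge0 vP r_gt0 r_lt_rho.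
Let rho_gt0 := rate_gt0 r_gt0 r_lt_rho.
Let d_gt0 := delta_gt0 r_gt0 r_lt_rho.

Lemma price_gt0 y : 0 < price y. Proof. exact: shadow_gt0. Qed.

Lemma disc_arg_price y : 0 < y -> A (price y) = y.
Proof.
move=> y0; rewrite /price /ptime; case: xgetP => [x _ //|/(_ _) no].
by have [tau /no] := disc_arg_onto vP r_gt0 r_lt_rho C_ge0 q_ge0 kapq grow y0.
Qed.

Lemma disc_arg_gt0 P : 0 < P -> 0 < A P.
Proof. by move/Agt; apply: le_lt_trans; exact: (conj_arg_ge0 vP). Qed.

Lemma ptimeK tau : ptime (A (shadow tau)) = tau.
Proof.
have := disc_arg_price (disc_arg_gt0 (shadow_gt0 r rho tau)); rewrite /price => e.
case: (ltgtP (ptime (A (shadow tau))) tau) => // h.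
  by have := Alt h; rewrite e ltxx.
by have := Alt h; rewrite e ltxx.
Qed.

Lemma price_slack y : 0 < y -> g (delta * price y) < y.
Proof. by move=> y0; rewrite -[ltRHS]disc_arg_price// Agt// price_gt0. Qed.

Lemma is_derive_ptime (y : R) : 0 < y ->
  is_derive y (1 : R) ptime (r * (y - g (delta * price y)))^-1.
Proof.
move=> y0; have e := disc_arg_price y0.
have dA := is_derive_disc_arg vP r_gt0 r_lt_rho C_ge0 q_ge0 kapq grow (ptime y).
have := @is_derive_inverse R (A \o shadow) ptime _ (ptime y) _ _ dA.
rewrite /= -/(price y) e; apply.
- by near=> t; exact: ptimeK.
- by near=> t; exact: (disc_arg_continuous vP r_gt0 r_lt_rho C_ge0 q_ge0 kapq grow).
- by rewrite mulf_neq0 ?gt_eqF// subr_gt0 price_slack.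
Unshelve. all: by end_near. Qed.

Lemma is_derive_price (y : R) : 0 < y -> is_derive y (1 : R) price
  (kap * price y * (r * (y - g (delta * price y)))^-1).
Proof.
move=> y0; exact: (is_derive1_comp (is_derive_shadow r rho (ptime y)) (is_derive_ptime y0)).
Qed.

Lemma price_continuous (y : R) : 0 < y -> {for y, continuous price}.
Proof. by move=> /is_derive_price h; apply: is_derive_continuous h. Qed.

Lemma cont_lbound y : 0 <= y -> has_lbound [set B P - P * y | P in [set P | 0 <= P]].
Proof.
rewrite le_eqVlt => /predU1P[<-|y0].
  by exists 0 => _ [P P0 <-]; rewrite mulr0 subr0.
exists (B (price y) - price y * y) => _ [P P0 <-].
have := Bsub (price_gt0 y) P0; rewrite disc_arg_price//.
by move: (B P) (B (price y)) (price y) => *; lra.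
Qed.

Lemma cont_le y P : 0 <= y -> 0 <= P -> cont_value y <= B P - P * y.
Proof. by move=> y0 P0; apply: ge_inf; [exact: cont_lbound|exists P]. Qed.

Lemma contE y : 0 < y -> cont_value y = B (price y) - price y * y.
Proof.
move=> y0; apply/eqP; rewrite eq_le; apply/andP; split.
  by apply: cont_le; apply: ltW => //; exact: price_gt0.
apply: lb_le_inf; first by exists (B 0 - 0 * y), 0 => /=.
move=> _ [P P0 <-]; have := Bsub (price_gt0 y) P0; rewrite disc_arg_price//.
by move: (B P) (B (price y)) (price y) => *; lra.
Qed.

Lemma cont_subgradient y z : 0 < y -> 0 <= z -> cont_value z <= cont_value y - price y * (z - y).
Proof.
move=> y0 z0; have := cont_le z0 (ltW (price_gt0 y)); rewrite (contE y0).
by move: (price y) (B _) (cont_value z) => *; lra.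
Qed.

Lemma cont_le0 y : 0 <= y -> cont_value y <= 0.
Proof.
move=> y0; have := cont_le y0 (lexx 0).
by rewrite disc_conj0// mul0r subr0.
Qed.

Lemma cont_lt y z : 0 < y -> y < z -> cont_value z < cont_value y.
Proof.
move=> y0 yz; have z0 : 0 <= z by lra.
apply: le_lt_trans (cont_subgradient y0 z0) _.
by rewrite ltrBlDr ltrDl mulr_gt0 ?price_gt0// subr_gt0.
Qed.

Lemma cont_lt0 y : 0 < y -> cont_value y < 0.
Proof.
move=> y0; have y20 : 0 < y / 2 by lra.
by apply: lt_le_trans (cont_le0 (ltW y20)); apply: cont_lt; lra.
Qed.

Lemma is_derive_cont (y : R) : 0 < y -> is_derive y (1 : R) cont_value (- price y).
Proof.
move=> y0.
have h : is_derive y (1 : R) (fun z => - cont_value z) (price y).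
  apply: is_derive_subgradient (price_continuous y0); near=> z.
  have z0 : 0 < z by near: z; exact: lt_nbhsr.
  have := cont_subgradient y0 (ltW z0); have := cont_subgradient z0 (ltW y0).
  by move: (cont_value y) (cont_value z) (price y) (price z) => *; split; lra.
apply: near_eq_is_derive (is_deriveN h).
by near=> z; rewrite /= opprK.
Unshelve. all: by end_near. Qed.

Lemma cont_hjb y : 0 < y -> cont_value y = vs (delta * price y) - delta * price y * y.
Proof.
move=> y0; rewrite contE// (disc_conj_hjb vP r_gt0 r_lt_rho C_ge0 q_ge0 kapq grow (price_gt0 y)).
rewrite disc_arg_price//; move: (price y) (vs _) => P V; ring.
Qed.

(** The function F_dm in terms of the cost: the slack in the Hamilton-Jacobi-Bellman
    inequality for the value of retiring. *)
Definition retire_slack (m y : R) : R := m - v y - vs (delta * dv y) + delta * dv y * y.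

(** Let h s = vs (delta * s) - delta * s * y. By cont_hjb the difference of the two
    values is h (price y) - h (dv y) - retire_slack m y. As h is convex and decreasing
    at the price, price y >= dv y would make this negative. *)
Lemma price_lt_marginal m y : 0 < y -> 0 < retire_slack m y -> - v y <= cont_value y - m ->
  price y < dv y.
Proof.
move=> y0 G0 VW; rewrite ltNge; apply/negP => dP.
have := conj_subgradient vP (delta * price y) (delta * dv y).
have : 0 <= (y - g (delta * price y)) * (delta * (price y - dv y)).
  have := price_slack y0; have d0 := d_gt0.
  by move=> /ltW h; apply: mulr_ge0; rewrite ?subr_ge0// mulr_ge0 ?subr_ge0// ltW.
move: VW G0; rewrite cont_hjb// /retire_slack.
move: (price y) (dv y) (v y) => P D V.
by move: delta (g _) (vs _) (vs _) => d a b c *; lra.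
Qed.

(** The same decomposition: h also decreases at the marginal cost, so a smaller price
    makes the difference of the values positive. *)
Lemma cont_gt_of_price_lt m y : 0 < y -> retire_slack m y <= 0 -> price y < dv y ->
  - v y < cont_value y - m.
Proof.
move=> y0 G0 dP; have gy : g (delta * dv y) < y.
  have h : delta * dv y < dv y.
    by rewrite gtr_pMl ?(marginal_gt0 vP)// ?ltr_pdivrMr// ?mul1r// ltW.
  by apply: (conj_arg_lt_marginal vP) => //; exact: ltW.
have := conj_subgradient vP (delta * dv y) (delta * price y).
have : 0 < (y - g (delta * dv y)) * (delta * (dv y - price y)).
  by have d0 := d_gt0; rewrite mulr_gt0 ?subr_gt0// mulr_gt0 ?subr_gt0.
move: G0; rewrite cont_hjb// /retire_slack.
move: (price y) (dv y) (v y) => P D V.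
by move: delta (g _) (vs _) (vs _) => d a b c *; lra.
Qed.

(** The discounted gap between the conjugates of continuing and of retiring. *)
Let gap m tau := expR (- rho * tau) * (B (shadow tau) - m - vs (shadow tau)).

Lemma is_derive_gap m (tau : R) : dv 0 <= shadow tau ->
  is_derive tau (1 : R) (gap m) (rho * expR (- rho * tau) * retire_slack m (g (shadow tau))).
Proof.
move=> S0.
have dB := is_derive_disc_conj vP r_gt0 r_lt_rho C_ge0 q_ge0 kapq grow tau.
have dV := is_derive1_comp (is_derive_conj vP (shadow tau)) (is_derive_shadow r rho tau).
have h := is_deriveB (is_deriveB dB (is_derive_cst m tau 1)) dV.
apply: is_derive_eq (is_derive_mul (is_derive_expM (- rho) tau) h) _.
have -> : ((B \o shadow) - cst m - (vs \o shadow)) tau = B (shadow tau) - m - vs (shadow tau) by [].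
rewrite subr0 /retire_slack (marginal_conj_arg vP)//.
have -> : v (g (shadow tau)) = shadow tau * g (shadow tau) - vs (shadow tau).
  by rewrite legendreE; lra.
move: (shadow tau) (expR _) => S E; move: (g _) (B _) (vs S) => a b c.
by move: (vs _) => d; field; rewrite gt_eqF// rho_gt0.
Qed.

(** The derivative of the gap has the sign of the slack, so the gap decreases in the
    region in question. Its lower limit is nonnegative, hence it is positive. *)
Lemma disc_conj_gt m ybar P : 0 <= ybar -> (forall z, ybar < z -> retire_slack m z < 0) ->
  dv ybar <= P -> vs P < B P - m.
Proof.
move=> y0 Gneg yP; have dv0 := marginal_le vP (lexx 0) y0.
have P0 : 0 < P by apply: lt_le_trans yP; exact: (marginal_gt0 vP).
have [tau tauE] := shadow_onto r_lt_rho P0.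
have gapdecr s t : tau <= s -> s < t -> gap m t < gap m s.
  move=> ts st; rewrite -ltrN2.
  have St x : s <= x -> dv 0 <= shadow x.
    move=> sx; have := shadow_le r_lt_rho (le_trans ts sx); rewrite tauE.
    by move=> h; lra.
  apply: (@mvt_lt _ (fun x => - gap m x) (fun x => - (rho * expR (- rho * x) * retire_slack m (g (shadow x)))) s t st).
    by move=> x /andP[sx _]; apply: is_deriveN; exact: is_derive_gap (St x sx).
  move=> x /andP[sx _]; rewrite -mulrN; apply: mulr_gt0.
    by apply: mulr_gt0; [exact: rho_gt0|exact: expR_gt0].
  rewrite oppr_gt0; apply: Gneg; rewrite -(conj_arg_marginal vP y0).
  apply: (conj_arg_lt vP) => //; apply: le_lt_trans yP _; rewrite -tauE.
  by apply: (shadow_lt r_lt_rho); lra.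
have gap1 : 0 <= gap m (tau + 1).
  rewrite leNgt; apply/negP => g1.
  have h : expR (- rho * t) * vs (1 * expR (kap * t)) + expR (- rho * t) * m @[t --> +oo] --> (0 : R).
    rewrite -[X in _ --> X](addr0 (0 : R)); apply: cvgD.
      exact: (conj_flow_cvg0 vP r_lt_rho C_ge0 q_ge0 kapq grow ler01).
    rewrite -[X in _ --> X](mul0r m); apply: cvgM; last exact: cvg_cst.
    by apply: cvg_expRN; exact: rho_gt0.
  have [M [_ hM]] : \forall t \near +oo, expR (- rho * t) * vs (1 * expR (kap * t)) + expR (- rho * t) * m < - gap m (tau + 1).
    by apply: (cvgr_lt _ h); rewrite oppr_gt0.
  pose t := Num.max (M + 1) (tau + 2).
  have tt : tau + 1 < t by rewrite lt_max; apply/orP; right; lra.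
  have tM : M < t by rewrite lt_max; apply/orP; left; lra.
  have := hM t tM; have : tau <= tau + 1 by lra.
  move=> /gapdecr/(_ tt); rewrite {1}/gap mul1r -shadowE.
  have := mulr_ge0 (expR_ge0 (- rho * t)) (Bge0 (shadow t)).
  by move: (expR _) (vs _) (B _) (gap _ _) => *; lra.
have : gap m (tau + 1) < gap m tau by apply: gapdecr; lra.
move=> /(le_lt_trans gap1); rewrite /gap pmulr_rgt0 ?expR_gt0// tauE.
by move: (B P) (vs P) => *; lra.
Qed.

Lemma cont_gt m ybar y : 0 <= ybar -> 0 < y -> (forall z, ybar < z -> retire_slack m z < 0) ->
  retire_slack m y <= 0 -> ybar <= y -> - v y < cont_value y - m.
Proof.
move=> yb0 y0 Gneg Gy yby; have [|dP] := ltP (price y) (dv y).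
  exact: cont_gt_of_price_lt.
have := fenchel_young vP (price y) (ltW y0).
have := disc_conj_gt yb0 Gneg (le_trans (marginal_le vP yb0 yby) dP).
rewrite contE//; move: (price y) => P; move: (vs _) (B _) (v y) => *; lra.
Qed.

Section Crossing.
Variables m yh yb : R.
Hypotheses (yh_gt0 : 0 < yh) (yhE : v yh = m) (yh_yb : yh <= yb).
Hypothesis slack_gt0 : forall y, 0 <= y -> y < yb -> 0 < retire_slack m y.
Hypothesis slack_le0 : forall y, yb <= y -> retire_slack m y <= 0.
Hypothesis slack_lt0 : forall y, yb < y -> retire_slack m y < 0.

Let D y := cont_value y - m + v y.

Let D_yh y : 0 < y -> y <= yh -> D y < 0.
Proof.
move=> y0 yyh; have := cont_lt0 y0; have := cost_le vP (ltW y0) yyh.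
by rewrite /D yhE; move: (cont_value y) (v y) => *; lra.
Qed.

Let D_yb y : yb <= y -> 0 < D y.
Proof.
move=> yby; have yb0 : 0 <= yb by exact: le_trans (ltW yh_gt0) yh_yb.
have y0 : 0 < y by exact: lt_le_trans yh_gt0 (le_trans yh_yb yby).
have := cont_gt yb0 y0 slack_lt0 (slack_le0 yby) yby.
by rewrite /D; move: (cont_value y) (v y) => *; lra.
Qed.

Lemma is_derive_cost (y : R) : 0 < y -> is_derive y (1 : R) v (dv y).
Proof.
move=> y0; apply: is_derive_subgradient.
  near=> z; have z0 : 0 <= z by apply: ltW; near: z; exact: lt_nbhsr.
  by split; apply: (cost_subgradient vP) => //; exact: ltW.
have e : {near y, (fun x : R => dv (Num.max 0 x)) =1 dv}.
  by near=> z; rewrite (max_idPr _)//; apply: ltW; near: z; exact: lt_nbhsr.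
have h := marginal_continuous vP (x := y).
rewrite /continuous_at (max_idPr (ltW y0)) in h.
exact: (cvg_trans (near_eq_cvg e) h).
Unshelve. all: by end_near. Qed.

Let dD (y : R) : 0 < y -> is_derive y (1 : R) D (dv y - price y).
Proof.
move=> y0; have h := is_deriveB (is_derive_cont y0) (is_derive_cst m y 1).
apply: is_derive_eq (is_deriveD h (is_derive_cost y0)) _.
by rewrite subr0 addrC.
Qed.

(** At a maximum of D in the interval, D is nonnegative, so price_lt_marginal makes
    its derivative positive; the maximum is thus at b only. *)
Let D_pos a b : 0 < a -> a < b -> b < yb -> 0 <= D a -> 0 < D b.
Proof.
move=> a0 ab byb Da; rewrite ltNge; apply/negP => Db.
have cD : {within `[a, b], continuous D}.
  apply: continuous_in_subspaceT => y; rewrite inE/= in_itv/= => /andP[h _].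
  by apply: is_derive_continuous (dD (lt_le_trans a0 h)).
have [c [acb Dc cmax]] : exists c, [/\ a <= c < b, 0 <= D c & forall t, a <= t <= b -> D t <= D c].
  have [c] := EVT_max (ltW ab) cD.
  rewrite in_itv/= => /andP[ac]; rewrite le_eqVlt => /predU1P[-> | cb] cmax.
    have ba : D b <= D a by exact: le_trans Db Da.
    exists a; split; rewrite ?lexx//.
    by move=> t tab; apply: le_trans ba; apply: cmax.
  exists c; split=> //; first by rewrite ac.
  by apply: le_trans Da _; apply: cmax; rewrite in_itv/= lexx ltW.
have [ac cb] : a <= c /\ c < b by move/andP: acb.
have c0 : 0 < c by exact: lt_le_trans a0 ac.
have pd : price c < dv c.
  apply: (price_lt_marginal c0 (slack_gt0 (ltW c0) (lt_trans cb byb))).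
  by move: Dc; rewrite /D; move: (cont_value c) (v c) => *; lra.
rewrite -subr_gt0 in pd.
have [z /andP[cz zb]] := is_derive_gt0_right (dD c0) pd cb.
by rewrite ltNge cmax// (le_trans ac (ltW cz)) ltW.
Qed.

(** The difference of the two values is negative up to yh and positive from yb on; in
    between, by D_pos, it stays positive after its first zero. *)
Lemma crossing : exists yt, [/\ yh < yt < yb, - v yt = cont_value yt - m, price yt < dv yt,
  forall y, 0 < y -> y < yt -> cont_value y - m < - v y &
  forall y, yt < y -> - v y < cont_value y - m].
Proof.
have cD : {within `[yh, yb], continuous D}.
  apply: continuous_in_subspaceT => y; rewrite inE/= in_itv/= => /andP[h _].
  by apply: is_derive_continuous (dD (lt_le_trans yh_gt0 h)).
have [|yt] := IVT yh_yb cD (v := 0).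
  by rewrite ge_min le_max (ltW (D_yh yh_gt0 (lexx _))) (ltW (D_yb (lexx _))) orbT.
rewrite in_itv/= => /andP[h1 h2] Dyt; exists yt.
have yt1 : yh < yt.
  rewrite lt_neqAle h1 andbT; apply/eqP => e.
  by have := D_yh yh_gt0 (lexx _); rewrite e Dyt ltxx.
have yt2 : yt < yb.
  rewrite lt_neqAle h2 andbT; apply/eqP => e.
  by have := D_yb (lexx _); rewrite -e Dyt ltxx.
have yt0 : 0 < yt by exact: lt_trans yh_gt0 yt1.
have DE y : D y = cont_value y - m + v y by [].
have e : - v yt = cont_value yt - m by move: Dyt; rewrite DE; move: (cont_value yt) (v yt) => *; lra.
split => //.
- by rewrite yt1.
- by apply: (price_lt_marginal yt0 (slack_gt0 (ltW yt0) yt2)); rewrite e.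
- move=> y y0 yyt; have : ~~ (0 <= D y).
    by apply/negP => /(D_pos y0 yyt yt2); rewrite Dyt ltxx.
  by rewrite -ltNge DE; move: (cont_value y) (v y) => *; lra.
- move=> y yty; have : 0 < D y.
    have [yyb|] := ltP y yb; last exact: D_yb.
    by apply: (D_pos yt0 yty yyb); rewrite Dyt.
  by rewrite DE; move: (cont_value y) (v y) => *; lra.
Qed.

End Crossing.

End Continuation.

(** * Paths of promises *)

Section Increments.
Context {R : realType}.
Local Notation mu := (@lebesgue_measure R).

(** Over a partition into n equal steps the increments add up to at most a constant
    divided by n. This replaces the differentiation of absolutely continuous
    functions. *)
Lemma constant_of_increments (D V : R -> R) (c T : R) : 0 <= c -> 0 <= T ->
  (forall s t, 0 <= s -> s <= t -> t <= T ->
    `|D t - D s| <= c * (t - s) * (V t - V s)) -> D T = D 0.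
Proof.
move=> c0 T0 h; apply/eqP; rewrite -subr_eq0 -normr_le0 leNgt; apply/negP => e0.
pose W := c * T * (V T - V 0).
have W0 : 0 <= W.
  by have := le_trans (normr_ge0 _) (h 0 T (lexx _) T0 (lexx _)); rewrite subr0.
pose n := (Num.truncn (W / `|D T - D 0|)).+1.
have nW : W < n%:R * `|D T - D 0|.
  rewrite -ltr_pdivrMr//; exact: truncnS_gt.
have n0 : 0 < n%:R :> R by rewrite ltr0n.
pose t k : R := k%:R * (T / n%:R).
have t0 k : 0 <= t k by rewrite mulr_ge0// divr_ge0.
have tS k : t k.+1 - t k = T / n%:R by rewrite /t -mulrBl -natrB// subSnn mul1r.
have tT k : (k <= n)%N -> t k <= T.
  move=> kn; rewrite /t mulrA ler_pdivrMr// [leRHS]mulrC ler_wpM2r// ler_nat//.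
have part k : (k <= n)%N -> `|D (t k) - D 0| <= c * (T / n%:R) * (V (t k) - V 0).
  elim: k => [_|k IH kn]; first by rewrite /t mul0r !subrr normr0 mulr0.
  have h1 := IH (ltnW kn).
  have tk : t k <= t k.+1 by rewrite -subr_ge0 tS divr_ge0.
  have := h _ _ (t0 k) tk (tT _ kn); rewrite tS => h2.
  have := ler_normD (D (t k.+1) - D (t k)) (D (t k) - D 0); rewrite subrKA.
  move: (c * _) h1 h2 => C h1 h2 h3; apply: le_trans h3 _; lra.
have tn : t n = T by rewrite /t mulrCA divff ?mulr1// gt_eqF.
have := part n (leqnn _); rewrite tn mulrA -[_ / _ * _]mulrAC ler_pdivlMr//.
by rewrite -/W leNgt mulrC nW.
Qed.

Lemma Rintegral_increment (f : R -> R) s t : 0 <= s -> s <= t ->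
  mu.-integrable `[0, t] (EFin \o f) ->
  \int[mu]_(x in `[0, t]) f x - \int[mu]_(x in `[0, s]) f x = \int[mu]_(x in `]s, t]) f x.
Proof. by move=> s0 st ft; rewrite Rintegral_itvB// bnd_simp. Qed.

Lemma integrable_increment (f : R -> R) s t T : 0 <= s -> t <= T ->
  mu.-integrable `[0, T] (EFin \o f) -> mu.-integrable `]s, t] (EFin \o f).
Proof.
move=> s0 tT; apply: integrableS => //.
by apply: subset_itv; rewrite bnd_simp.
Qed.

Lemma integrable_initial (f : R -> R) t T : t <= T ->
  mu.-integrable `[0, T] (EFin \o f) -> mu.-integrable `[0, t] (EFin \o f).
Proof.
by move=> tT; apply: integrableS => //; apply: subset_itv; rewrite bnd_simp.
Qed.

Lemma Rintegral_oc_antiderivative (f Phi : R -> R) (a b : R) : continuous f ->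
  (forall t, a <= t <= b -> is_derive t (1 : R) Phi (f t)) -> a <= b ->
  \int[mu]_(s in `]a, b]) f s = Phi b - Phi a.
Proof.
move=> cf dP ab; rewrite -(Rintegral_antiderivative cf dP ab).
rewrite Rintegral_itv_obnd_cbnd//.
apply: integrableS (continuous_integrable_itv a b cf) => //.
by apply: subset_itvr; rewrite bnd_simp.
Qed.

Lemma integrable_cmul (c f : R -> R) (a b : R) : continuous c ->
  mu.-integrable `[a, b] (EFin \o f) -> mu.-integrable `[a, b] (EFin \o (fun x => c x * f x)).
Proof.
move=> cc fi; have [ab|ab] := leP a b; last first.
  by rewrite set_itv_ge ?bnd_simp -?ltNge//; exact: integrable_set0.
have [z _ zM] : exists2 z, z \in `[a, b] & forall t, t \in `[a, b] -> `|c t| <= `|c z|.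
  apply: EVT_max => //; apply: continuous_subspaceT => x.
  by apply: cvg_norm; exact: cc.
apply: eq_integrable (integrableMr _ _ _ fi) => //.
  by apply: measurable_funTS; exact: continuous_measurable_fun.
exists `|c z|; split; first exact: num_real.
by move=> M zM' x xab; apply: le_trans (zM x xab) (ltW zM').
Qed.

Lemma continuous_integrable_oc (f : R -> R) a b : continuous f ->
  mu.-integrable `]a, b] (EFin \o f).
Proof.
move=> cf; apply: integrableS (continuous_integrable_itv a b cf) => //.
by apply: subset_itvr; rewrite bnd_simp.
Qed.

Lemma Rintegral_oc_cst (k a b : R) : a <= b ->
  \int[mu]_(_ in `]a, b]) k = k * (b - a).
Proof.
move=> ab.
have ck : continuous (cst k : R -> R) by move=> x; exact: cvg_cst.
have dk (x : R) : a <= x <= b -> is_derive x (1 : R) (fun x => k * x) (cst k x).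
  by move=> _; apply: is_derive_eq (is_derive_scale k (is_derive_id x 1)) _; rewrite mulr1.
by have := Rintegral_oc_antiderivative ck dk ab; rewrite -mulrBr.
Qed.

Lemma le_Rintegral_oc (f h : R -> R) a b :
  mu.-integrable `]a, b] (EFin \o f) -> mu.-integrable `]a, b] (EFin \o h) ->
  (forall x, a < x <= b -> f x <= h x) ->
  \int[mu]_(x in `]a, b]) f x <= \int[mu]_(x in `]a, b]) h x.
Proof.
by move=> fi hi fh; apply: le_Rintegral => // x; rewrite /= in_itv/=; exact: fh.
Qed.

End Increments.

Section Dynamics.
Context {R : realType} (r y0 : R) (p y : R -> R).
Local Notation mu := (@lebesgue_measure R).
Context (r_gt0 : 0 < r) (ode : solves_ode r y0 p y).

Let f s := r * (y s - p s).
Let If t := \int[mu]_(s in `[0, t]) f s.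

Let fi T : mu.-integrable `[0, T] (EFin \o f).
Proof.
have [T0|T0] := leP 0 T; first exact: (ode T0).1.
by rewrite set_itv_ge ?bnd_simp -?ltNge//; exact: integrable_set0.
Qed.

Lemma ode_init : y 0 = y0.
Proof. by have [_ ->] := ode (lexx 0); rewrite set_itv1 Rintegral_set1 addr0. Qed.

Let yB s t : 0 <= s -> s <= t -> y t - y s = \int[mu]_(x in `]s, t]) f x.
Proof.
move=> s0 st; rewrite -Rintegral_increment//.
rewrite (ode s0).2 (ode (le_trans s0 st)).2.
by rewrite opprD addrACA subrr add0r.
Qed.

Lemma ode_continuous T : 0 <= T -> {within `[0, T], continuous y}.
Proof.
move=> T0; apply: (@subspace_eq_continuous _ _ _ (fun t => y0 + If t)).
  move=> t; rewrite inE/= in_itv/= => /andP[t0 _]; exact/esym/(ode t0).2.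
move=> x; apply: cvgD; first exact: cvg_cst.
exact: (parameterized_integral_continuous T0 (fi T)).
Qed.

Lemma promise_integrable T : mu.-integrable `[0, T] (EFin \o y).
Proof.
have [T0|T0] := leP 0 T; last first.
  by rewrite set_itv_ge ?bnd_simp -?ltNge//; exact: integrable_set0.
apply: continuous_compact_integrable; first exact: segment_compact.
exact: ode_continuous.
Qed.

Lemma payment_integrable T : mu.-integrable `[0, T] (EFin \o p).
Proof.
have := integrable_sub (measurable_itv _) (promise_integrable T)
   (integrable_mull (measurable_itv _) r^-1 (fi T)).
apply: eq_integrable => // x _; congr EFin; rewrite /f mulKf ?gt_eqF//; lra.
Qed.

Lemma expRN_lipschitz (c a b : R) : 0 <= c -> 0 <= a -> a <= b ->
  0 <= expR (- c * a) - expR (- c * b) <= c * (b - a).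
Proof.
move=> c0 a0 ab; apply/andP; split.
  by rewrite subr_ge0 ler_expR !mulNr lerN2 ler_wpM2l.
have e : expR (- c * b) = expR (- c * a) * expR (- (c * (b - a))).
  by rewrite -expRD; congr expR; ring.
have ea : 0 < expR (- c * a) <= 1.
  by rewrite expR_gt0 expR_le1 mulNr oppr_le0 mulr_ge0.
have h := expR_ge1Dx (- (c * (b - a))).
have cb : 0 <= c * (b - a) by rewrite mulr_ge0// subr_ge0.
rewrite e; move: (expR _) (expR _) ea h cb => u w /andP[u0 u1] h cb.
move: (c * (b - a)) h cb => z h cb; nra.
Qed.

(** The integrating factor for a solution that is merely absolutely continuous. Over a
    short interval, the promise moves by at most the integral of its speed and the
    discount factor by at most r times the length, so the difference D of the two
    sides has increments as in constant_of_increments. *)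
Lemma discounted_promise T : 0 <= T ->
  expR (- r * T) * y T = y0 - \int[mu]_(s in `[0, T]) (r * expR (- r * s) * p s).
Proof.
move=> T0.
pose h s := r * expR (- r * s) * p s.
have ce : continuous (fun s : R => r * expR (- r * s) : R).
  by move=> x; apply: is_derive_continuous (is_derive_scale r (is_derive_expM (- r) x)).
have hi t : mu.-integrable `[0, t] (EFin \o h).
  by apply: (integrable_cmul ce); exact: payment_integrable.
pose D t := expR (- r * t) * y t + \int[mu]_(s in `[0, t]) h s.
pose V t := \int[mu]_(s in `[0, t]) `|f s|.
have Vi t : mu.-integrable `[0, t] (EFin \o (fun s => `|f s|)) by exact: integrable_norm.
suff : D T = D 0.
  rewrite /D set_itv1 Rintegral_set1 ode_init mulr0 expR0 mul1r addr0 => <-.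
  by rewrite addrK.
apply: (@constant_of_increments _ D V (2 * r)) => //.
  by rewrite mulr_ge0// ltW.
move=> s t s0 st tT; have t0 := le_trans s0 st.
have VB a b : 0 <= a -> a <= b -> V b - V a = \int[mu]_(x in `]a, b]) `|f x|.
  by move=> a0 ab; rewrite Rintegral_increment.
pose G x := (expR (- r * s) - expR (- r * x)) * f x + r * expR (- r * x) * (y x - y t).
have mI : measurable (`]s, t]%classic : set (measurableTypeR R)) by exact: measurable_itv.
pose es := expR (- r * s).
have i1 : mu.-integrable `]s, t] (EFin \o (fun x => es * f x)).
  by apply: integrable_mull => //; exact: integrable_increment (lexx _) (fi t).
have i2 : mu.-integrable `]s, t] (EFin \o h).
  exact: integrable_increment (lexx _) (hi t).
have i3 : mu.-integrable `]s, t] (EFin \o (fun x => y t * (r * expR (- r * x)))).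
  by apply: integrable_mull => //; exact: continuous_integrable_oc.
have GE x : G x = es * f x + h x - y t * (r * expR (- r * x)).
  by rewrite /G /h /es /f; ring.
have intG : mu.-integrable `]s, t] (EFin \o G).
  apply: eq_integrable (integrable_sub mI (integrable_add mI i1 i2) i3) => //.
  by move=> x _; rewrite /= GE.
have DB : D t - D s = \int[mu]_(x in `]s, t]) G x.
  under eq_Rintegral do rewrite GE.
  rewrite RintegralB//; last exact: integrable_add.
  rewrite RintegralD// RintegralZl//; last exact: integrable_increment (lexx _) (fi t).
  rewrite RintegralZl//; last exact: continuous_integrable_oc.
  have -> : \int[mu]_(x in `]s, t]) (r * expR (- r * x)) =
      - expR (- r * t) - - expR (- r * s).
    apply: (Rintegral_oc_antiderivative (Phi := fun x => - expR (- r * x)) ce) => // x _.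
    apply: is_derive_eq (is_deriveN (is_derive_expM (- r) x)) _.
    by rewrite mulNr opprK.
  rewrite -yB//.
  rewrite -Rintegral_increment// /D /es.
  move: (\int[mu]_(x in `[0, t]) h x) (\int[mu]_(x in `[0, s]) h x) => a b; ring.
have yV x : s < x <= t -> `|y x - y t| <= V t - V s.
  move=> /andP[sx xt]; have x0 : 0 <= x by lra.
  rewrite distrC yB//.
  apply: le_trans (le_normr_Rintegral _ _) _ => //.
    exact: integrable_increment (lexx _) (fi t).
  rewrite -VB// lerB// -subr_ge0 VB//; last exact: ltW.
  exact: Rintegral_ge0.
rewrite DB; apply: le_trans (le_normr_Rintegral _ intG) _ => //.
have -> : 2 * r * (t - s) * (V t - V s) = \int[mu]_(x in `]s, t]) (r * (t - s) * `|f x| + r * (V t - V s)).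
  rewrite RintegralD//.
  - rewrite RintegralZl//; last first.
      by apply: integrable_norm => //; exact: integrable_increment (lexx _) (fi t).
    by rewrite -VB// Rintegral_oc_cst//; move: (V t - V s) => z; ring.
  - by apply: integrable_mull => //; exact: integrable_increment (lexx _) (Vi t).
  - by apply: continuous_integrable_oc => x; exact: cvg_cst.
apply: le_Rintegral_oc; first exact: integrable_norm.
  apply: integrable_add => //.
    by apply: integrable_mull => //; exact: integrable_increment (lexx _) (Vi t).
  by apply: continuous_integrable_oc => x; exact: cvg_cst.
move=> x sx; apply: le_trans (ler_normD _ _) _; rewrite !normrM; apply: lerD.
  apply: ler_wpM2r => //; case/andP: sx => sx xt.
  have /andP[h1 h2] := expRN_lipschitz (ltW r_gt0) s0 (ltW sx).
  by rewrite ger0_norm//; apply: le_trans h2 _; rewrite ler_pM2l//; lra.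
rewrite gtr0_norm// ger0_norm ?expR_ge0// -mulrA ler_pM2l//.
have x0 : 0 <= x by case/andP: sx; lra.
rewrite -[leRHS]mul1r; apply: ler_pM; rewrite ?expR_ge0 ?yV//.
by rewrite expR_le1 mulNr oppr_le0 mulr_ge0// ltW.
Qed.

End Dynamics.

(** * Supersolutions and verification *)

Section Verification.
Context {R : realType} (v dv : R -> R) (r rho m : R).
Local Notation mu := (@lebesgue_measure R).
Local Notation g := (conj_arg dv).
Local Notation vs := (legendre v dv).
Local Notation kap := (rho - r).
Local Notation delta := (r / rho).

Context (vP : convex_cost v dv) (r_gt0 : 0 < r) (r_lt_rho : r < rho).
Context (y0 : R) (p y : R -> R).
Context (p_ge0 : forall t, 0 <= t -> 0 <= p t) (ode : solves_ode r y0 p y).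

Definition cost_flow (s : R) : R := rho * expR (- rho * s) * (m + v (p s)).
Definition total_cost (t : R) : R := \int[mu]_(s in `[0, t]) cost_flow s.
Local Notation k := cost_flow.
Local Notation K := total_cost.

Let rho_gt0 := rate_gt0 r_gt0 r_lt_rho.

(** Weak duality. The Fenchel-Young inequality at the price P e^{kap t} bounds the
    cost flow below by the payments, valued at this price, minus the conjugate; the
    valued payments add up to the decrease of the discounted promise, and X accounts
    for the conjugate. *)
Lemma dual_bound (X dX : R -> R) P s t T :
  mu.-integrable `[0, T] (EFin \o k) -> 0 <= s -> s <= t -> t <= T ->
  (forall x : R, s <= x <= t -> is_derive x (1 : R) X (dX x)) ->
  (forall x, s <= x <= t ->
     dX x <= rho * expR (- rho * x) * (m - vs (delta * (P * expR (kap * x))))) ->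
  X t - X s + P * (expR (- r * s) * y s - expR (- r * t) * y t) <= K t - K s.
Proof.
move=> ki s0 st tT dXP dXle; have t0 := le_trans s0 st.
pose b x := rho * expR (- rho * x) * (m - vs (delta * (P * expR (kap * x)))).
have cb : continuous b.
  move=> x; apply: cvgM.
    by apply: is_derive_continuous (is_derive_scale rho (is_derive_expM (- rho) x)).
  apply: cvgB; first exact: cvg_cst.
  apply: (@continuous_comp _ _ _ (fun x => delta * (P * expR (kap * x)) : R) vs x).
    apply: is_derive_continuous (is_derive_scale delta (is_derive_scale P (is_derive_expM kap x))).
  exact: (conj_continuous vP).
have [Y dY] := antiderivative cb.
have XY : X t - X s <= Y t - Y s.
  have : Y s - X s <= Y t - X t.
    apply: (@mvt_le _ (fun x => Y x - X x) (fun x => b x - dX x) _ _ st).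
      by move=> x xst; exact: is_deriveB (dY x) (dXP x xst).
    by move=> x xst; rewrite subr_ge0 dXle.
  by move: (X s) (X t) (Y s) (Y t) => *; lra.
pose h x := r * expR (- r * x) * p x.
have hi T' : mu.-integrable `[0, T'] (EFin \o h).
  apply: (@integrable_cmul _ (fun x => r * expR (- r * x))); last exact: payment_integrable ode T'.
  by move=> x; apply: is_derive_continuous (is_derive_scale r (is_derive_expM (- r) x)).
have mI : measurable (`]s, t]%classic : set (measurableTypeR R)) by exact: measurable_itv.
have i1 : mu.-integrable `]s, t] (EFin \o (fun x => P * h x)).
  by apply: integrable_mull => //; exact: integrable_increment (lexx _) (hi t).
have i2 : mu.-integrable `]s, t] (EFin \o b) by exact: continuous_integrable_oc.
have : \int[mu]_(x in `]s, t]) (P * h x + b x) <= K t - K s.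
  rewrite Rintegral_increment//; last exact: integrable_initial ki.
  apply: le_Rintegral_oc; first exact: integrable_add.
    exact: integrable_increment ki.
  move=> x /andP[sx _]; have x0 : 0 <= x by lra.
  rewrite /h /b /k -(discount_weight r_gt0 r_lt_rho).
  have := fenchel_young vP (delta * (P * expR (kap * x))) (p_ge0 x0).
  move=> /(ler_wpM2l (mulr_ge0 (ltW rho_gt0) (expR_ge0 (- rho * x)))).
  move: (vs _) (v _) => a c; move: (expR _) (expR _) delta => e1 e2 d; lra.
rewrite RintegralD// RintegralZl//; last exact: integrable_increment (lexx _) (hi t).
rewrite -Rintegral_increment//.
rewrite (Rintegral_oc_antiderivative cb (fun x _ => dY x) st).
rewrite (discounted_promise r_gt0 ode s0) (discounted_promise r_gt0 ode t0).
rewrite -/(h _); move: XY.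
move: (\int[mu]_(x in `[0, t]) h x) (\int[mu]_(x in `[0, s]) h x).
move: (X s) (X t) (Y s) (Y t) (K s) (K t) => *; lra.
Qed.

Lemma cost_lower s t T : mu.-integrable `[0, T] (EFin \o k) -> 0 <= s -> s <= t -> t <= T ->
  m * (expR (- rho * s) - expR (- rho * t)) <= K t - K s.
Proof.
move=> ki s0 st tT.
have dX (x : R) : s <= x <= t -> is_derive x (1 : R) (fun x => - m * expR (- rho * x))
    (- m * (- rho * expR (- rho * x))).
  by move=> _; exact: is_derive_scale (is_derive_expM (- rho) x).
(* at price 0, only the running cost m is counted *)
have := dual_bound (P := 0) ki s0 st tT dX.
rewrite mul0r addr0 => h; apply: le_trans (h _).
  by move: (expR _) (expR _) => *; lra.
move=> x _; rewrite mul0r mulr0 conj0// subr0.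
by move: (expR _) => *; lra.
Qed.

Lemma expR_rates (Q s t : R) :
  expR (- rho * t) * (Q * expR (kap * (t - s))) = Q * expR (- kap * s) * expR (- r * t).
Proof.
rewrite mulrCA -[RHS]mulrA -!expRD; congr (Q * expR _); ring.
Qed.

(** The dual bound with the price path that starts at the marginal cost of y s, and
    the discounted conjugate as potential: the Fenchel-Young inequality gives the cost
    of retiring at both ends, with equality at time s. It is the prices, not the
    promises, that must stay where the slack is nonnegative, which holds for a short
    time. *)
Lemma retire_supersolution yb s t T :
  (forall z, 0 <= z -> z <= yb -> 0 <= retire_slack v dv r rho m z) ->
  mu.-integrable `[0, T] (EFin \o k) -> 0 <= s -> s <= t -> t <= T -> 0 <= yb ->
  0 <= y s -> 0 <= y t -> dv (y s) * expR (kap * (t - s)) <= dv yb ->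
  expR (- rho * t) * - v (y t) - K t <= expR (- rho * s) * - v (y s) - K s.
Proof.
move=> slack0 ki s0 st tT yb0 ys0 yt0 hS.
have k0 : 0 < kap by rewrite subr_gt0.
set Q := dv (y s) in hS.
have Q0 : 0 < Q by exact: (marginal_gt0 vP).
pose P := Q * expR (- kap * s).
pose S (x : R) : R := P * expR (kap * x).
have SE (x : R) : S x = Q * expR (kap * (x - s)).
  by rewrite /S /P -mulrA -expRD; congr (_ * expR _); ring.
pose X (x : R) : R := expR (- rho * x) * vs (S x).
pose dX (x : R) : R := rho * expR (- rho * x) * ((1 - delta) * S x * g (S x) - vs (S x)).
have dXP (x : R) : s <= x <= t -> is_derive x (1 : R) X (dX x).
  move=> _; have dS : is_derive x (1 : R) S (kap * S x).
    apply: is_derive_eq (is_derive_scale P (is_derive_expM kap x)) _.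
    by rewrite /S mulrCA.
  have dV := is_derive1_comp (is_derive_conj vP (S x)) dS.
  apply: is_derive_eq (is_derive_mul (is_derive_expM (- rho) x) dV) _.
  rewrite /dX /=; move: (S x) (expR _) => a e; move: (g a) (vs a) => b c.
  by field; rewrite gt_eqF.
have := dual_bound (P := P) ki s0 st tT dXP.
have h : forall x, s <= x <= t ->
    dX x <= rho * expR (- rho * x) * (m - vs (delta * (P * expR (kap * x)))).
  move=> x /andP[sx xt]; rewrite -/(S x) /dX ler_wpM2l//.
    by rewrite mulr_ge0 ?expR_ge0// ltW.
  have S1 : Q <= S x.
    rewrite SE; apply: (ler_peMr (ltW Q0)).
    by rewrite -expR0 ler_expR mulr_ge0 ?(ltW k0)// subr_ge0.
  have S2 : S x <= dv yb.
    apply: le_trans hS; rewrite SE ler_pM2l// ler_expR ler_pM2l//; lra.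
  have S0 : dv 0 <= S x by apply: le_trans S1; exact: (marginal_le vP).
  have gS0 := conj_arg_ge0 vP (S x).
  have gS1 : g (S x) <= yb by rewrite -(conj_arg_marginal vP yb0) (conj_arg_le vP).
  have := slack0 _ gS0 gS1; rewrite /retire_slack (marginal_conj_arg vP)//.
  rewrite [vs (S x)]legendreE; move: (S x) => a; move: (g a) (vs _) => b c.
  by move: (v b) => d; lra.
move=> /(_ h) {h}.
have fy := fenchel_young vP (S t) yt0.
have Xs : X s = expR (- rho * s) * (Q * y s - v (y s)).
  by rewrite /X SE subrr mulr0 expR0 mulr1 /Q (conj_marginal vP ys0).
have es := expR_rates Q s s; have et := expR_rates Q s t.
rewrite subrr mulr0 expR0 mulr1 in es.
rewrite Xs /X; have := ler_wpM2l (expR_ge0 (- rho * t)) fy.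
have -> : P * (expR (- r * s) * y s - expR (- r * t) * y t) =
  (Q * expR (- kap * s) * expR (- r * s)) * y s - (Q * expR (- kap * s) * expR (- r * t)) * y t.
  by rewrite /P; ring.
rewrite -es -et -(SE t).
move: (S t) (K s) (K t) => a ks kt; move: (vs a) (v (y t)) (v (y s)) => b c d.
move: (expR _) (expR _) => e1 e2; lra.
Qed.

(** Costs accrue at least at the rate rho m. *)
Lemma constant_supersolution s t T : mu.-integrable `[0, T] (EFin \o k) ->
  0 <= s -> s <= t -> t <= T ->
  expR (- rho * t) * - m - K t <= expR (- rho * s) * - m - K s.
Proof.
move=> ki s0 st tT; have := cost_lower ki s0 st tT.
by move: (K s) (K t) (expR _) (expR _) => *; lra.
Qed.

Section NeverRetire.
Context (C q : R) (C_ge0 : 0 <= C) (q_ge0 : 0 <= q) (kapq : kap * q < rho)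
  (grow : forall s : R, 0 <= s -> vs s <= C * (1 + s `^ q)).
Local Notation B := (disc_conj v dv r rho).
Local Notation cont := (cont_value v dv r rho).

(** With the potential e^{-rho t} (B (S t) - m), where S is the price path, the
    hypothesis of the dual bound holds with equality. *)
Let dual_cont Q s t T : mu.-integrable `[0, T] (EFin \o k) ->
  0 <= s -> s <= t -> t <= T -> 0 < Q ->
  expR (- rho * t) * (B (Q * expR (kap * (t - s))) - Q * expR (kap * (t - s)) * y t - m) - K t
   <= expR (- rho * s) * (B Q - Q * y s - m) - K s.
Proof.
move=> ki s0 st tT Q0; have [tau tauE] := shadow_onto r_lt_rho Q0.
have QE t' : Q * expR (kap * (t' - s)) = shadow r rho (tau - s + t').
  by rewrite -tauE !shadowE -expRD; congr expR; ring.
pose P := Q * expR (- kap * s).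
have PE (x : R) : P * expR (kap * x) = shadow r rho (tau - s + x).
  by rewrite -QE /P -mulrA -expRD; congr (_ * expR _); ring.
pose X (x : R) : R := expR (- rho * x) * (B (shadow r rho (tau - s + x)) - m).
pose dX (x : R) : R := rho * expR (- rho * x) * (m - vs (delta * shadow r rho (tau - s + x))).
have dXP (x : R) : s <= x <= t -> is_derive x (1 : R) X (dX x).
  move=> _; have dB := is_derive_shiftl
    (is_derive_disc_conj vP r_gt0 r_lt_rho C_ge0 q_ge0 kapq grow (tau - s + x)).
  have h := is_deriveB dB (is_derive_cst m x 1).
  apply: is_derive_eq (is_derive_mul (is_derive_expM (- rho) x) h) _.
  have -> : ((fun s0 : R => (B \o shadow r rho) (tau - s + s0)) - cst m) x =
     B (shadow r rho (tau - s + x)) - m by [].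
  rewrite /dX; move: (B _) (vs _) (expR _) => *; lra.
have := dual_bound (P := P) ki s0 st tT dXP.
have h : forall x, s <= x <= t ->
    dX x <= rho * expR (- rho * x) * (m - vs (delta * (P * expR (kap * x)))).
  by move=> x _; rewrite PE.
move=> /(_ h) {h}; rewrite QE /X subrK tauE.
have es := expR_rates Q s s; have et := expR_rates Q s t.
rewrite subrr mulr0 expR0 mulr1 in es.
have -> : P * (expR (- r * s) * y s - expR (- r * t) * y t) =
  (Q * expR (- kap * s) * expR (- r * s)) * y s - (Q * expR (- kap * s) * expR (- r * t)) * y t.
  by rewrite /P; ring.
rewrite -es -et QE.
move: (shadow _ _ _) (K s) (K t) => a ks kt; move: (B a) (B Q) => b c.
move: (expR _) (expR _) => e1 e2; lra.
Qed.

(** Any initial price Q bounds the value at time t by dual_cont; the infimum over Q is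
    the value at time s. *)
Lemma cont_supersolution s t T : mu.-integrable `[0, T] (EFin \o k) ->
  0 <= s -> s <= t -> t <= T -> 0 <= y s -> 0 <= y t ->
  expR (- rho * t) * (cont (y t) - m) - K t <= expR (- rho * s) * (cont (y s) - m) - K s.
Proof.
move=> ki s0 st tT ys0 yt0.
have e0 := expR_gt0 (- rho * s).
suff h Q : 0 <= Q -> (expR (- rho * t) * (cont (y t) - m) - K t + K s) / expR (- rho * s) + m <= B Q - Q * y s.
  have : (expR (- rho * t) * (cont (y t) - m) - K t + K s) / expR (- rho * s) + m <= cont (y s).
    apply: lb_le_inf; first by exists (B 0 - 0 * y s), 0 => /=.
    by move=> _ [Q Q0 <-]; exact: h.
  rewrite -lerBrDr ler_pdivrMr//.
  by move: (cont _) (cont _) (K s) (K t) (expR _) (expR _) => *; lra.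
move=> Q0; rewrite -lerBrDr ler_pdivrMr//.
move: Q0; rewrite le_eqVlt => /predU1P[<-|Q0].
  have := cost_lower ki s0 st tT; rewrite disc_conj0// mul0r subr0.
  have := cont_le0 vP r_gt0 r_lt_rho C_ge0 q_ge0 kapq grow yt0.
  have := expR_ge0 (- rho * t).
  by move: (cont _) (K s) (K t) (expR _) (expR _) => *; nra.
have := dual_cont ki s0 st tT Q0.
have Q1 : 0 <= Q * expR (kap * (t - s)) by rewrite mulr_ge0 ?expR_ge0// ltW.
have := cont_le vP r_gt0 r_lt_rho C_ge0 q_ge0 kapq grow yt0 Q1.
move=> /(ler_wpM2l (expR_ge0 (- rho * t))).
move: (Q * expR _) (K s) (K t) (cont _) => a ks kt c; move: (B a) (B Q) => b d.
by move: (expR _) (expR _) => *; lra.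
Qed.

(** In dual_cont with s = 0, the terminal promise vanishes in the limit by the tail
    condition, and the terminal conjugate is nonnegative. *)
Lemma cont_bound_infinite a : (forall T, mu.-integrable `[0, T] (EFin \o k)) ->
  0 <= y0 -> (forall t, 0 <= t -> a <= - K t) ->
  expR (- r * t) * y t @[t --> +oo] --> (0 : R) -> a <= cont y0 - m.
Proof.
move=> ki y00 aK tail; rewrite lerBrDr.
apply: lb_le_inf; first by exists (B 0 - 0 * y0), 0 => /=.
move=> _ [Q Q0 <-]; have K0 : K 0 = 0 by rewrite /K set_itv1 Rintegral_set1.
have bound t : 0 <= t -> a <= B Q - Q * y0 - m + m * expR (- rho * t) + Q * (expR (- r * t) * y t).
  move=> t0; apply: le_trans (aK t t0) _.
  move: Q0; rewrite /= le_eqVlt => /predU1P[<-|Q0].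
    have := cost_lower (ki t) (lexx 0) t0 (lexx t); rewrite disc_conj0// !mul0r K0 mulr0 expR0.
    by move: (K t) (expR _) => *; lra.
  have := dual_cont (ki t) (lexx 0) t0 (lexx t) Q0.
  rewrite K0 (ode_init ode) mulr0 expR0 subr0.
  have e : expR (- rho * t) * (Q * expR (kap * t)) = Q * expR (- r * t).
    by have := expR_rates Q 0 t; rewrite subr0 mulr0 expR0 mulr1.
  have := mulr_ge0 (expR_ge0 (- rho * t)) (disc_conj_ge0 vP r_gt0 r_lt_rho (Q * expR (kap * t))).
  have -> : Q * (expR (- r * t) * y t) = expR (- rho * t) * (Q * expR (kap * t)) * y t.
    by rewrite e mulrA.
  move: (Q * expR _) => S; move: (B S) (B Q) (K t) (expR _) (y t) => *; lra.
rewrite -lerBrDr.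
have lim : B Q - Q * y0 - m + m * expR (- rho * t) + Q * (expR (- r * t) * y t) @[t --> +oo] -->
    B Q - Q * y0 - m + m * 0 + Q * 0.
  apply: cvgD; last by apply: cvgM => //; exact: cvg_cst.
  apply: cvgD; first exact: cvg_cst.
  by apply: cvgM; [exact: cvg_cst|exact: cvg_expRN].
rewrite !mulr0 !addr0 in lim.
apply: (cvgr_to_ge lim); near=> t; apply: bound; near: t.
by apply: nbhs_pinfty_ge; rewrite num_real.
Unshelve. all: by end_near. Qed.

End NeverRetire.

Section Stopping.
Context (W : R -> R) (yt yb T : R).
Context (yt_gt0 : 0 < yt) (yt_yb : yt < yb) (T_ge0 : 0 <= T).
Context (slack0 : forall z, 0 <= z -> z <= yb -> 0 <= retire_slack v dv r rho m z).
Context (Whi : forall z, yt <= z -> - v z <= W z).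
Context (Wlo : forall z, 0 <= z -> z <= yt -> W z <= - v z).
Context (ki : mu.-integrable `[0, T] (EFin \o k)).
Context (yT : forall s, 0 <= s -> s <= T -> 0 <= y s).
Let X (phi : R -> R) (t : R) := expR (- rho * t) * phi (y t) - K t.
Context (superW : forall s t, 0 <= s -> s <= t -> t <= T -> X W t <= X W s).

Definition stop_value (z : R) : R := if z <= yt then - v z else W z.

(** The time that the price takes to grow from the marginal cost of yt to that of yb. *)
Let step_time := ln (dv yb / dv yt) / kap.

Let step_time_gt0 : 0 < step_time.
Proof.
have a := marginal_gt0 vP (ltW yt_gt0).
rewrite divr_gt0 ?subr_gt0// ln_gt0// ltr_pdivlMr// mul1r.
exact: (marginal_lt vP (ltW yt_gt0) yt_yb).
Qed.

Let retire_step s t : 0 <= s -> s <= t -> t <= T -> t - s <= step_time -> y s <= yt ->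
  X (fun z => - v z) t <= X (fun z => - v z) s.
Proof.
move=> s0 st tT ts ys; have k0 : 0 < kap by rewrite subr_gt0.
have a := marginal_gt0 vP (ltW yt_gt0).
have yb0 : 0 <= yb by exact: ltW (lt_trans yt_gt0 yt_yb).
have b := marginal_gt0 vP yb0.
have sT := le_trans st tT; have t0 := le_trans s0 st.
apply: (retire_supersolution slack0 ki) => //; [exact: yT|exact: yT|].
apply: le_trans (_ : dv yt * expR (ln (dv yb / dv yt)) <= _); last first.
  by rewrite lnK ?posrE ?divr_gt0// mulrC divfK// gt_eqF.
apply: ler_pM; rewrite ?expR_ge0//.
- exact: ltW (marginal_gt0 vP (yT s0 sT)).
- exact: (marginal_le vP (yT s0 sT) ys).
- by rewrite ler_expR mulrC -ler_pdivlMr.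
Qed.

(** If the path ends above yt, W is a supersolution all the way. If it starts above
    and ends below, W is used until a time when the promise equals yt, and the value
    of retiring from then on. If it starts and ends below, that value is used
    throughout. *)
Let value_step s t : 0 <= s -> s <= t -> t <= T -> t - s <= step_time ->
  X stop_value t <= X stop_value s.
Proof.
move=> s0 st tT ts; have sT := le_trans st tT; have t0 := le_trans s0 st.
have Xle phi psi x : phi (y x) <= psi (y x) -> X phi x <= X psi x.
  by move=> h; rewrite lerB// ler_wpM2l ?expR_ge0.
have WV x : 0 <= x -> x <= T -> X W x <= X stop_value x.
  move=> x0 xT; apply: Xle; rewrite /stop_value; case: ifPn => // yx.
  by apply: Wlo => //; exact: yT.
have [ytt|ytt] := leP yt (y t).
  apply: le_trans (WV s s0 sT); apply: le_trans (superW s0 st tT).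
  by apply: Xle; rewrite /stop_value; case: ifPn => // _; exact: Whi.
have VF x : y x <= yt -> X stop_value x = X (fun z => - v z) x.
  by move=> h; rewrite /X /stop_value h.
rewrite (VF t (ltW ytt)).
have [ys|ys] := leP (y s) yt; first by rewrite (VF s ys); exact: retire_step.
have cy : {within `[s, t], continuous y}.
  apply: (continuous_subspaceW _ (ode_continuous ode T_ge0)).
  by apply: subset_itv; rewrite bnd_simp.
have [|z zst zE] := IVT st cy (v := yt).
  by rewrite ge_min le_max (ltW ytt) (ltW ys) orbT.
move: zst; rewrite in_itv/= => /andP[sz zt].
have z0 := le_trans s0 sz.
apply: le_trans (retire_step z0 zt tT _ _) _; first by lra.
  by rewrite zE.
apply: le_trans (_ : X W z <= _); first by apply: Xle; apply: Whi; rewrite zE.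
apply: le_trans (WV s s0 sT); apply: superW => //.
exact: le_trans zt tT.
Qed.

Lemma verification : expR (- rho * T) * - v (y T) - K T <= stop_value y0.
Proof.
have X0 : X stop_value 0 = stop_value y0.
  by rewrite /X /K set_itv1 Rintegral_set1 mulr0 expR0 mul1r subr0 (ode_init ode).
have XT : expR (- rho * T) * - v (y T) - K T <= X stop_value T.
  rewrite lerB// ler_wpM2l ?expR_ge0// /stop_value.
  by case: (leP (y T) yt) => // /ltW h; exact: Whi.
apply: le_trans XT _; rewrite -X0.
pose n := (Num.truncn (T / step_time)).+1.
have nT : T / n%:R <= step_time.
  rewrite ler_pdivrMr ?ltr0n// mulrC -ler_pdivrMr ?step_time_gt0//.
  exact/ltW/truncnS_gt.
pose t j : R := j%:R * (T / n%:R).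
have t0 j : 0 <= t j by rewrite mulr_ge0// divr_ge0.
have tS j : t j.+1 - t j = T / n%:R by rewrite /t -mulrBl -natrB// subSnn mul1r.
have tT j : (j <= n)%N -> t j <= T.
  move=> jn; rewrite /t mulrA ler_pdivrMr ?ltr0n// [leRHS]mulrC ler_wpM2r// ler_nat//.
have part j : (j <= n)%N -> X stop_value (t j) <= X stop_value 0.
  elim: j => [_|j IH jn]; first by rewrite /t mul0r.
  apply: le_trans (IH (ltnW jn)); apply: value_step => //; last by rewrite tS.
    by rewrite -subr_ge0 tS divr_ge0.
  exact: tT.
by have := part n (leqnn _); rewrite /t mulrCA divff ?mulr1// pnatr_eq0.
Qed.

End Stopping.

End Verification.

(** * Bounds on the payoff, and strategies that attain them *)

Section Payoff.
Context {R : realType} (u dv : R -> R) (r rho m : R).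
Local Notation mu := (@lebesgue_measure R).
Local Notation v := (pinv (@Rplus R) u).
Context (vP : convex_cost v dv) (r_gt0 : 0 < r) (r_lt_rho : r < rho) (m_ge0 : 0 <= m).

Let rho_gt0 := rate_gt0 r_gt0 r_lt_rho.

Section Path.
Context (y0 : R) (p y : R -> R) (bp : borel_Rplus p).
Local Notation k := (cost_flow v rho m p).
Local Notation K := (total_cost v rho m p).

Let p_ge0 := bp.2.

Lemma cost_flow_ge0 t : 0 <= t -> 0 <= k t.
Proof.
move=> t0; apply: mulr_ge0; first by rewrite mulr_ge0 ?expR_ge0 ?ltW.
by rewrite addr_ge0// (cost_ge0 vP) ?p_ge0.
Qed.

Lemma cost_flow_measurable (D : set R) : measurable D -> D `<=` Rplus -> measurable_fun D k.
Proof.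
move=> mD DR; apply: measurable_funM.
  apply: measurable_funTS; apply: continuous_measurable_fun.
  by move=> x; apply: is_derive_continuous (is_derive_scale rho (is_derive_expM (- rho) x)).
apply: measurable_funD; first exact: measurable_cst.
have mp : measurable_fun D p by apply: measurable_funS DR bp.1 => //; exact: measurable_itv.
have := measurableT_comp (continuous_measurable_fun (cost_continuous vP)) mp.
apply: eq_measurable_fun => t; rewrite inE => /DR.
rewrite /Rplus/= in_itv/= andbT => t0; rewrite (max_idPr _)//.
exact: p_ge0.
Qed.

Lemma payoff_integral (D : set R) : measurable D -> D `<=` Rplus ->
  (\int[mu]_(t in D) (rho * expR (- rho * t) * (- m + F u (p t)))%:E
   = - \int[mu]_(t in D) (k t)%:E)%E.
Proof.
move=> mD DR; rewrite -integral_ge0N; last first.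
  by move=> t /DR; rewrite /Rplus/= in_itv/= andbT => t0; rewrite lee_fin cost_flow_ge0.
apply: eq_integral => t _; rewrite -EFinN; congr EFin; rewrite /cost_flow /F.
by move: (pinv _ _ _) => w; ring.
Qed.

Lemma cost_integrable (D : set R) : measurable D -> D `<=` Rplus ->
  (\int[mu]_(t in D) (k t)%:E < +oo)%E -> mu.-integrable D (EFin \o k).
Proof.
move=> mD DR h; apply/integrableP; split.
  by apply/measurable_EFinP; exact: cost_flow_measurable.
apply: le_lt_trans h; rewrite le_eqVlt; apply/orP; left; apply/eqP.
apply: eq_integral => t; rewrite inE => /DR; rewrite /Rplus/= in_itv/= andbT => t0.
by rewrite ger0_norm// cost_flow_ge0.
Qed.

Lemma itv_Rplus (b : itv_bound R) : [set` Interval (BLeft 0) b] `<=` (@Rplus R).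
Proof. by move=> t; rewrite /Rplus/= !in_itv/= => /andP[->]. Qed.

Lemma time_set_fin (t : R) : [set s : R | 0 <= s /\ (s%:E <= t%:E)%E] = `[0, t]%classic.
Proof.
apply/seteqP; split => s /=; rewrite in_itv/= lee_fin; first by case=> -> ->.
by move=> /andP[].
Qed.

Lemma time_set_infty : [set s : R | 0 <= s /\ (s%:E <= +oo)%E] = `[0, +oo[%classic.
Proof.
apply/seteqP; split => s /=; rewrite in_itv/= leey andbT; first by case.
by move=> ->.
Qed.

Context (ode : solves_ode r y0 p y) (y0_ge0 : 0 <= y0).

Lemma promise_ge0_before (t : R) : (t%:E <= T_0 y)%E -> 0 <= t ->
  forall s, 0 <= s -> s <= t -> 0 <= y s.
Proof.
move=> tT0 t0.
have pos s : 0 <= s -> s < t -> 0 < y s.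
  move=> s0 st; rewrite ltNge; apply/negP => ys.
  have : (T_0 y <= s%:E)%E by apply: ereal_inf_lbound; exists s.
  by move=> /(le_trans tT0); rewrite lee_fin leNgt st.
move=> s s0; rewrite le_eqVlt => /predU1P[->|st]; last exact: ltW (pos _ s0 st).
rewrite leNgt; apply/negP => yt.
have [t0'|t0'] := leP t 0.
  have e : t = 0 by apply/eqP; rewrite eq_le t0' t0.
  by move: yt; rewrite e (ode_init ode) ltNge y0_ge0.
have [|z zt zE] := IVT t0 (ode_continuous ode t0) (v := y t / 2).
  have y00 : 0 < y 0 by exact: pos.
  by rewrite ge_min le_max; apply/andP; split; apply/orP; [right|left]; lra.
move: zt; rewrite in_itv/= => /andP[z0]; rewrite le_eqVlt => /predU1P[zt|zt].
  by move: zE; rewrite zt; lra.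
by have := pos z z0 zt; rewrite zE; lra.
Qed.

(** Paths of infinite cost have payoff -oo; otherwise the verification argument covers
    finite retirement times, and the hypothesis on the total costs the infinite one. *)
Lemma payoff_le (W : R -> R) (yt yb : R) (T : \bar R) :
  0 < yt -> yt < yb ->
  (forall z, 0 <= z -> z <= yb -> 0 <= retire_slack v dv r rho m z) ->
  (forall z, yt <= z -> - v z <= W z) ->
  (forall z, 0 <= z -> z <= yt -> W z <= - v z) ->
  (forall T, mu.-integrable `[0, T] (EFin \o k) ->
    (forall s, 0 <= s -> s <= T -> 0 <= y s) ->
    forall s t, 0 <= s -> s <= t -> t <= T ->
    expR (- rho * t) * W (y t) - K t <= expR (- rho * s) * W (y s) - K s) ->
  ((forall T, mu.-integrable `[0, T] (EFin \o k)) ->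
    expR (- r * t) * y t @[t --> +oo] --> (0 : R) ->
    forall a, (forall t, 0 <= t -> a <= - K t) -> a <= W y0) ->
  admissible_time r y T ->
  (payoff u rho m p y T <= (stop_value v W yt y0)%:E)%E.
Proof.
move=> yt0 ytb slack0 Whi Wlo superW infW [T0 TT0 tail].
case: T T0 TT0 tail => [t| |//] T0 TT0 tail; rewrite /payoff.
  rewrite lee_fin in T0.
  rewrite time_set_fin (payoff_integral (measurable_itv _) (@itv_Rplus _)).
  have [ki|] := ltP (\int[mu]_(s in `[0%R, t]) (k s)%:E)%E +oo%E; last first.
    by rewrite leye_eq => /eqP ->; exact: leNye.
  have {}ki := cost_integrable (measurable_itv _) (@itv_Rplus _) ki.
  have yT := promise_ge0_before TT0 T0.
  have := verification vP r_gt0 r_lt_rho p_ge0 ode yt0 ytb T0 slack0 Whi Wlo ki yT (superW t ki yT).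
  rewrite -lee_fin; apply: le_trans; rewrite EFinB leeD2l// /total_cost /Rintegral fineK//.
  exact: integrable_fin_num.
rewrite time_set_infty (payoff_integral (measurable_itv _) (@itv_Rplus _)) add0e.
have [ki|] := ltP (\int[mu]_(s in `[0%R, +oo[) (k s)%:E)%E +oo%E; last first.
  by rewrite leye_eq => /eqP ->; exact: leNye.
have {}ki := cost_integrable (measurable_itv _) (@itv_Rplus _) ki.
have kT T : mu.-integrable `[0, T] (EFin \o k).
  by apply: integrableS ki => //; apply: subset_itvl.
have fin : (\int[mu]_(t in `[0%R, +oo[) (k t)%:E)%E \is a fin_num.
  exact: integrable_fin_num.
rewrite -(fineK fin) -EFinN lee_fin.
have h : - fine (\int[mu]_(s in `[0%R, +oo[) (k s)%:E)%E <= W y0.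
  apply: (infW kT (tail erefl)) => t t0; rewrite lerN2 /total_cost /Rintegral.
  rewrite fine_le//; first exact: integrable_fin_num.
  apply: ge0_subset_integral => //.
  - exact: measurable_int ki.
  - by move=> s; rewrite /= in_itv/= andbT => s0; rewrite lee_fin cost_flow_ge0.
  - exact: subset_itvl.
apply: (le_trans h); rewrite /stop_value; case: ifPn => // y0t.
exact: Wlo.
Qed.

End Path.

Section Strategies.

Lemma smooth_solves_ode (p y : R -> R) : continuous p ->
  (forall t : R, is_derive t (1 : R) y (r * (y t - p t))) -> solves_ode r (y 0) p y.
Proof.
move=> cp dy t t0.
have cy : continuous y by move=> x; apply: is_derive_continuous (dy x).
have cf : continuous (fun s : R => r * (y s - p s) : R).
  by move=> x; apply: cvgM; [exact: cvg_cst|apply: cvgB; [exact: cy|exact: cp]].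
split; first exact: continuous_integrable_itv.
by rewrite (Rintegral_antiderivative cf (fun s _ => dy s) t0) subrKC.
Qed.

Lemma borel_of_continuous (p : R -> R) : continuous p ->
  (forall t, 0 <= t -> 0 <= p t) -> borel_Rplus p.
Proof.
by move=> cp p0; split=> //; apply: measurable_funTS; exact: continuous_measurable_fun.
Qed.

Lemma Fbar_ge (p y : R -> R) (T : \bar R) : continuous p ->
  (forall t, 0 <= t -> 0 <= p t) ->
  (forall t : R, is_derive t (1 : R) y (r * (y t - p t))) ->
  admissible_time r y T -> (payoff u rho m p y T <= Fbar u r rho m (y 0%R))%E.
Proof.
move=> cp p0 dy aT; apply: ereal_sup_ubound; exists p, y, T; split=> //.
- exact: borel_of_continuous.
- exact: smooth_solves_ode.
Qed.

Lemma T_0_ge0 (y : R -> R) : (0 <= T_0 y)%E.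
Proof. by apply: le_ereal_inf_tmp => _ [t [t0 _] <-]; rewrite lee_fin. Qed.

(** The constant path, stopped at once. *)
Lemma Fbar_ge_retire y0 : 0 <= y0 -> ((F u y0)%:E <= Fbar u r rho m y0)%E.
Proof.
move=> y00; have c0 : continuous (cst y0 : R -> R) by move=> x; exact: cvg_cst.
have d0 (t : R) : is_derive t (1 : R) (cst y0 : R -> R) (r * (cst y0 t - cst y0 t)).
  by apply: is_derive_eq; rewrite subrr mulr0.
have a0 : admissible_time r (cst y0) 0%:E.
  by split=> //; exact: T_0_ge0.
apply: le_trans (Fbar_ge c0 (fun _ _ => y00) d0 a0).
rewrite /payoff (time_set_fin 0) set_itv1 integral_set1 addr0 mulr0 expR0 mul1r.
exact: lexx.
Qed.

(** Payments that grow at the rate r serve the promise in the time y0 / (k r). As gam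
    * r <= rho, discounting makes up for the growth of their cost, which disappears as
    k tends to 0. *)
Lemma Fbar_ge_spread (y0 a gam k : R) : 0 < y0 -> 0 <= a -> gam * r <= rho ->
  (forall x, 0 <= x -> v x <= a * (x + x `^ gam)) -> 0 < k ->
  ((- m - (a * rho / (rho - r) * k + a * rho * y0 / r * (k `^ gam / k)))%:E
    <= Fbar u r rho m y0)%E.
Proof.
move=> y00 a0 hg vg k0.
pose p t : R := k * expR (r * t).
pose y t : R := (y0 - k * r * t) * expR (r * t).
pose N := y0 / (k * r).
have kr0 : 0 < k * r by rewrite mulr_gt0.
have N0 : 0 < N by rewrite divr_gt0.
have cp : continuous p.
  by move=> t; apply: is_derive_continuous (is_derive_scale k (is_derive_expM r t)).
have p0 t : 0 <= t -> 0 <= p t by move=> _; rewrite mulr_ge0 ?expR_ge0 ?ltW.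
have dy (t : R) : is_derive t (1 : R) y (r * (y t - p t)).
  have h := is_deriveB (is_derive_cst y0 t 1) (is_derive_scale (k * r) (is_derive_id t 1)).
  apply: is_derive_eq (is_derive_mul h (is_derive_expM r t)) _.
  have -> : (cst y0 - (fun s : R => k * r * s)) t = y0 - k * r * t by [].
  by rewrite /y /p; ring.
have krN : k * r * N = y0 by rewrite mulrC divfK// gt_eqF.
have yN : y N = 0 by rewrite /y krN subrr mul0r.
have ypos t : t < N -> 0 < y t.
  move=> tN; rewrite mulr_gt0 ?expR_gt0// subr_gt0.
  by move: tN; rewrite /N ltr_pdivlMr// mulrC.
have aN : admissible_time r y N%:E.
  split=> //; first by rewrite lee_fin ltW.
  apply: le_ereal_inf_tmp => _ [t [t0 yt] <-]; rewrite lee_fin leNgt.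
  by apply/negP => /ypos; rewrite ltNge yt.
have y0E : y 0 = y0 by rewrite /y !mulr0 expR0 subr0 mulr1.
have := Fbar_ge cp p0 dy aN; rewrite y0E; apply: le_trans.
have bp := borel_of_continuous cp p0.
rewrite /payoff time_set_fin (payoff_integral bp (measurable_itv _) (@itv_Rplus _)).
rewrite yN /F (cost0 vP) oppr0 mulr0 add0e.
pose k' t := cost_flow v rho m p t.
pose b (t : R) : R := m * (rho * expR (- rho * t)) +
   (a * k * rho * expR (- (rho - r) * t) + a * rho * k `^ gam).
have cb : continuous b.
  move=> t; apply: cvgD.
    apply: is_derive_continuous (is_derive_scale m (is_derive_scale rho (is_derive_expM (- rho) t))).
  apply: cvgD; last exact: cvg_cst.
  by apply: is_derive_continuous (is_derive_scale (a * k * rho) (is_derive_expM (- (rho - r)) t)).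
have kb t : 0 <= t -> k' t <= b t.
  move=> t0; have := vg _ (p0 t t0).
  have -> : p t `^ gam = k `^ gam * expR (r * t * gam).
    by rewrite /p powRM ?expR_ge0 ?(ltW k0)// -expRM.
  have w0 : 0 <= rho * expR (- rho * t) by rewrite mulr_ge0 ?expR_ge0// ltW.
  move=> /(ler_wpM2l w0); rewrite /k' /cost_flow /b {2}/p.
  have e1 : expR (- rho * t) * expR (r * t) = expR (- (rho - r) * t).
    by rewrite -expRD; congr expR; ring.
  have e2 : expR (- rho * t) * expR (r * t * gam) <= 1.
    rewrite -expRD expR_le1; have := ler_wpM2r t0 hg; lra.
  have c0 : 0 <= a * rho * k `^ gam by rewrite !mulr_ge0 ?powR_ge0// ltW.
  have := ler_wpM2l c0 e2; rewrite -e1; move: (v _) => w.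
  by move: (expR _) (expR _) (expR _) (k `^ gam) => E1 E2 E3 E4; lra.
pose Y (t : R) : R := - m * expR (- rho * t) +
   (- (a * k * rho / (rho - r)) * expR (- (rho - r) * t) + a * rho * k `^ gam * t).
have dY (t : R) : is_derive t (1 : R) Y (b t).
  have h1 := is_derive_scale (- m) (is_derive_expM (- rho) t).
  have h2 := is_derive_scale (- (a * k * rho / (rho - r))) (is_derive_expM (- (rho - r)) t).
  have h3 := is_derive_scale (a * rho * k `^ gam) (is_derive_id t 1).
  apply: is_derive_eq (is_deriveD h1 (is_deriveD h2 h3)) _.
  rewrite /b; move: (expR _) (expR _) (k `^ gam) => e1 e2 e3.
  by field; rewrite gt_eqF// subr_gt0.
have ib := continuous_integrable_itv 0 N cb.
have eb := Rintegral_antiderivative cb (fun t _ => dY t) (ltW N0).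
have : (\int[mu]_(t in `[0%R, N]) (k' t)%:E <= \int[mu]_(t in `[0%R, N]) (b t)%:E)%E.
  apply: ge0_le_integral => //.
  - by move=> t; rewrite /= in_itv/= => /andP[t0 _]; rewrite lee_fin (cost_flow_ge0 bp).
  - by apply/measurable_EFinP; apply: (cost_flow_measurable bp) => //; exact: itv_Rplus.
  - by apply/measurable_EFinP; apply: measurable_funTS; exact: continuous_measurable_fun.
  - by move=> t; rewrite /= in_itv/= => /andP[t0 _]; rewrite lee_fin kb.
have fb : (\int[mu]_(t in `[0%R, N]) (b t)%:E = (Y N - Y 0%R)%:E)%E.
  by rewrite -eb /Rintegral fineK//; exact: integrable_fin_num.
rewrite fb => h; rewrite leeNr; apply: le_trans h _; rewrite -EFinN lee_fin.
have NE : N = y0 / r / k by rewrite /N; field; rewrite !gt_eqF.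
rewrite /Y !mulr0 expR0 NE.
have f1 := expR_ge0 (- rho * (y0 / r / k)).
have c1 : 0 <= a * k * rho / (rho - r).
  by rewrite divr_ge0 ?subr_ge0 ?(ltW r_lt_rho)// !mulr_ge0// ltW.
have f2 := mulr_ge0 c1 (expR_ge0 (- (rho - r) * (y0 / r / k))).
have f3 := mulr_ge0 m_ge0 f1.
have -> : a * rho * y0 / r * (k `^ gam / k) = a * rho * k `^ gam * (y0 / r / k).
  by move: (k `^ gam) => x; field; rewrite !gt_eqF.
have -> : a * rho / (rho - r) * k = a * k * rho / (rho - r) by ring.
move: f2 f3 f1; move: (a * k * rho / _) (a * rho * _ * _) (expR _) (expR _) => *; lra.
Qed.

Lemma Fbar_ge_abandon (y0 a gam : R) : 0 < y0 -> 0 <= a -> 1 < gam -> gam * r <= rho ->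
  (forall x, 0 <= x -> v x <= a * (x + x `^ gam)) ->
  ((- m)%:E <= Fbar u r rho m y0)%E.
Proof.
move=> y00 a0 g1 hg vg; apply/lee_addgt0Pr => e e0.
have k0 : 0 < rho - r by rewrite subr_gt0.
have g10 : 0 < gam - 1 by lra.
pose c1 := a * rho / (rho - r) + 1; pose c2 := a * rho * y0 / r + 1.
have c10 : 0 < c1.
  by apply: ltr_wpDl => //; rewrite divr_ge0 ?(ltW k0)// mulr_ge0// ltW.
have c20 : 0 < c2.
  by apply: ltr_wpDl => //; rewrite divr_ge0 ?(ltW r_gt0)// mulr_ge0 ?(ltW y00)// mulr_ge0// ltW.
have e20 : 0 < e / 2 by lra.
pose k := Num.min (e / 2 / c1) ((e / 2 / c2) `^ (gam - 1)^-1).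
have kgt0 : 0 < k by rewrite lt_min powR_gt0 !divr_gt0.
have h1 : c1 * k <= e / 2.
  by rewrite mulrC -ler_pdivlMr// ge_min lexx.
have h2 : c2 * (k `^ gam / k) <= e / 2.
  rewrite mulrC -ler_pdivlMr//.
  have powE (x : R) : 0 < x -> x `^ gam / x = x `^ (gam - 1).
    move=> x0; rewrite -(mulr_powRB1 (ltW x0) (lt_trans ltr01 g1)).
    by rewrite mulrAC divff ?mul1r// gt_eqF.
  rewrite (powE _ kgt0).
  have -> : e / 2 / c2 = ((e / 2 / c2) `^ (gam - 1)^-1) `^ (gam - 1).
    by rewrite -powRrM mulVf ?gt_eqF// powRr1// ltW// divr_gt0.
  apply: ge0_ler_powR; rewrite ?nnegrE ?powR_ge0 ?(ltW kgt0) ?(ltW g10)//.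
  by rewrite ge_min lexx orbT.
have := Fbar_ge_spread y00 a0 hg vg kgt0.
move=> /(leeD2r e%:E); apply: le_trans; rewrite -EFinD lee_fin.
have p1 : 0 <= k `^ gam / k by rewrite divr_ge0 ?powR_ge0 ?ltW.
move: h1 h2; rewrite /c1 /c2; move: (k `^ gam / k) p1 => x x0.
move: (a * rho / (rho - r)) (a * rho * y0 / r) => A1 A2; lra.
Qed.

Section NeverRetireStrategy.
Context (C q : R) (C_ge0 : 0 <= C) (q_ge0 : 0 <= q) (kapq : (rho - r) * q < rho)
  (grow : forall s : R, 0 <= s -> legendre v dv s <= C * (1 + s `^ q)).

(** The payments that are optimal for the price path starting at price y0 turn the
    Fenchel-Young inequality into an equality at all times. *)
Lemma Fbar_ge_never y0 : 0 < y0 -> ((cont_value v dv r rho y0 - m)%:E <= Fbar u r rho m y0)%E.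
Proof.
move=> y00.
pose tau := ptime dv r rho y0.
pose p t : R := conj_arg dv (r / rho * shadow r rho (tau + t)).
pose y t : R := disc_arg dv r rho (shadow r rho (tau + t)).
pose P := price dv r rho y0.
have P0 : 0 < P by exact: price_gt0.
have PE (t : R) : shadow r rho (tau + t) = expR ((rho - r) * t) * P.
  by rewrite shadowD mulrC -shadowE.
have cp : continuous p.
  move=> t; apply: (@continuous_comp _ _ _ (fun t => r / rho * shadow r rho (tau + t)) (conj_arg dv) t).
    by apply: is_derive_continuous (is_derive_scale _ (is_derive_shiftl (is_derive_shadow r rho (tau + t)))).
  exact: (conj_arg_continuous vP).
have p0 t : 0 <= t -> 0 <= p t by move=> _; exact: (conj_arg_ge0 vP).
have dy (t : R) : is_derive t (1 : R) y (r * (y t - p t)).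
  exact: is_derive_shiftl (is_derive_disc_arg vP r_gt0 r_lt_rho C_ge0 q_ge0 kapq grow (tau + t)).
have yE : y 0 = y0.
  by rewrite /y addr0 (disc_arg_price vP r_gt0 r_lt_rho C_ge0 q_ge0 kapq grow y00).
have ypos t : 0 < y t.
  by apply: (disc_arg_gt0 vP r_gt0 r_lt_rho C_ge0 q_ge0 kapq grow); exact: shadow_gt0.
have aN : admissible_time r y +oo%E.
  split=> //; last by move=> _; exact: (disc_arg_tail vP r_gt0 r_lt_rho C_ge0 q_ge0 kapq grow).
  apply: le_ereal_inf_tmp => _ [t [_ yt] <-].
  by move: (ypos t); rewrite ltNge yt.
have := Fbar_ge cp p0 dy aN; rewrite yE; apply: le_trans.
have bp := borel_of_continuous cp p0.
rewrite /payoff time_set_infty (payoff_integral bp (measurable_itv _) (@itv_Rplus _)) add0e.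
have mI : measurable (`[0, +oo[%classic : set (measurableTypeR R)) by exact: measurable_itv.
have ce : continuous (fun t : R => rho * expR (- rho * t) : R).
  by move=> t; apply: is_derive_continuous (is_derive_scale rho (is_derive_expM (- rho) t)).
have [|t| |ie ee] := @half_line_antiderivative R _ (fun t => - expR (- rho * t)) 0 (- 0) ce.
- by move=> t _; rewrite mulr_ge0 ?expR_ge0// ltW.
- by move=> _; apply: is_derive_eq (is_deriveN (is_derive_expM (- rho) t)) _; rewrite mulNr opprK.
- by apply: cvgN; exact: cvg_expRN.
have ib := disc_conj_integrable vP r_gt0 r_lt_rho C_ge0 q_ge0 kapq grow (ltW P0).
have ia := disc_arg_integrable vP r_gt0 r_lt_rho C_ge0 q_ge0 kapq grow P0.
have kE t : cost_flow v rho m p t = m * (rho * expR (- rho * t))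
   + P * (r * expR (- r * t) * conj_arg dv (r / rho * expR ((rho - r) * t) * P))
   - rho * expR (- rho * t) * legendre v dv (r / rho * expR ((rho - r) * t) * P).
  rewrite /cost_flow /p PE mulrA -(discount_weight r_gt0 r_lt_rho) legendreE.
  by move: (conj_arg dv _) => x; move: (pinv _ _ x) (expR _) (expR _) => *; ring.
have i1 := integrable_mull mI m ie.
have i2 := integrable_mull mI P ia.
have i12 := integrable_add mI i1 i2.
have ki : mu.-integrable `[0, +oo[ (EFin \o cost_flow v rho m p).
  apply: eq_integrable (integrable_sub mI i12 ib) => // t _.
  by rewrite /= kE.
have fin : (\int[mu]_(t in `[0%R, +oo[) (cost_flow v rho m p t)%:E)%E \is a fin_num.
  exact: integrable_fin_num.
rewrite -(fineK fin) -EFinN lee_fin.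
have -> : fine (\int[mu]_(t in `[0%R, +oo[) (cost_flow v rho m p t)%:E)%E =
    \int[mu]_(t in `[0, +oo[) cost_flow v rho m p t by [].
under eq_Rintegral do rewrite kE.
have e1 : \int[mu]_(t in `[0, +oo[) (m * (rho * expR (- rho * t)))
    = m * \int[mu]_(t in `[0, +oo[) (rho * expR (- rho * t)) by rewrite RintegralZl.
have e2 : \int[mu]_(t in `[0, +oo[) (P * (r * expR (- r * t) *
      conj_arg dv (r / rho * expR ((rho - r) * t) * P))) = P * disc_arg dv r rho P.
  by rewrite disc_argE RintegralZl.
rewrite RintegralB// RintegralD// e1 e2 ee -disc_conjE.
rewrite (contE vP r_gt0 r_lt_rho C_ge0 q_ge0 kapq grow y00).
rewrite (disc_arg_price vP r_gt0 r_lt_rho C_ge0 q_ge0 kapq grow y00) mulr0 expR0.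
by rewrite -/P; move: (disc_conj _ _ _ _ P) => b; lra.
Qed.

End NeverRetireStrategy.

End Strategies.

End Payoff.

(** * Derivatives relative to the half-line *)

Section HalfLineDerivative.
Context {R : realType}.
Implicit Types (f df : R -> R) (x l : R).

Definition has_derR f x l :=
  quotient_at f x z @[z --> within (@Rplus R) x^'] --> l.

Lemma RplusE x : Rplus x = (0 <= x).
Proof. by rewrite /Rplus/= in_itv/= andbT. Qed.

Lemma at_right_Rplus x : 0 <= x -> x^'+ `=>` within (@Rplus R) x^'.
Proof.
move=> x0 P [e e0 h]; exists e => // z ze xz; apply: h => //.
  by rewrite gt_eqF.
by rewrite RplusE ltW// (le_lt_trans x0).
Qed.

Lemma at_left_Rplus x : 0 < x -> x^'- `=>` within (@Rplus R) x^'.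
Proof.
move=> x0 P [e e0 h]; exists (Num.min e x); first by rewrite /= lt_min e0.
move=> z; rewrite /= lt_min => /andP[ze zx] xz; apply: h => //.
  by rewrite lt_eqF.
by rewrite RplusE; move: zx; rewrite ltr_norml => /andP[_]; lra.
Qed.

Lemma within_Rplus_proper x : 0 <= x -> ProperFilter (within (@Rplus R) x^').
Proof.
by move=> x0; apply: Build_ProperFilter => /(at_right_Rplus x0)/filter_ex[].
Qed.

Lemma near_dRplus x (P : set R) : (\forall z \near x, z != x -> 0 <= z -> P z) <->
  (\forall z \near within (@Rplus R) x^', P z).
Proof.
split=> h.
  change (nbhs x (fun z => z != x -> Rplus z -> P z)).
  by move: h; apply: filterS => z h zx zR; apply: h => //; rewrite -RplusE.
have {}h : nbhs x (fun z => z != x -> Rplus z -> P z) := h.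
by move: h; apply: filterS => z h zx z0; apply: h => //; rewrite RplusE.
Qed.

Lemma near_Rplus x (P : set R) : (\forall z \near x, 0 <= z -> P z) <->
  (\forall z \near within (@Rplus R) (nbhs x), P z).
Proof.
split=> h.
  change (nbhs x (fun z => Rplus z -> P z)).
  by move: h; apply: filterS => z h zR; apply: h => //; rewrite -RplusE.
have {}h : nbhs x (fun z => Rplus z -> P z) := h.
by move: h; apply: filterS => z h z0; apply: h => //; rewrite RplusE.
Qed.

Lemma has_derR_right f x l : 0 <= x -> has_derR f x l ->
  quotient_at f x z @[z --> x^'+] --> l.
Proof. by move=> x0; apply: cvg_trans; apply: cvg_app; exact: at_right_Rplus. Qed.

Lemma has_derR_left f x l : 0 < x -> has_derR f x l ->
  quotient_at f x z @[z --> x^'-] --> l.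
Proof. by move=> x0; apply: cvg_trans; apply: cvg_app; exact: at_left_Rplus. Qed.

Lemma deriv_RplusE f x l : 0 <= x -> has_derR f x l -> deriv_Rplus f x = l.
Proof.
move=> x0 h; have ? := within_Rplus_proper x0.
by apply: cvg_lim => //; exact: Rhausdorff.
Qed.

Lemma has_derR_cvg f x l : has_derR f x l -> f z @[z --> within (@Rplus R) (nbhs x)] --> f x.
Proof.
move=> h; apply/cvgrPdist_lt => e e0.
have /near_dRplus h1 : \forall z \near within (@Rplus R) x^', `|l - quotient_at f x z| < 1.
  by move/cvgrPdist_lt : h => /(_ 1 ltr01).
have h2 : \forall z \near x, `|x - z| * (`|l| + 1) < e.
  have le1 : 0 < `|l| + 1 by have := normr_ge0 l; lra.
  near=> z; rewrite -ltr_pdivlMr//; near: z.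
  apply: cvgr_dist_lt; first exact: cvg_id.
  by rewrite divr_gt0.
apply/near_Rplus; near=> z => z0; have [->|zx] := eqVneq z x; first by rewrite subrr normr0.
have q : `|l - quotient_at f x z| < 1 by apply: (near h1 z).
have dx : z - x != 0 by rewrite subr_eq0.
have -> : f x - f z = - (quotient_at f x z * (z - x)).
  by rewrite /quotient_at divfK// opprB.
rewrite normrN normrM (distrC z) mulrC.
apply: (@le_lt_trans _ _ (`|x - z| * (`|l| + 1))); last by near: z.
rewrite ler_wpM2l//.
have := ler_normB l (l - quotient_at f x z); rewrite opprB addrC subrK.
by move: q; lra.
Unshelve. all: by end_near. Qed.

Lemma cvg_max0 f x : (f z @[z --> within (@Rplus R) (nbhs (Num.max 0 x))] --> f (Num.max 0 x)) ->
  {for x, continuous (fun z : R => f (Num.max 0 z) : R)}.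
Proof.
move=> h; apply: cvg_trans h => P /near_Rplus h.
have cm : {for x, continuous (fun z : R => Num.max 0 z : R)}.
  by apply: continuous_max; [exact: cvg_cst|exact: cvg_id].
have {}h : nbhs x (fun z => 0 <= Num.max 0 z -> P (f (Num.max 0 z))) := cm _ h.
change (nbhs x (fun z => P (f (Num.max 0 z)))).
by move: h; apply: filterS => z; apply; rewrite le_max lexx.
Qed.

Lemma max0_cvg f x : 0 <= x -> {for x, continuous (fun z : R => f (Num.max 0 z) : R)} ->
  f z @[z --> within (@Rplus R) (nbhs x)] --> f x.
Proof.
move=> x0; rewrite /prop_for /continuous_at (max_idPr x0) => h P /h hP.
have {}hP : nbhs x (fun z => P (f (Num.max 0 z))) := hP.
apply/near_Rplus; move: hP; apply: filterS => z hz z0.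
by rewrite -(max_idPr z0).
Qed.

Lemma has_derRN f x l : has_derR f x l -> has_derR (fun z => - f z) x (- l).
Proof.
rewrite /has_derR => /cvgN; apply: cvg_trans; apply: near_eq_cvg; near=> z.
change (- quotient_at f x z = quotient_at (fun z => - f z) x z); rewrite /quotient_at.
by move: (f z) (f x) (_^-1) => *; ring.
Unshelve. all: by end_near. Qed.

Lemma has_derR_near f h x l :
  (\forall z \near x, 0 <= z -> f z = h z) -> f x = h x -> has_derR f x l -> has_derR h x l.
Proof.
move=> fh fhx; apply: cvg_trans; apply: near_eq_cvg; apply/near_dRplus.
near=> z => zx z0; rewrite /quotient_at fhx; congr ((_ - _) / _).
exact: (near fh z).
Unshelve. all: by end_near. Qed.

(** The one-sided version of is_derive_subgradient, valid at 0. *)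
Lemma has_derR_subgradient f df x : 0 <= x ->
  (forall a b, 0 <= a -> 0 <= b -> f a + df a * (b - a) <= f b) ->
  {for x, continuous (fun z : R => df (Num.max 0 z) : R)} -> has_derR f x (df x).
Proof.
move=> x0 hf; rewrite /prop_for /continuous_at (max_idPr x0) => cdf.
apply/cvgrPdist_le => e e0.
move/cvgrPdist_le : cdf => /(_ e e0) h; apply/near_dRplus.
near=> z => zx z0.
have : `|df x - df (Num.max 0 z)| <= e by near: z.
rewrite (max_idPr z0) => hz.
have h1 := hf x z x0 z0; have h2 := hf z x z0 x0.
have dx : z - x != 0 by rewrite subr_eq0.
move: hz; rewrite !ler_norml /quotient_at -[df x](mulfK dx) -mulrBl => /andP[h3 h4].
rewrite mulfK// in h3 h4.
move: zx; rewrite neq_lt => /orP[zx|zx].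
  have d0 : z - x < 0 by lra.
  by rewrite ler_ndivlMr// ler_ndivrMr//; apply/andP; split; nra.
have d0 : 0 < z - x by lra.
by rewrite ler_pdivlMr// ler_pdivrMr//; apply/andP; split; nra.
Unshelve. all: by end_near. Qed.

Lemma has_derR_is_derive f x l : is_derive x (1 : R) f l -> has_derR f x l.
Proof.
move=> /is_derive1_caratheodory[h [hE ch <-]].
have : h z @[z --> within (@Rplus R) x^'] --> h x.
  move=> P /ch hP; apply/near_dRplus.
  have {}hP : nbhs x (fun z => P (h z)) := hP.
  by move: hP; apply: filterS => z hz _ _.
apply: cvg_trans; apply: near_eq_cvg; apply/near_dRplus.
by near=> z => zx z0; rewrite /quotient_at hE mulfK// subr_eq0.
Unshelve. all: by end_near. Qed.

Lemma C2_on_of (U : set R) f f1 f2 : (forall x, U x -> 0 <= x) ->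
  (forall x, U x -> \forall z \near x, 0 <= z -> U z) ->
  (forall x, U x -> has_derR f x (f1 x)) ->
  (forall x, U x -> has_derR f1 x (f2 x)) ->
  (forall x, U x -> f2 z @[z --> within (@Rplus R) (nbhs x)] --> f2 x) ->
  C2_on U f.
Proof.
move=> UR Uop h1 h2 h3.
have d1 x : U x -> deriv_Rplus f x = f1 x.
  by move=> Ux; apply: deriv_RplusE (h1 _ Ux); exact: UR.
have d2 x : U x -> has_derR (deriv_Rplus f) x (f2 x).
  move=> Ux; apply: has_derR_near (h2 _ Ux); last by rewrite d1.
  by near=> z => z0; rewrite d1//; apply: (near (Uop x Ux) z).
split.
- by move=> x Ux; apply/cvg_ex; exists (f1 x); exact: h1.
- by move=> x Ux; apply/cvg_ex; exists (f2 x); exact: d2.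
- apply/subspace_continuousP => x Ux.
  have e z : U z -> deriv_Rplus (deriv_Rplus f) z = f2 z.
    by move=> Uz; apply: deriv_RplusE (d2 _ Uz); exact: UR.
  move=> P; rewrite /from_subspace (e x Ux) => /(h3 x Ux)/near_Rplus hP.
  have hP' : \forall z \near x, 0 <= z -> P (f2 z) by exact: hP.
  change (nbhs x (fun z => U z -> P (deriv_Rplus (deriv_Rplus f) z))).
  by move: hP'; apply: filterS => z hz Uz; rewrite e//; apply: hz; exact: UR.
Unshelve. all: by end_near. Qed.

Section Glue.
Context (V f f1 h h1 : R -> R) (y1 : R) (y1_gt0 : 0 < y1).
Context (Vlo : forall z, 0 <= z -> z <= y1 -> V z = f z) (Vhi : forall z, y1 < z -> V z = h z).

Lemma C2_glue (f2 h2 : R -> R) :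
  (forall x, 0 <= x -> has_derR f x (f1 x)) ->
  (forall x, 0 <= x -> has_derR f1 x (f2 x)) ->
  (forall x, 0 <= x -> f2 z @[z --> within (@Rplus R) (nbhs x)] --> f2 x) ->
  (forall x : R, y1 < x -> is_derive x (1 : R) h (h1 x)) ->
  (forall x : R, y1 < x -> is_derive x (1 : R) h1 (h2 x)) ->
  (forall x : R, y1 < x -> {for x, continuous h2}) ->
  C2_on (@Rplus R `\ y1) V.
Proof.
move=> df df1 cf2 dh dh1 ch2.
pose piece (a b : R -> R) z := if z <= y1 then a z else b z.
have loE a b z : z < y1 -> piece a b z = a z by move=> /ltW zy; rewrite /piece zy.
have hiE a b z : y1 < z -> piece a b z = b z by move=> zy; rewrite /piece leNgt zy.
have cases x : (@Rplus R `\ y1) x -> 0 <= x /\ (x < y1 \/ y1 < x).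
  move=> [+ /= xy]; rewrite RplusE => x0; split=> //; apply/orP.
  by rewrite -neq_lt; apply/eqP.
apply: (@C2_on_of _ V (piece f1 h1) (piece f2 h2)).
- by move=> x /cases[].
- move=> x /cases[x0 [xy|xy]].
    near=> z => z0; split; first by rewrite RplusE.
    have zy : z < y1 by near: z; exact: lt_nbhsl.
    by move=> /= e; rewrite e ltxx in zy.
  near=> z => z0; split; first by rewrite RplusE.
  have zy : y1 < z by near: z; exact: lt_nbhsr.
  by move=> /= e; rewrite e ltxx in zy.
- move=> x /cases[x0 [xy|xy]].
    rewrite (loE _ _ _ xy); apply: has_derR_near (df _ x0); last by rewrite Vlo// ltW.
    by near=> z => z0; rewrite Vlo// ltW//; near: z; exact: lt_nbhsl.
  rewrite (hiE _ _ _ xy); apply: has_derR_near (has_derR_is_derive (dh _ xy)); last by rewrite Vhi.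
  by near=> z => z0; rewrite Vhi//; near: z; exact: lt_nbhsr.
- move=> x /cases[x0 [xy|xy]].
    rewrite (loE _ _ _ xy); apply: has_derR_near (df1 _ x0); last by rewrite loE.
    by near=> z => z0; rewrite loE//; near: z; exact: lt_nbhsl.
  rewrite (hiE _ _ _ xy); apply: has_derR_near (has_derR_is_derive (dh1 _ xy)); last by rewrite hiE.
  by near=> z => z0; rewrite hiE//; near: z; exact: lt_nbhsr.
- move=> x /cases[x0 [xy|xy]].
    rewrite (loE _ _ _ xy); apply: cvg_trans (cf2 _ x0); apply: near_eq_cvg; apply/near_Rplus.
    by near=> z => z0; rewrite loE//; near: z; exact: lt_nbhsl.
  rewrite (hiE _ _ _ xy) => P /(ch2 x xy) hP; apply/near_Rplus.
  have {}hP : nbhs x (fun z => P (h2 z)) := hP.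
  near=> z => z0; change (P (piece f2 h2 z)).
  by rewrite hiE; near: z => //; exact: lt_nbhsr.
Unshelve. all: by end_near. Qed.

(** A derivative at y1 would equal both one-sided slopes. *)
Lemma not_C2_kink a b : has_derR f y1 a -> is_derive y1 (1 : R) h b -> f y1 = h y1 ->
  a != b -> ~ C2_on (@Rplus R) V.
Proof.
move=> df dh fh ab [dV _ _].
have /dV/cvg_ex[l dVl] : Rplus y1 by rewrite RplusE ltW.
have y10 := ltW y1_gt0.
have left : quotient_at V y1 z @[z --> y1^'-] --> a.
  apply: cvg_trans (has_derR_left y1_gt0 df); apply: near_eq_cvg; near=> z.
  have zy : z < y1 by near: z; exact: nbhs_left_lt.
  have z0 : 0 < z by near: z; exact: nbhs_left_gt.
  by rewrite /quotient_at !Vlo// ltW.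
have right : quotient_at V y1 z @[z --> y1^'+] --> b.
  apply: cvg_trans (has_derR_right y10 (has_derR_is_derive dh)); apply: near_eq_cvg; near=> z.
  have zy : y1 < z by near: z; exact: nbhs_right_gt.
  by rewrite /quotient_at Vhi// Vlo// fh.
have e1 := cvg_unique (@Rhausdorff R) left (has_derR_left y1_gt0 dVl).
have e2 := cvg_unique (@Rhausdorff R) right (has_derR_right y10 dVl).
by move/eqP: ab; apply; rewrite e1 e2.
Unshelve. all: by end_near. Qed.

End Glue.

End HalfLineDerivative.

(** * From the utility to the cost *)

Section Utility.
Context {R : realType} (u : R -> R).
Context (u_ge0 : forall x, 0 <= x -> 0 <= u x)
  (u_incr : forall x z, 0 <= x -> x < z -> u x < u z)
  (u_concave : strictly_concave_on (@Rplus R) u)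
  (u_C2 : C2_on (@Rplus R) u) (u_0 : u 0 = 0)
  (u_inada : deriv_Rplus u x @[x --> +oo] --> (0 : R))
  (gamma c0 c1 : R)
  (gamma_gt1 : 1 < gamma) (c0_gt0 : 0 < c0) (c1_gt0 : 0 < c1)
  (u_growth : forall x, 0 <= x ->
     c0 * (-1 + x `^ gamma^-1) <= u x <= c1 * (1 + x `^ gamma^-1)).

Local Notation u1 := (deriv_Rplus u).
Local Notation u2 := (deriv_Rplus (deriv_Rplus u)).
Local Notation v := (pinv (@Rplus R) u).

Definition marginal_cost (y : R) : R := (u1 (v y))^-1.
Local Notation dv := marginal_cost.

Lemma u_has_derR (x : R) : 0 <= x -> has_derR u x (u1 x).
Proof. by rewrite -RplusE => /(let: And3 h _ _ := u_C2 in h). Qed.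

Lemma u1_has_derR (x : R) : 0 <= x -> has_derR u1 x (u2 x).
Proof. by rewrite -RplusE => /(let: And3 _ h _ := u_C2 in h). Qed.

Lemma u2_cvg (x : R) : 0 <= x -> u2 z @[z --> within (@Rplus R) (nbhs x)] --> u2 x.
Proof.
move=> x0; case: u_C2 => _ _ /subspace_continuousP/(_ x); apply.
by rewrite RplusE.
Qed.

(** By concavity, difference quotients at x are monotone; the limit towards x gives
    the tangent. *)
Lemma u_tangent (x z : R) : 0 <= x -> 0 <= z -> u z <= u x + u1 x * (z - x).
Proof.
move=> x0 z0; have [->|zx] := eqVneq z x; first by rewrite subrr mulr0 addr0.
have dx : z - x != 0 by rewrite subr_eq0.
(* the difference quotients at x are ordered by concavity *)
have conc s : 0 < s < 1 -> s * (u z - u x) <= u (x + s * (z - x)) - u x.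
  move=> s01; have Rz : Rplus z by rewrite RplusE.
  have Rx : Rplus x by rewrite RplusE.
  have := u_concave Rz Rx zx s01.
  have -> : s * z + (1 - s) * x = x + s * (z - x) by ring.
  by lra.
have key w : w != x -> 0 < (w - x) / (z - x) < 1 ->
    (w - x) / (z - x) * (u z - u x) <= u w - u x.
  move=> wx /conc; rewrite divfK//.
  by have -> : x + (w - x) = w by ring.
move: (zx); rewrite neq_lt => /orP[lt|lt].
  have xp : 0 < x by lra.
  have h := has_derR_left xp (u_has_derR x0).
  have : u1 x <= (u z - u x) / (z - x).
    apply: (cvgr_to_le h); near=> w.
    have wx : w < x by near: w; exact: nbhs_left_lt.
    have zw : z < w by near: w; exact: nbhs_left_gt.
    have d0 : z - x < 0 by lra.
    have wx0 : w - x < 0 by lra.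
    have := key w; rewrite lt_eqF// => /(_ isT).
    rewrite ltr_ndivrMr// ltr_ndivlMr// mul1r mul0r => k.
    have {}k := k _; rewrite /quotient_at.
    rewrite ler_ndivrMr// mulrAC; apply: le_trans (k _); last by apply/andP; split; lra.
    by rewrite le_eqVlt; apply/orP; left; apply/eqP; ring.
  rewrite ler_ndivlMr; lra.
have h := has_derR_right x0 (u_has_derR x0).
have : (u z - u x) / (z - x) <= u1 x.
  apply: (cvgr_to_ge h); near=> w.
  have xw : x < w by near: w; exact: nbhs_right_gt.
  have wz : w < z by near: w; exact: nbhs_right_lt.
  have d0 : 0 < z - x by lra.
  have := key w; rewrite gt_eqF// => /(_ isT).
  rewrite ltr_pdivrMr// ltr_pdivlMr// mul1r mul0r /quotient_at => k.
  rewrite ler_pdivlMr; last by lra.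
  apply: le_trans (k _); last by apply/andP; split; lra.
  by rewrite le_eqVlt; apply/orP; left; apply/eqP; ring.
rewrite ler_pdivrMr; lra.
Unshelve. all: by end_near. Qed.

Lemma u_tangent_lt (x z : R) : 0 <= x -> 0 <= z -> z != x -> u z < u x + u1 x * (z - x).
Proof.
move=> x0 z0 zx; have h2 : 0 < (2^-1 : R) < 1 by apply/andP; split; lra.
have Rz : Rplus z by rewrite RplusE.
have Rx : Rplus x by rewrite RplusE.
have := u_concave Rz Rx zx h2.
set w := _ * z + _ => hw.
have w0 : 0 <= w by rewrite /w; lra.
have := u_tangent x0 w0; rewrite /w in hw *; lra.
Qed.

Lemma u1_gt0 (x : R) : 0 <= x -> 0 < u1 x.
Proof.
move=> x0; have x1 : x < x + 1 by lra.
have := u_incr x0 x1; have x10 : 0 <= x + 1 by lra.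
by have := u_tangent x0 x10; lra.
Qed.

Lemma u1_lt (x z : R) : 0 <= x -> x < z -> u1 z < u1 x.
Proof.
move=> x0 xz; have z0 : 0 <= z by lra.
have h1 := u_tangent_lt x0 z0 (negbT (gt_eqF xz)).
have h2 := u_tangent_lt z0 x0 (negbT (lt_eqF xz)); nra.
Qed.

Lemma u1_continuous : continuous (fun x : R => u1 (Num.max 0 x) : R).
Proof.
move=> x; apply: cvg_max0; apply: has_derR_cvg; apply: u1_has_derR.
by rewrite le_max lexx.
Qed.

Lemma u_continuous : continuous (fun x : R => u (Num.max 0 x) : R).
Proof.
move=> x; apply: cvg_max0; apply: has_derR_cvg; apply: u_has_derR.
by rewrite le_max lexx.
Qed.

Lemma u_onto (y : R) : 0 <= y -> exists2 x : R, 0 <= x & u x = y.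
Proof.
move=> y0; pose b := (1 + y / c0) `^ gamma.
have b0 : 0 <= b by exact: powR_ge0.
have yc : 0 <= 1 + y / c0 by rewrite addr_ge0// divr_ge0// ltW.
have ub : y <= u b.
  have /andP[+ _] := u_growth b0; apply: le_trans.
  rewrite /b -powRrM divff ?powRr1// ?gt_eqF//; last exact: lt_trans ltr01 gamma_gt1.
  by rewrite addKr mulrC divfK// gt_eqF.
have cu : {within `[0, b], continuous (fun x : R => u (Num.max 0 x) : R)}.
  by apply: continuous_subspaceT => x; exact: u_continuous.
have [|x] := IVT b0 cu (v := y).
  by rewrite maxxx (max_idPr b0) u_0 ge_min y0 le_max ub orbT.
rewrite in_itv/= => /andP[x0 _]; rewrite (max_idPr x0) => xy.
by exists x.
Qed.

Lemma vK (x : R) : 0 <= x -> v (u x) = x.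
Proof.
move=> x0; apply: pinvKV; last by rewrite inE RplusE.
move=> a b; rewrite !inE !RplusE => a0 b0 ab.
case: (ltgtP a b) => // h.
  by have := u_incr a0 h; rewrite ab ltxx.
by have := u_incr b0 h; rewrite ab ltxx.
Qed.

Lemma v_spec (y : R) : 0 <= y -> 0 <= v y /\ u (v y) = y.
Proof. by move=> /u_onto[x x0 <-]; rewrite vK. Qed.

Lemma marginal_cost_u (x : R) : 0 <= x -> dv (u x) = (u1 x)^-1.
Proof. by move=> x0; rewrite /marginal_cost vK. Qed.

(** Tangents of u lie above its graph, hence those of the inverse lie below. Marginal
    costs reach all large values because u' tends to 0. *)
Lemma utility_convex_cost : convex_cost v dv.
Proof.
have v0 : v 0 = 0 by rewrite -[in LHS]u_0 vK.
have dv0 : dv 0 = (u1 0)^-1 by rewrite /marginal_cost v0.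
split.
- exact: v0.
- move=> x z /v_spec[x0 xE] /v_spec[z0 zE]; rewrite /marginal_cost.
  have := u_tangent x0 z0; rewrite xE zE => h; have u10 := u1_gt0 x0.
  have : (z - x) / u1 (v x) <= v z - v x by rewrite ler_pdivrMr//; lra.
  by rewrite mulrC; lra.
- move=> x z x0 xz; have z0 : 0 <= z by lra.
  have [vx xE] := v_spec x0; have [vz zE] := v_spec z0.
  rewrite /marginal_cost ltf_pV2 ?posrE ?u1_gt0//; apply: u1_lt => //.
  rewrite ltNge; apply/negP; rewrite le_eqVlt => /predU1P[e|/(u_incr vz)].
    by rewrite -xE -zE e ltxx in xz.
  by rewrite xE zE ltNge (ltW xz).
- by rewrite dv0 invr_gt0 u1_gt0.
- move=> s; rewrite dv0 => s0.
  have sp : 0 < s by apply: lt_le_trans s0; rewrite invr_gt0 u1_gt0.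
  have sV : s^-1 <= u1 0 by rewrite -[leRHS]invrK lef_pV2 ?posrE ?invr_gt0 ?u1_gt0.
  have [M [_ hM]] : \forall x \near +oo, u1 x < s^-1.
    by apply: (cvgr_lt _ u_inada); rewrite invr_gt0.
  pose b := Num.max 0 M + 1.
  have b0 : 0 <= b by rewrite addr_ge0// le_max lexx.
  have bM : M < b by rewrite (@le_lt_trans _ _ (Num.max 0 M))// ?ltrDl// le_max lexx orbT.
  have ub := hM b bM.
  have cu : {within `[0, b], continuous (fun x : R => u1 (Num.max 0 x) : R)}.
    by apply: continuous_subspaceT => x; exact: u1_continuous.
  have [|x] := IVT b0 cu (v := s^-1).
    by rewrite maxxx (max_idPr b0) ge_min (ltW ub) orbT le_max sV.
  rewrite in_itv/= => /andP[x0 _]; rewrite (max_idPr x0) => xs.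
  by exists (u x); [exact: u_ge0|rewrite marginal_cost_u// xs invrK].
Qed.

Local Notation vP := utility_convex_cost.
Local Notation vs := (legendre v dv).

(** The lower growth bound on u gives v x <= (1 + x / c0)^gamma. For small x,
    convexity replaces the constant term by a linear one. *)
Lemma cost_growth : exists2 a : R, 0 <= a & forall x, 0 <= x -> v x <= a * (x + x `^ gamma).
Proof.
have g0 : 0 < gamma by exact: lt_trans ltr01 gamma_gt1.
have base x : 0 <= x -> v x <= (1 + x / c0) `^ gamma.
  move=> /v_spec[w0 wE]; have /andP[+ _] := u_growth w0; rewrite wE => h.
  have h1 : v x `^ gamma^-1 <= 1 + x / c0.
    by rewrite -lerBlDl ler_pdivlMr// mulrC addrC.
  have -> : v x = (v x `^ gamma^-1) `^ gamma.
    by rewrite -powRrM mulVf ?powRr1// gt_eqF.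
  by apply: ge0_ler_powR; rewrite ?nnegrE ?powR_ge0 ?(ltW g0)// (le_trans _ h1)// powR_ge0.
have d1 := ltW (marginal_gt0 vP ler01).
have k0 : 0 <= 1 + c0^-1 by rewrite addr_ge0// invr_ge0 ltW.
exists (dv 1 + (1 + c0^-1) `^ gamma) => [|x x0]; first by rewrite addr_ge0 ?powR_ge0.
have p0 := powR_ge0 x gamma; have p1 := powR_ge0 (1 + c0^-1) gamma.
have [x1|x1] := leP x 1.
  have := cost_subgradient vP x0 (lexx 0); rewrite (cost0 vP).
  have := marginal_le vP x0 x1.
  move: (powR _ _) (powR _ _) (v _) (dv _) (dv _) p0 p1 d1 => *; nra.
have : v x <= ((1 + c0^-1) * x) `^ gamma.
  apply: le_trans (base x x0) _; apply: ge0_ler_powR; rewrite ?nnegrE ?(ltW g0)//.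
  - by rewrite addr_ge0// divr_ge0// ltW.
  - exact: mulr_ge0.
  - by rewrite mulrDl mul1r lerD ?(ltW x1)// mulrC.
rewrite powRM//.
move: (powR _ _) (powR _ _) (v _) (dv _) p0 p1 d1 => *; nra.
Qed.

(** With w = v (conj_arg s), the conjugate is s * u w - w. The upper growth bound on u
    and Young's inequality for the exponent gamma leave a power of s, with the dual
    exponent. *)
Lemma conj_growth : exists2 C : R, 0 <= C &
  forall s, 0 <= s -> vs s <= C * (1 + s `^ (gamma / (gamma - 1))).
Proof.
have g0 : 0 < gamma by exact: lt_trans ltr01 gamma_gt1.
have g10 : 0 < gamma - 1 by rewrite subr_gt0.
set q := gamma / (gamma - 1).
have q1 : 1 <= q by rewrite ler_pdivlMr// mul1r lerBlDr lerDl.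
have q0 : 0 < q by exact: lt_le_trans ltr01 q1.
have conj : gamma^-1 + q^-1 = 1.
  by rewrite /q; field; rewrite !gt_eqF.
exists (c1 + c1 `^ q) => [|s s0]; first by rewrite addr_ge0 ?powR_ge0 ?ltW.
rewrite legendreE; have [w0 wE] := v_spec (conj_arg_ge0 vP s).
have /andP[_] := u_growth w0; rewrite wE => /(ler_wpM2l s0).
set w := v _ in w0 *; set x := conj_arg _ _ => hx.
have b0 : 0 <= c1 * s by rewrite mulr_ge0// ltW.
have := conjugate_powR (powR_ge0 w gamma^-1) b0 g0 q0 conj.
rewrite -powRrM mulVf ?gt_eqF// powRr1// powRM ?(ltW c1_gt0)//.
have h1 : w / gamma <= w by rewrite ler_pdivrMr// ler_peMr// ltW.
have h2 : c1 `^ q * s `^ q / q <= c1 `^ q * s `^ q.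
  by rewrite ler_pdivrMr// ler_peMr// mulr_ge0// powR_ge0.
have h3 : s <= 1 + s `^ q.
  have [s1|s1] := leP s 1; first by rewrite (le_trans s1)// lerDl powR_ge0.
  apply: (@le_trans _ _ (s `^ q)); last by rewrite lerDr.
  by rewrite -{1}(powRr1 s0); apply: ler_powR => //; exact: ltW.
have h4 : c1 * s <= c1 * (1 + s `^ q) by rewrite ler_pM2l.
have := powR_ge0 c1 q; have := powR_ge0 s q.
move: h1 h2 h4 hx; move: (s `^ q) (c1 `^ q) (w `^ _) => S D W *; lra.
Qed.

Lemma FstarE (p : R) : Fstar u p = - vs (- p).
Proof.
rewrite /Fstar; apply/eqP; rewrite eq_le; apply/andP; split.
  apply: inf_lbound.
    exists (- vs (- p)) => _ [x + <-]; rewrite RplusE => x0.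
    by have := fenchel_young vP (- p) x0; rewrite /F; move: (v x) (vs _) => *; lra.
  exists (conj_arg dv (- p)); first by rewrite RplusE (conj_arg_ge0 vP).
  by rewrite legendreE /F; move: (conj_arg _ _) => x; move: (v x) => *; ring.
apply: lb_le_inf; first by exists (0 * p - F u 0), 0; rewrite ?RplusE.
move=> _ [x + <-]; rewrite RplusE => x0.
by have := fenchel_young vP (- p) x0; rewrite /F; move: (v x) (vs _) => *; lra.
Qed.

Lemma F_has_derR (y : R) : 0 <= y -> has_derR (F u) y (- dv y).
Proof.
move=> y0; apply: has_derRN.
exact: (has_derR_subgradient y0 (cost_subgradient vP) (marginal_continuous vP (x := y))).
Qed.

Lemma F_dmE (r rho m y : R) : 0 <= y -> F_dm u (r / rho) m y = retire_slack v dv r rho m y.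
Proof.
move=> y0; rewrite /F_dm (deriv_RplusE y0 (F_has_derR y0)) FstarE /retire_slack /F mulrN opprK.
by move: (vs _) (v y) => *; ring.
Qed.

Lemma cost_cvg (y : R) : 0 <= y -> v z @[z --> within (@Rplus R) (nbhs y)] --> v y.
Proof. by move=> y0; apply: max0_cvg y0 _; exact: (cost_continuous vP). Qed.

Lemma marginal_cvg (y : R) : 0 <= y -> dv z @[z --> within (@Rplus R) (nbhs y)] --> dv y.
Proof. by move=> y0; apply: max0_cvg y0 _; exact: (marginal_continuous vP). Qed.

Lemma cost_within (y : R) : 0 <= y -> v z @[z --> within (@Rplus R) y^'] --> within (@Rplus R) (v y)^'.
Proof.
move=> y0 P /near_dRplus hP; apply/near_dRplus.
have /near_Rplus : \forall z \near within (@Rplus R) (nbhs y), v z != v y -> 0 <= v z -> P (v z).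
  exact: (cost_cvg y0) hP.
apply: filterS => z hz zy z0; apply: hz => //; last exact: cost_ge0 vP _ z0.
move: zy; rewrite neq_lt => /orP[zy|zy].
  by rewrite lt_eqF// (cost_lt vP).
by rewrite gt_eqF// (cost_lt vP).
Qed.

Definition curvature (y : R) : R := - (u2 (v y) * dv y ^+ 3).

Lemma marginal_has_derR (y : R) : 0 <= y -> has_derR dv y (curvature y).
Proof.
move=> y0; have v0 := cost_ge0 vP y0.
have FF : Filter (within (@Rplus R) y^') by exact: within_filter.
have h1 : quotient_at u1 (v y) (v z) @[z --> within (@Rplus R) y^'] --> u2 (v y).
  by apply: cvg_comp (cost_within y0) _; exact: u1_has_derR.
have h2 : quotient_at v y z @[z --> within (@Rplus R) y^'] --> dv y.
  exact: (has_derR_subgradient y0 (cost_subgradient vP) (marginal_continuous vP (x := y))).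
have h3 : dv z @[z --> within (@Rplus R) y^'] --> dv y.
  move=> P /(marginal_cvg y0)/near_Rplus hP; apply/near_dRplus.
  by move: hP; apply: filterS => z hz _; exact: hz.
have h4 := cvgM (cvgM h1 h2) (cvgM h3 (cvg_cst (dv y))).
have {h4} h5 := cvgN (h4 FF FF FF FF); move: (h5 FF) => {h5}; rewrite /has_derR /curvature.
have -> : - (u2 (v y) * dv y * (dv y * dv y)) = - (u2 (v y) * dv y ^+ 3) by ring.
apply: cvg_trans; apply: near_eq_cvg; apply/near_dRplus.
near=> z => zy z0.
have a1 := u1_gt0 (cost_ge0 vP z0); have a2 := u1_gt0 v0.
have vz : v z - v y != 0.
  rewrite subr_eq0; move: zy; rewrite neq_lt => /orP[zy|zy].
    by rewrite lt_eqF// (cost_lt vP).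
  by rewrite gt_eqF// (cost_lt vP).
have dz : z - y != 0 by rewrite subr_eq0.
change (- (quotient_at u1 (v y) (v z) * quotient_at v y z * (dv z * dv y))
  = quotient_at dv y z).
rewrite /quotient_at /marginal_cost.
move: a1 a2 vz; move: (u1 (v z)) (u1 (v y)) (v z) (v y) => A1 A2 V1 V2 a1 a2 vz.
by field; rewrite dz vz !gt_eqF.
Unshelve. all: by end_near. Qed.

Lemma curvature_cvg (y : R) : 0 <= y -> curvature z @[z --> within (@Rplus R) (nbhs y)] --> curvature y.
Proof.
move=> y0; have v0 := cost_ge0 vP y0.
have FF : Filter (within (@Rplus R) (nbhs y)) by exact: within_filter.
have h : u2 (v z) @[z --> within (@Rplus R) (nbhs y)] --> u2 (v y).
  move=> P /(u2_cvg v0)/near_Rplus hP; apply/near_Rplus.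
  have /near_Rplus : \forall z \near within (@Rplus R) (nbhs y), 0 <= v z -> P (u2 (v z)).
    exact: (cost_cvg y0) hP.
  by apply: filterS => z hz z0; apply: hz => //; exact: (cost_ge0 vP).
apply: cvgN; apply: cvgM h _; have d := marginal_cvg y0.
have h3 := cvgM d (cvgM d d); exact: (h3 FF FF).
Qed.

(** * The face-lifted utility *)

Section Contract.
Local Notation mu := (@lebesgue_measure R).
Context (r rho m : R) (r_gt0 : 0 < r) (r_lt_rho : r < rho) (m_gt0 : 0 < m).
Context (F_dm_decr : forall x z, 0 <= x -> x < z ->
     F_dm u (r / rho) m z < F_dm u (r / rho) m x)
  (F_dm_oo : F_dm u (r / rho) m x @[x --> +oo] --> -oo).

Local Notation slack := (retire_slack v dv r rho m).
Local Notation yhat := (yhat u m).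
Local Notation ybar := (ybar u (r / rho) m).
Local Notation delta := (r / rho).

Let rho_gt0 := rate_gt0 r_gt0 r_lt_rho.
Let d_gt0 := delta_gt0 r_gt0 r_lt_rho.

Lemma yhat_spec : 0 < yhat /\ v yhat = m.
Proof.
have y0 : 0 <= u m by apply: u_ge0; exact: ltW.
have vy : v (u m) = m by rewrite vK// ltW.
have -> : yhat = u m.
  apply/eqP; rewrite eq_le; apply/andP; split.
    apply: inf_lbound; first by exists 0 => z [].
    by split=> //; rewrite /F vy.
  apply: lb_le_inf; first by exists (u m); split=> //; rewrite /F vy.
  move=> z [z0]; rewrite /F lerN2 => h; rewrite leNgt; apply/negP => zu.
  by have := cost_lt vP z0 zu; rewrite vy ltNge h.
by split=> //; rewrite -u_0; exact: u_incr.
Qed.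

Lemma slack_decr x z : 0 <= x -> x < z -> slack z < slack x.
Proof.
by move=> x0 xz; have := F_dm_decr x0 xz; rewrite !F_dmE// (le_trans x0)// ltW.
Qed.

(** At yhat the slack is delta s yhat - vs (delta s), where s = dv yhat. The maximiser
    of the conjugate at delta s < s is less than yhat, so the difference is positive. *)
Lemma slack_yhat : 0 < slack yhat.
Proof.
have [y0 vy] := yhat_spec; rewrite /retire_slack vy legendreE.
set s := dv yhat; have s0 : 0 < s by exact: marginal_gt0 vP _ (ltW y0).
have d1 : delta < 1 by rewrite ltr_pdivrMr// mul1r.
have ds : delta * s < s by rewrite -[ltRHS]mul1r ltr_pM2r.
have ds0 : 0 < delta * s by rewrite mulr_gt0.
have := conj_arg_lt_marginal vP (ltW y0) ds y0.
have g0 := conj_arg_ge0 vP (delta * s); have := cost_ge0 vP g0.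
move: (delta * s) ds0 => t t0; move: (conj_arg _ _) => x; move: (v x) yhat => w y ? ?.
have : t * x < t * y by rewrite ltr_pM2l.
lra.
Qed.

Lemma ybar_nonempty : [set y | 0 <= y /\ F_dm u delta m y <= 0] !=set0.
Proof.
have [M [_ hM]] : \forall x \near +oo, F_dm u delta m x <= 0.
  by move/cvgrNyPle : F_dm_oo; exact.
exists (Num.max 0 M + 1); split; first by rewrite addr_ge0// le_max lexx.
by apply: hM; rewrite (@le_lt_trans _ _ (Num.max 0 M)) ?ltrDl// le_max lexx orbT.
Qed.

Lemma ybar_lbound : has_lbound [set y | 0 <= y /\ F_dm u delta m y <= 0].
Proof. by exists 0 => z []. Qed.

Lemma ybar_ge0 : 0 <= ybar.
Proof. by apply: lb_le_inf; [exact: ybar_nonempty|move=> z []]. Qed.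

Lemma slack_gt0 y : 0 <= y -> y < ybar -> 0 < slack y.
Proof.
move=> y0; apply: contraTT; rewrite -!leNgt => h.
by apply: inf_lbound; [exact: ybar_lbound|split=> //; rewrite F_dmE].
Qed.

Lemma slack_lt0 y : ybar < y -> slack y < 0.
Proof.
move=> yb; have hi : has_inf [set y | 0 <= y /\ F_dm u delta m y <= 0].
  by split; [exact: ybar_nonempty|exact: ybar_lbound].
have e0 : 0 < y - ybar by rewrite subr_gt0.
have [z [z0 hz]] := inf_adherent e0 hi; rewrite -/ybar subrKC => zy.
by apply: lt_le_trans (slack_decr z0 zy) _; rewrite -F_dmE.
Qed.

Lemma slack_continuous : continuous (fun x : R => slack (Num.max 0 x) : R).
Proof.
move=> x; have cd := marginal_continuous vP (x := x); have cc := cost_continuous vP (x := x).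
have cm : {for x, continuous (fun z : R => Num.max 0 z : R)}.
  by apply: continuous_max; [exact: cvg_cst|exact: cvg_id].
have cdd : {for x, continuous (fun z : R => delta * dv (Num.max 0 z) : R)}.
  by apply: cvgM; [exact: cvg_cst|exact: cd].
apply: cvgD; last by apply: cvgM.
apply: cvgB; first by apply: cvgB => //; exact: cvg_cst.
by apply: (@continuous_comp _ _ _ (fun z : R => delta * dv (Num.max 0 z)) vs x) => //;
  exact: (conj_continuous vP).
Qed.

Lemma slack_ybar : slack ybar <= 0.
Proof.
have b0 := ybar_ge0.
have h : slack (Num.max 0 z) @[z --> ybar^'+] --> slack ybar.
  by have := cvg_at_right_filter (slack_continuous (x := ybar)); rewrite (max_idPr b0).
apply: (cvgr_to_le h); near=> z.
have zb : ybar < z by near: z; exact: nbhs_right_gt.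
by rewrite (max_idPr _) ?(le_trans b0) ?ltW// slack_lt0.
Unshelve. all: by end_near. Qed.

Lemma slack_le0 y : ybar <= y -> slack y <= 0.
Proof. by rewrite le_eqVlt => /predU1P[<-|/slack_lt0/ltW//]; exact: slack_ybar. Qed.

Lemma yhat_lt_ybar : yhat < ybar.
Proof. by rewrite ltNge; apply/negP => /slack_le0; rewrite leNgt slack_yhat. Qed.

Lemma stop_valueE (W : R -> R) (y1 z : R) : 0 <= z -> stop_value v W y1 z =
  F u z * \1_(`[0, y1]) z + W z * \1_(`]y1, +oo[) z.
Proof.
move=> z0; rewrite /stop_value /F !indicE !mem_setE !in_itv/= z0 /= andbT ltNge.
by case: (z <= y1); rewrite /= ?mulr1 ?mulr0 ?addr0 ?add0r.
Qed.

Section Value.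
Context (W : R -> R) (yt : R) (yt_gt0 : 0 < yt) (yt_ybar : yt < ybar).
Context (Whi : forall z, yt <= z -> - v z <= W z).
Context (Wlo : forall z, 0 <= z -> z <= yt -> W z <= - v z).
Context (superW : forall p y T,
  mu.-integrable `[0, T] (EFin \o cost_flow v rho m p) ->
  borel_Rplus p ->
  (forall s, 0 <= s -> s <= T -> 0 <= y s) ->
  (exists2 y0, 0 <= y0 & solves_ode r y0 p y) ->
  forall s t, 0 <= s -> s <= t -> t <= T ->
    expR (- rho * t) * W (y t) - total_cost v rho m p t
      <= expR (- rho * s) * W (y s) - total_cost v rho m p s).
Context (infW : forall p y y0, 0 <= y0 -> borel_Rplus p -> solves_ode r y0 p y ->
  (forall T, mu.-integrable `[0, T] (EFin \o cost_flow v rho m p)) ->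
  expR (- r * t) * y t @[t --> +oo] --> (0 : R) ->
  forall a, (forall t, 0 <= t -> a <= - total_cost v rho m p t) -> a <= W y0).
Context (attained : forall y0, yt < y0 -> ((W y0)%:E <= Fbar u r rho m y0)%E).

(** The criterion behind both cases: beyond yt, the value W must be attained and be a
    supersolution. *)
Lemma Fbar_stop_value y0 : 0 <= y0 -> Fbar u r rho m y0 = (stop_value v W yt y0)%:E.
Proof.
move=> y00; apply/eqP; rewrite eq_le; apply/andP; split; last first.
  rewrite /stop_value; case: (leP y0 yt) => y0t; last exact: attained.
  exact: Fbar_ge_retire.
apply: ge_ereal_sup => _ [p [y [T [bp ode aT ->]]]].
have hb : yt < (yt + ybar) / 2 by move: yt_ybar; lra.
apply: (payoff_le vP r_gt0 r_lt_rho (ltW m_gt0) bp ode y00 yt_gt0 hb) => //.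
- by move=> z z0 zb; apply/ltW/slack_gt0 => //; move: yt_ybar; lra.
- by move=> T' ki yT; apply: superW => //; exists y0.
- exact: (infW y00 bp ode).
Qed.

End Value.

(** Total costs are at least m (1 - e^{-rho t}), so that never retiring yields at most
    -m, which is approached by spreading the payments over a long time. *)
Lemma Fbar_abandon : gamma * delta <= 1 ->
  forall y0, 0 <= y0 -> Fbar u r rho m y0 = (stop_value v (cst (- m)) yhat y0)%:E.
Proof.
move=> gd; have [yh0 vyh] := yhat_spec; have [a a0 va] := cost_growth.
apply: Fbar_stop_value => //.
- exact: yhat_lt_ybar.
- by move=> z hz; rewrite lerN2 -vyh (cost_le vP)// ltW.
- by move=> z z0 hz; rewrite lerN2 -vyh (cost_le vP).
- move=> p y T ki bp _ [y0 _ ode] s t s0 st tT.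
  exact: (constant_supersolution vP r_gt0 r_lt_rho bp.2 ode ki s0 st tT).
- move=> p y y0 _ bp ode ki _ b hb.
  have lim : - (m * (1 - expR (- rho * t))) @[t --> +oo] --> (- (m * (1 - 0)) : R).
    apply: cvgN; apply: cvgM; first exact: cvg_cst.
    by apply: cvgB; [exact: cvg_cst|exact: cvg_expRN].
  rewrite subr0 mulr1 in lim; apply: (cvgr_to_ge lim); near=> t.
  have t0 : 0 <= t by near: t; exact: nbhs_pinfty_ge.
  apply: le_trans (hb t t0) _; rewrite lerN2.
  have := cost_lower vP r_gt0 r_lt_rho bp.2 ode (ki t) (lexx 0) t0 (lexx t).
  have -> : total_cost v rho m p 0 = 0 by rewrite /total_cost set_itv1 Rintegral_set1.
  by rewrite mulr0 expR0 subr0.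
- move=> y0 hy; have y00 := lt_trans yh0 hy.
  apply: (Fbar_ge_abandon vP r_gt0 r_lt_rho (ltW m_gt0) y00 a0 gamma_gt1 _ va).
  by move: gd; rewrite mulrA ler_pdivrMr// mul1r.
Unshelve. all: by end_near. Qed.

Lemma Fbar_abandon_fin : gamma * delta <= 1 ->
  (forall z, 0 <= z -> z <= yhat -> fine (Fbar u r rho m z) = F u z) /\
  (forall z, yhat < z -> fine (Fbar u r rho m z) = - m).
Proof.
move=> gd; split=> z; first by move=> z0 zt; rewrite (Fbar_abandon gd z0) /stop_value zt.
move=> zt; have z0 := lt_trans (yhat_spec).1 zt.
by rewrite (Fbar_abandon gd (ltW z0)) /stop_value leNgt zt.
Qed.

Lemma Fbar_abandon_C2 : gamma * delta <= 1 ->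
  C2_on (@Rplus R `\ yhat) (fun y => fine (Fbar u r rho m y)).
Proof.
move=> gd; have [lo hi] := Fbar_abandon_fin gd.
apply: (@C2_glue _ _ _ (fun z => - dv z) (fun=> - m) (cst 0) _ lo hi
  (fun z => - curvature z) (cst 0)).
- exact: F_has_derR.
- by move=> x x0; apply: has_derRN; exact: marginal_has_derR.
- by move=> x x0; apply: cvgN; exact: curvature_cvg.
- by move=> x _; exact: cvg_cst.
Qed.

Lemma Fbar_abandon_not_C2 : gamma * delta <= 1 ->
  ~ C2_on (@Rplus R) (fun y => fine (Fbar u r rho m y)).
Proof.
move=> gd; have [yh0 vyh] := yhat_spec; have [lo hi] := Fbar_abandon_fin gd.
apply: (@not_C2_kink _ _ _ (fun=> - m) _ yh0 lo hi (- dv yhat) 0).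
- by apply: F_has_derR; exact: ltW.
- by rewrite /F vyh.
- by rewrite oppr_eq0 gt_eqF// (marginal_gt0 vP (ltW yh0)).
Qed.

Section NeverRetire.
Context (gd : 1 < gamma * delta).

(** This is where 1 < gamma * delta enters: the dual function is finite. *)
Lemma growth_rate : (rho - r) * (gamma / (gamma - 1)) < rho.
Proof.
have g10 : 0 < gamma - 1 by rewrite subr_gt0.
move: gd; rewrite !mulrA ltr_pdivlMr// ltr_pdivrMr//; lra.
Qed.

Context (C : R) (C_ge0 : 0 <= C)
  (grow : forall s, 0 <= s -> vs s <= C * (1 + s `^ (gamma / (gamma - 1)))).
Local Notation q := (gamma / (gamma - 1)).
Local Notation cont := (cont_value v dv r rho).
Local Notation price := (price dv r rho).

Lemma q_gt1 : 1 < q.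
Proof. by rewrite ltr_pdivlMr ?subr_gt0// mul1r ltrBlDr ltrDl. Qed.

Let q_ge0 : 0 <= q := ltW (lt_trans ltr01 q_gt1).

Lemma w0starE p : p <= 0 -> w0star u rho delta p = - disc_conj v dv r rho (- p).
Proof.
move=> p0; rewrite /w0star disc_conjE.
have p0' : 0 <= - p by lra.
have := disc_conj_integrable vP r_gt0 r_lt_rho C_ge0 q_ge0 growth_rate grow p0'.
have e1 : rho * (1 - delta) = rho - r by field; rewrite gt_eqF.
move=> ib; rewrite -[RHS]mulN1r.
have -> : -1 * \int[mu]_(t in `[0, +oo[) (rho * expR (- rho * t) *
    vs (delta * expR ((rho - r) * t) * - p)) = \int[mu]_(t in `[0, +oo[)
    (-1 * (rho * expR (- rho * t) * vs (delta * expR ((rho - r) * t) * - p))).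
  by rewrite RintegralZl.
by apply: eq_Rintegral => t _; rewrite FstarE e1 !mulrN mulN1r.
Qed.

Lemma w0E y : w0 u rho delta y = cont y.
Proof.
rewrite /w0 /cont_value; congr inf; apply/seteqP; split => x /= [p].
  rewrite in_itv/= => p0 <-; exists (- p); first by rewrite oppr_ge0.
  by rewrite w0starE//; ring.
move=> p0 <-; exists (- p); first by rewrite in_itv/= oppr_le0.
have h : - p <= 0 by rewrite oppr_le0.
by rewrite (w0starE h) !opprK mulrN mulrC addrC.
Qed.

Lemma switch_exists : exists yt, [/\ yhat < yt < ybar, - v yt = cont yt - m, price yt < dv yt,
  forall y, 0 < y -> y < yt -> cont y - m < - v y &
  forall y, yt < y -> - v y < cont y - m].
Proof.
have [yh0 vyh] := yhat_spec.
apply: (crossing vP r_gt0 r_lt_rho C_ge0 q_ge0 growth_rate grow yh0 vyh (ltW yhat_lt_ybar)).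
- exact: slack_gt0.
- exact: slack_le0.
- exact: slack_lt0.
Qed.

Section Switch.
Context (yt : R) (yt_in : yhat < yt < ybar) (yt_eq : - v yt = cont yt - m)
  (yt_lo : forall y, 0 < y -> y < yt -> cont y - m < - v y)
  (yt_hi : forall y, yt < y -> - v y < cont y - m).

Local Notation V := (stop_value v (fun z => cont z - m) yt).

Lemma switch_gt0 : 0 < yt.
Proof. by have [h _] := yhat_spec; case/andP: yt_in => + _; exact: lt_trans. Qed.

Lemma switch_unique z : is_ytilde u rho delta m z -> z = yt.
Proof.
move=> [/andP[z1 _]]; rewrite w0E /F; have [h _] := yhat_spec.
have z0 := lt_trans h z1; case: (ltgtP z yt) => // hz e.
  by have := yt_lo z0 hz; rewrite -e ltxx.
by have := yt_hi hz; rewrite -e ltxx.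
Qed.

Lemma is_ytilde_switch : is_ytilde u rho delta m yt.
Proof. by split=> //; rewrite w0E. Qed.

Lemma Fbar_never y0 : 0 <= y0 -> Fbar u r rho m y0 = (V y0)%:E.
Proof.
have yt0 := switch_gt0; case/andP: yt_in => _ ytb.
apply: Fbar_stop_value => //.
- by move=> z; rewrite le_eqVlt => /predU1P[<-|/yt_hi/ltW//]; rewrite yt_eq.
- move=> z; rewrite le_eqVlt => /predU1P[<- _|z0].
    have := cont_le0 vP r_gt0 r_lt_rho C_ge0 q_ge0 growth_rate grow (lexx 0).
    by have := m_gt0; rewrite (cost0 vP); lra.
  by rewrite le_eqVlt => /predU1P[->|/(yt_lo z0)/ltW//]; rewrite yt_eq.
- move=> p y T ki bp yT [y1 _ ode] s t s0 st tT.
  apply: (cont_supersolution vP r_gt0 r_lt_rho bp.2 ode C_ge0 q_ge0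
    growth_rate grow ki s0 st tT); apply: yT => //; lra.
- move=> p y y1 y10 bp ode ki tail a ha.
  exact: (cont_bound_infinite vP r_gt0 r_lt_rho bp.2 ode C_ge0 q_ge0
    growth_rate grow ki y10 ha tail).
- move=> y1 h; have y10 := lt_trans yt0 h.
  exact: (Fbar_ge_never vP r_gt0 r_lt_rho (ltW m_gt0) C_ge0 q_ge0 growth_rate grow y10).
Qed.

Lemma never_value_lt x z : 0 <= x -> x < z -> V z < V x.
Proof.
move=> x0 xz; rewrite /stop_value; have yt0 := switch_gt0.
have dec a b : 0 < a -> a < b -> cont b < cont a.
  exact: (cont_lt vP r_gt0 r_lt_rho C_ge0 q_ge0 growth_rate grow).
case: (leP z yt) => zt; case: (leP x yt) => xt.
- by rewrite ltrN2 (cost_lt vP).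
- by have := lt_trans xt xz; rewrite ltNge zt.
- have h1 := dec _ _ yt0 zt; have h2 := cost_le vP x0 xt.
  by move: yt_eq h1 h2; lra.
- by rewrite ltrD2r; apply: dec => //; exact: lt_trans xt.
Qed.

(** At a price e * y^(gamma - 1), both the bound on disc_conj and the term P * y are
    of order y^gamma, with factors of order e^q and e. As q > 1, the second one wins
    for small e. *)
Lemma cont_growth : exists A B : R, [/\ 0 < A, 0 <= B &
  forall y, 0 < y -> cont y <= B - A * y `^ gamma].
Proof.
have q1 := q_gt1; have q10 : 0 < q - 1 by rewrite subr_gt0.
have g0 : 0 < gamma by exact: lt_trans ltr01 gamma_gt1.
have eta0 : 0 < rho - (rho - r) * q by rewrite subr_gt0; exact: growth_rate.
pose K := rho * C / (rho - (rho - r) * q).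
have K0 : 0 <= K by rewrite divr_ge0 ?(ltW eta0)// mulr_ge0// ltW.
pose L := K * delta `^ q; have L0 : 0 <= L by rewrite mulr_ge0// powR_ge0.
pose h := (2 * (L + 1))^-1; have h0 : 0 < h by rewrite invr_gt0 mulr_gt0// ltr_wpDl.
pose e := h `^ (q - 1)^-1; have e0 : 0 < e by exact: powR_gt0.
have eq1 : e `^ q = e * h.
  have {1}-> : q = 1 + (q - 1) by lra.
  rewrite powRD ?(gt_eqF e0) ?implybT// powRr1 ?(ltW e0)//; congr (_ * _).
  by rewrite /e -powRrM mulVf ?powRr1 ?gt_eqF// ltW.
exists (e / 2), K; split=> //; first by rewrite divr_gt0.
move=> y y0; set Y := y `^ gamma; have Y0 : 0 <= Y by exact: powR_ge0.
pose P := e * y `^ (gamma - 1).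
have P0 : 0 <= P by rewrite mulr_ge0 ?powR_ge0// ltW.
have Py : P * y = e * Y.
  rewrite /P -mulrA; congr (_ * _).
  by rewrite /Y -(mulr_powRB1 (ltW y0) g0) mulrC.
have Pq : P `^ q = e * h * Y.
  rewrite /P powRM ?powR_ge0 ?(ltW e0)// eq1 -powRrM; congr (_ * (_ `^ _)).
  by rewrite mulrC divfK// gt_eqF// subr_gt0.
have := cont_le vP r_gt0 r_lt_rho C_ge0 q_ge0 growth_rate grow (ltW y0) P0.
move=> /le_trans; apply.
have := disc_conj_bound vP r_gt0 r_lt_rho C_ge0 q_ge0 growth_rate grow P0.
rewrite -/K powRM ?(ltW d_gt0)// Pq Py.
have LE : L * (e * h * Y) <= e / 2 * Y.
  have : L * h <= 1 / 2.
    rewrite /h ler_pdivrMr; last by rewrite mulr_gt0// ltr_wpDl.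
    lra.
  have eY : 0 <= e * Y by rewrite mulr_ge0// ltW.
  by move=> /(ler_wpM2r eY); lra.
rewrite /L in LE; move: LE; move: (delta `^ q) (disc_conj _ _ _ _ _) => D B; lra.
Qed.

(** For y >= 1 the value is at most its value -eta at 1. Beyond yt, a weighted mean of
    this bound and of cont_growth, with weight theta on the latter, eliminates the
    additive constant B. *)
Lemma never_value_growth : exists cbar0 cbar1 : R, [/\ 0 < cbar0, 0 < cbar1 &
  forall y, 0 <= y -> cbar0 * (-1 - y `^ gamma) <= V y <= cbar1 * (1 - y `^ gamma)].
Proof.
have yt0 := switch_gt0; have [a a0 va] := cost_growth.
have g0 : 0 < gamma by exact: lt_trans ltr01 gamma_gt1.
have [A [B [A0 B0 hB]]] := cont_growth.
have V0 : V 0 = 0 by rewrite /stop_value (ltW yt0) (cost0 vP) oppr0.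
have V1 : V 1 < 0 by rewrite -V0; exact: never_value_lt.
pose eta := - V 1; have eta0 : 0 < eta by rewrite oppr_gt0.
pose theta := eta / (B + eta).
have Be : 0 < B + eta by lra.
have th0 : 0 < theta by rewrite divr_gt0.
have th1 : theta * (B + eta) = eta by rewrite divfK// gt_eqF.
have T0 := powR_ge0 yt gamma; have T1 : 0 < 1 + yt `^ gamma by lra.
pose c := Num.min (theta * A) (eta / (1 + yt `^ gamma)).
have cp : 0 < c by rewrite lt_min mulr_gt0//= divr_gt0.
have cA : c <= theta * A by rewrite ge_min lexx.
have cT : c * (1 + yt `^ gamma) <= eta by rewrite -ler_pdivlMr// ge_min lexx orbT.
exists (2 * a + 1), c; split=> //; first by lra.
move=> y y0; have Y0 := powR_ge0 y gamma.
apply/andP; split.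
  have h1 : y <= 1 + y `^ gamma.
    have [y1|y1] := leP y 1; first by lra.
    apply: (@le_trans _ _ (y `^ gamma)); last by lra.
    by rewrite -{1}(powRr1 y0); apply: ler_powR; exact: ltW.
  have h2 : - v y <= V y.
    rewrite /stop_value; case: (leP y yt) => // h; exact/ltW/yt_hi.
  have := ler_wpM2l a0 h1; have := va y y0.
  by move: h2; move: (v y) (V y) (y `^ gamma) Y0 => *; lra.
have Vle0 : V y <= 0.
  by move: y0; rewrite le_eqVlt => /predU1P[<-|h]; [rewrite V0|rewrite -V0 ltW// never_value_lt].
have [y1|y1] := leP y 1.
  have : y `^ gamma <= 1.
    have -> : 1 = (1 : R) `^ gamma by rewrite powR1.
    by apply: ge0_ler_powR; rewrite ?nnegrE ?(ltW g0).
  by move: Vle0 cp; move: (V y) (y `^ gamma) => *; nra.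
have Vy : V y <= - eta by rewrite /eta opprK ltW// never_value_lt.
have [yyt|yyt] := leP y yt.
  have : y `^ gamma <= yt `^ gamma by apply: ge0_ler_powR; rewrite ?nnegrE ?(ltW g0) ?(ltW yt0).
  move: Vy cp cT Y0; move: (V y) (y `^ gamma) (yt `^ gamma) => *; nra.
have yp : 0 < y by lra.
have VW : V y <= B - A * y `^ gamma.
  have := hB y yp; rewrite /stop_value (leNgt y) yyt /=; move: m_gt0; lra.
have th2 : 0 <= 1 - theta by rewrite subr_ge0 /theta ler_pdivrMr// mul1r; lra.
have := ler_wpM2l th2 Vy; have := ler_wpM2l (ltW th0) VW; have := ler_wpM2r Y0 cA.
move: th1 cp; move: (V y) (y `^ gamma) => *; lra.
Qed.

Lemma Fbar_never_fin :
  (forall z, 0 <= z -> z <= yt -> fine (Fbar u r rho m z) = F u z) /\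
  (forall z, yt < z -> fine (Fbar u r rho m z) = cont z - m).
Proof.
split=> z; first by move=> z0 zt; rewrite (Fbar_never z0) /stop_value zt.
move=> zt; have z0 := lt_trans switch_gt0 zt.
by rewrite (Fbar_never (ltW z0)) /stop_value leNgt zt.
Qed.

Lemma Fbar_never_C2 : C2_on (@Rplus R `\ yt) (fun y => fine (Fbar u r rho m y)).
Proof.
have yt0 := switch_gt0; have [lo hi] := Fbar_never_fin.
have dP x (h : yt < x) := is_derive_price vP r_gt0 r_lt_rho C_ge0 q_ge0 growth_rate grow (lt_trans yt0 h).
apply: (C2_glue lo hi (f1 := fun z => - dv z) (h1 := fun z => - price z)
  (f2 := fun z => - curvature z)
  (h2 := fun z => - ((rho - r) * price z * (r * (z - conj_arg dv (delta * price z)))^-1))).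
- exact: F_has_derR.
- by move=> x x0; apply: has_derRN; exact: marginal_has_derR.
- by move=> x x0; apply: cvgN; exact: curvature_cvg.
- move=> x xt; have x0 := lt_trans yt0 xt.
  have := is_derive_cont vP r_gt0 r_lt_rho C_ge0 q_ge0 growth_rate grow x0.
  move=> h; apply: is_derive_eq (is_deriveB h (is_derive_cst m x 1)) _.
  by rewrite subr0.
- by move=> x xt; apply: is_deriveN; exact: dP.
- move=> x xt; have x0 := lt_trans yt0 xt.
  have cp := price_continuous vP r_gt0 r_lt_rho C_ge0 q_ge0 growth_rate grow x0.
  have sl := price_slack vP r_gt0 r_lt_rho C_ge0 q_ge0 growth_rate grow x0.
  apply: cvgN; apply: cvgM; first by apply: cvgM; [exact: cvg_cst|exact: cp].
  apply: cvgV; first by rewrite mulf_neq0 ?gt_eqF// subr_gt0.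
  apply: cvgM; first exact: cvg_cst.
  apply: cvgB; first exact: cvg_id.
  apply: (@continuous_comp _ _ _ (fun z : R => delta * price z) (conj_arg dv) x).
    by apply: cvgM; [exact: cvg_cst|exact: cp].
  exact: (conj_arg_continuous vP).
Unshelve. all: by end_near. Qed.

Lemma Fbar_never_not_C2 : price yt < dv yt ->
  ~ C2_on (@Rplus R) (fun y => fine (Fbar u r rho m y)).
Proof.
move=> h; have yt0 := switch_gt0; have [lo hi] := Fbar_never_fin.
apply: (not_C2_kink yt0 lo hi (a := - dv yt) (b := - price yt)).
- by apply: F_has_derR; exact: ltW.
- have d := is_derive_cont vP r_gt0 r_lt_rho C_ge0 q_ge0 growth_rate grow yt0.
  apply: is_derive_eq (is_deriveB d (is_derive_cst m yt 1)) _.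
  by rewrite subr0.
- exact: yt_eq.
- by rewrite eqr_opp gt_eqF.
Qed.

End Switch.

(** When the dual function is finite, the value of serving promises forever replaces
    the constant -m of Fbar_abandon. *)
Lemma never_solution : exists yt, [/\ 0 < yt, unique (is_ytilde u rho delta m) yt,
  C2_on (@Rplus R `\ yt) (fun y => fine (Fbar u r rho m y)),
  ~ C2_on (@Rplus R) (fun y => fine (Fbar u r rho m y)) &
  exists V : R -> R, [/\
    forall y, 0 <= y -> Fbar u r rho m y = (V y)%:E,
    forall y, 0 <= y -> V y =
      F u y * \1_(`[0, yt]) y + (w0 u rho delta y - m) * \1_(`]yt, +oo[) y,
    forall x z, 0 <= x -> x < z -> V z < V x &
    exists cbar0 cbar1 : R, [/\ 0 < cbar0, 0 < cbar1 & forall y, 0 <= y ->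
      cbar0 * (-1 - y `^ gamma) <= V y <= cbar1 * (1 - y `^ gamma)]]].
Proof.
have [yt [yt_in yt_eq kink yt_lo yt_hi]] := switch_exists.
exists yt; split.
- exact: switch_gt0 yt_in.
- split; first exact: is_ytilde_switch yt_in yt_eq.
  by move=> z hz; rewrite (switch_unique yt_lo yt_hi hz).
- exact: (Fbar_never_C2 yt_in yt_eq yt_lo yt_hi).
- exact: (Fbar_never_not_C2 yt_in yt_eq yt_lo yt_hi kink).
exists (stop_value v (fun z => cont z - m) yt); split.
- exact: (Fbar_never yt_in yt_eq yt_lo yt_hi).
- by move=> y y0; rewrite stop_valueE// w0E.
- exact: (never_value_lt yt_in yt_eq).
- exact: (never_value_growth yt_in yt_eq yt_hi).
Qed.

End NeverRetire.

End Contract.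

End Utility.

Theorem proposition3p10 (R : realType) (r rho delta m gamma c0 c1 : R)
  (u : R -> R)
  (r_gt0 : 0 < r) (rho_gt0 : 0 < rho) (m_gt0 : 0 < m)
  (deltaE : delta = r / rho)
  (u_ge0 : forall x, 0 <= x -> 0 <= u x)
  (u_incr : forall x z, 0 <= x -> x < z -> u x < u z)
  (u_concave : strictly_concave_on Rplus u)
  (u_C2 : C2_on Rplus u)
  (u_0 : u 0 = 0)
  (u_inada : deriv_Rplus u x @[x --> +oo] --> (0 : R))
  (gamma_gt1 : 1 < gamma) (c0_gt0 : 0 < c0) (c1_gt0 : 0 < c1)
  (u_growth : forall x, 0 <= x ->
     c0 * (-1 + x `^ gamma^-1) <= u x <= c1 * (1 + x `^ gamma^-1))
  (F_dm_decr : forall x z, 0 <= x -> x < z ->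
     F_dm u delta m z < F_dm u delta m x)
  (F_dm_oo : F_dm u delta m x @[x --> +oo] --> -oo)
  (delta_lt1 : delta < 1) :
  [/\ gamma * delta <= 1 -> forall y, 0 <= y ->
        Fbar u r rho m y =
          (F u y * \1_(`[0, yhat u m]) y - m * \1_(`]yhat u m, +oo[) y)%:E,
      1 < gamma * delta -> exists ytilde : R,
        unique (is_ytilde u rho delta m) ytilde /\
        forall y, 0 <= y ->
          Fbar u r rho m y =
            (F u y * \1_(`[0, ytilde]) y
             + (w0 u rho delta y - m) * \1_(`]ytilde, +oo[) y)%:E,
      exists y1 : R,
        [/\ 0 <= y1,
            C2_on (Rplus `\ y1) (fun y => fine (Fbar u r rho m y)) &
            ~ C2_on Rplus (fun y => fine (Fbar u r rho m y))] &
      1 < gamma * delta ->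
        (forall x z, 0 <= x -> x < z ->
           (Fbar u r rho m z < Fbar u r rho m x)%E) /\
        exists cbar0 cbar1 : R,
          [/\ 0 < cbar0, 0 < cbar1 &
              forall y, 0 <= y ->
                ((cbar0 * (-1 - y `^ gamma))%:E <= Fbar u r rho m y
                 <= (cbar1 * (1 - y `^ gamma))%:E)%E]].
Proof.
subst delta.
have r_lt_rho : r < rho by move: delta_lt1; rewrite ltr_pdivrMr// mul1r.
have [C C0 grow] := conj_growth u_ge0 u_incr u_concave u_C2 u_0 u_inada gamma_gt1 c0_gt0
  c1_gt0 u_growth.
have [yh0 _] := yhat_spec u_ge0 u_incr u_concave u_C2 u_0 u_inada gamma_gt1 c0_gt0
  u_growth m_gt0.
have never gd := never_solution u_ge0 u_incr u_concave u_C2 u_0 u_inada gamma_gt1 c0_gt0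
  u_growth r_gt0 r_lt_rho m_gt0 F_dm_decr F_dm_oo gd C0 grow.
split.
- move=> gd y y0; rewrite -mulNr -(stop_valueE u (cst (- m)))//.
  exact: (Fbar_abandon u_ge0 u_incr u_concave u_C2 u_0 u_inada gamma_gt1 c0_gt0
    u_growth r_gt0 r_lt_rho m_gt0 F_dm_decr F_dm_oo gd y0).
- move=> /never[yt [_ yt_uniq _ _ [V [FV VE _ _]]]]; exists yt; split=> // y y0.
  by rewrite FV// VE.
- have [gd|/never[yt [yt0 _ C2 nC2 _]]] := leP (gamma * (r / rho)) 1; last first.
    by exists yt; split; [exact: ltW|exact: C2|exact: nC2].
  exists (yhat u m); split; first exact: ltW.
    exact: (Fbar_abandon_C2 u_ge0 u_incr u_concave u_C2 u_0 u_inada gamma_gt1 c0_gt0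
      u_growth r_gt0 r_lt_rho m_gt0 F_dm_decr F_dm_oo gd).
  exact: (Fbar_abandon_not_C2 u_ge0 u_incr u_concave u_C2 u_0 u_inada gamma_gt1 c0_gt0
    u_growth r_gt0 r_lt_rho m_gt0 F_dm_decr F_dm_oo gd).
- move=> /never[yt [_ _ _ _ [V [FV _ Vdec [k0 [k1 [k0_gt0 k1_gt0 kV]]]]]]]; split.
    move=> x z x0 xz; rewrite !FV ?lte_fin ?Vdec//; exact: le_trans x0 (ltW xz).
  by exists k0, k1; split=> // y y0; rewrite FV// !lee_fin; exact: kV.
Qed.
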